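(* Fix $\epsilon\in(0,1)$, $\delta\in(0,\tfrac1e)$ and $B>0$. Let $C_1,C_2$ be such that \[ \frac{2\sqrt{C_2}}{C_1(\sqrt{C_2}-1)^2}\le\frac{\epsilon}{B^2} \] (e.g. $C_1=B^2$ and $C_2=\tfrac{14}{\epsilon^2}$). Let $A$ be an $(n\times d)$-matrix in which every row has $\ell_2$-norm at most $B$. Let $N$ be sampled from the $d$-dimensional Wishart distribution with $\nu$ degrees of freedom and scale matrix $V$, i.e. $N\sim\mathcal W_d(V,\nu)$, for any matrix $V$ with least singular value $\sigma_{\min}(V)\ge C_1$ (e.g. $V=C_1I_{d\times d}$) and $\nu\ge\lfloor d+2C_2\ln(4/\delta)\rfloor$. Then the algorithm outputting $X=A^{\top}A+N$ is $(\epsilon,\delta)$-differentially private.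
   Context: The Wishart distribution $\mathcal W_d(V,m)$ (for positive definite $V$) is the distribution of $\sum_{i=1}^m\mathbf g_i\mathbf g_i^{\top}$ with $\mathbf g_1,\dots,\mathbf g_m$ i.i.d. $\mathcal N(\mathbf 0_d,V)$. Two $(n\times d)$-matrices are neighbors if they differ in exactly one row. A randomized algorithm on $(n\times d)$-matrices with rows of $\ell_2$-norm at most $B$ is $(\epsilon,\delta)$-differentially private if for all neighboring such inputs $A,A'$ and every measurable set $S$ of outputs, $\Pr[\mathsf{ALG}(A)\in S]\le e^{\epsilon}\Pr[\mathsf{ALG}(A')\in S]+\delta$.
   Formalization: The formal theorem additionally assumes C_1 > 0 and C_2 > 1; without these the claim fails, e.g. for negative C_1 (the conditions become vacuous and V may be tiny) or for C_2 near 0 (tiny C_1 and ν = d). *)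

(* Defs.v *)
From HB Require Import structures.
From mathcomp Require Import all_boot all_order all_algebra.
From mathcomp Require Import all_classical all_reals all_analysis.

Set Implicit Arguments.
Unset Strict Implicit.
Unset Printing Implicit Defensive.

Import Order.TTheory GRing.Theory Num.Theory.
Import numFieldNormedType.Exports.

Local Open Scope classical_set_scope.
Local Open Scope ring_scope.

Section defs.
Context {R : realType}.

Definition mx_borel (m n : nat) : set (set 'M[R]_(m, n)) :=
  <<s [set: 'M[R]_(m, n)], open >>.

Definition l2norm_row (d : nat) (x : 'rV[R]_d) : R :=
  Num.sqrt (\sum_(j < d) x 0 j ^+ 2).
Definition l2norm_col (d : nat) (x : 'cV[R]_d) : R :=
  Num.sqrt (\sum_(j < d) x j 0 ^+ 2).

Definition sigma_min (d : nat) (V : 'M[R]_d) : R :=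
  inf [set l2norm_col (V *m x) | x in [set x : 'cV[R]_d | l2norm_col x = 1]].

Definition posdef (d : nat) (V : 'M[R]_d) : Prop :=
  V^T = V /\ forall x : 'cV[R]_d, x != 0 -> 0 < (x^T *m V *m x) 0 0.

Definition rows_bounded (n d : nat) (B : R) (A : 'M[R]_(n, d)) : Prop :=
  forall i : 'I_n, l2norm_row (row i A) <= B.

Definition neighbors (n d : nat) (A A' : 'M[R]_(n, d)) : Prop :=
  exists i : 'I_n, row i A != row i A' /\
    forall j : 'I_n, j != i -> row j A = row j A'.

Context {dT : measure_display} {T : measurableType dT}.

Definition mx_rv (m n : nat) (X : T -> 'M[R]_(m, n)) : Prop :=
  forall S, mx_borel S -> measurable (X @^-1` S).

(* g ~ N(0, V) (V positive definite): g is a random vector every nonzero linear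
   functional u^T g of which is a univariate normal N(0, u^T V u) *)
Definition gaussian_vec (P : probability T R) (d : nat) (V : 'M[R]_d)
    (g : T -> 'cV[R]_d) : Prop :=
  mx_rv g /\
  forall u : 'cV[R]_d, u != 0 -> forall S : set R, measurable S ->
    P ((fun w => (u^T *m g w) 0 0) @^-1` S) =
    normal_prob 0 (Num.sqrt ((u^T *m V *m u) 0 0)) S.

Definition mutually_independent (P : probability T R) (m d : nat)
    (g : 'I_m -> T -> 'cV[R]_d) : Prop :=
  forall S : 'I_m -> set 'cV[R]_d, (forall i, mx_borel (S i)) ->
    P [set w | forall i, S i (g i w)] =
    (\prod_(i < m) P (g i @^-1` S i))%E.

Definition wishart (P : probability T R) (d : nat) (V : 'M[R]_d) (m : nat)
    (N : T -> 'M[R]_d) : Prop :=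
  exists g : 'I_m -> T -> 'cV[R]_d,
    (forall i, gaussian_vec P V (g i)) /\ mutually_independent P g /\
    forall w, N w = \sum_(i < m) (g i w *m (g i w)^T).

Definition diff_private (P : probability T R) (n d p q : nat) (B eps delta : R)
    (M : 'M[R]_(n, d) -> T -> 'M[R]_(p, q)) : Prop :=
  forall A A' : 'M[R]_(n, d), rows_bounded B A -> rows_bounded B A' ->
    neighbors A A' ->
    forall S, mx_borel S ->
      (P (M A @^-1` S) <= (expR eps)%:E * P (M A' @^-1` S) + delta%:E)%E.

End defs.

(* Main.v *)
Require Import Defs.
From HB Require Import structures.
From mathcomp Require Import all_boot all_order all_algebra.
From mathcomp Require Import all_classical all_reals all_analysis.
From mathcomp Require Import measurable_realfun.
From mathcomp Require Import ring lra.
Import Order.TTheory GRing.Theory Num.Theory.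
Import numFieldNormedType.Exports.
Set Implicit Arguments.
Unset Strict Implicit.
Unset Printing Implicit Defensive.
Local Open Scope classical_set_scope.
Local Open Scope ring_scope.

(** Replacing row [a] by [b] changes [A^T *m A] from [K + a a^T] to [K + b b^T], so it suffices to
    compare [K + a a^T + N] with [K + N], and [K + N] with [K + b b^T + N].  Normalize
    [u = V^-1 a / sqrt p] with [p = a^T V^-1 a <= B^2 / C1] and write [g i = x i *: V u + h i] with
    [x i = u^T g i]: the [x i] are i.i.d. standard normal, and independent of the residuals [h i],
    which all lie in the hyperplane [u^T h = 0].  For fixed residuals there is therefore an
    orthogonal matrix whose first [k = nu - d + 1] rows annihilate them; in the rotated coordinates
    [y] of [x], the matrix [K + q v v^T + N], [v = V u], depends on [y_1, ..., y_k] only through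
    [y_1^2 + ... + y_k^2 + q].  The problem is thus reduced to shifting a chi-square variable with
    [k] degrees of freedom by [p]: its density ratio is controlled away from the lower and upper
    tails, and each tail has probability at most [delta / 4] by a Chernoff bound.

    Joint laws are identified from real characteristic functions [E cos (sum_i u_i X_i + phi)]. *)

(** * Characteristic functions *)

(** [gaussian_vec] constrains one-dimensional functionals only, so the joint law of the [x i] and
    [h i] has to be recovered from those; hence the multivariate uniqueness theorem. Independence is
    then used in one form: two blocks may be read from separate sample points of [P \x P], so that
    conditioning on a block means taking a section. Normalizing constants are never computed: the
    chi-square law is known up to a factor fixed by total mass 1, shared by both sides of the
    comparison. With [Q = B^2 / C1] and [w = 1 / sqrt C2] the hypothesis on [C1] and [C2] reads
    [2 Q w <= eps (1 - w)^2]. Cutting the chi-square law near [k (1 + w)^2] or [k (1 - w)^2] costs,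
    up to terms of order [1 / k], at most [Q w / (1 - w)^2] per step, so the two steps share [eps].
    The tails compose to [e^loss * delta / 4 + delta / 4], at most [delta] because [e <= 3]; this is
    the origin of [ln (4 / delta)]. Confining the residuals to a hyperplane gains one degree of
    freedom, [k = nu + 1 - d], which is exactly what the floor in the bound on [nu] gives away. *)

Section normal_char.
Context {R : realType}.
Local Notation mu := (@lebesgue_measure R).

Lemma normal_pdf01E (x : R) :
  normal_pdf 0 1 x = normal_peak 1 * expR (- (x ^+ 2 / 2)).
Proof.
by rewrite normal_pdfE ?oner_eq0// /normal_fun subr0 expr1n mulNr -[1 *+ 2]/(2%:R).
Qed.

Lemma is_derive_normal_pdf01 (x : R) :
  is_derive x 1 (normal_pdf 0 1) (- (x * normal_pdf 0 1 x)).
Proof.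
have -> : normal_pdf 0 1 = (fun x : R => normal_peak 1 * expR (- (x ^+ 2 / 2))).
  by apply/funext => y; rewrite normal_pdf01E.
apply: is_derive_eq.
rewrite /GRing.scale /= /GRing.scale/=.
by field.
Qed.

Lemma normal_pdf01_sym (x : R) : normal_pdf 0 1 (- x) = normal_pdf 0 1 x.
Proof. by rewrite !normal_pdf01E sqrrN. Qed.

(** Doubling the standard deviation absorbs the factor [|x|]: [x^2/2] splits as [3x^2/8 + x^2/8],
    the second term belongs to the density with [s = 2], and
    [|x| <= 3 (1 + 3x^2/8) <= 3 exp (3x^2/8)]. *)
Lemma integrable_norm_normal_pdf01 :
  mu.-integrable setT (fun x : R => (`|x| * normal_pdf 0 1 x)%:E).
Proof.
pose s : R := 2.
have s0 : s != 0 by rewrite /s pnatr_eq0.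
pose C : R := 3 * normal_peak 1 / normal_peak s.
have : mu.-integrable setT (fun x : R => C%:E * (normal_pdf 0 s x)%:E)%E.
  by apply: integrableZl => //; exact: integrable_normal_pdf.
apply: le_integrable => //.
  apply/measurable_EFinP; apply: measurable_funM; first exact: normr_measurable.
  exact: measurable_normal_pdf.
move=> x _.
have pp := @normal_peak_gt0 R s s0.
rewrite -EFinM !abse_EFin lee_fin !normrM normr_id !(ger0_norm (normal_pdf_ge0 _ _ _)).
rewrite /C (ger0_norm (normal_peak_ge0 _)) normr_nat.
have -> : `|(normal_peak s)^-1| = (normal_peak s)^-1 by apply: gtr0_norm; rewrite invr_gt0.
rewrite normal_pdf01E normal_pdfE// /normal_fun subr0.
rewrite [leRHS](_ : _ = 3 * normal_peak 1 * expR (- x ^+ 2 / (s ^+ 2 *+ 2))); last first.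
  by rewrite mulrA divfK// gt_eqF.
rewrite mulrCA -mulrA [leRHS]mulrCA ler_wpM2l ?normal_peak_ge0//.
have -> : - (x ^+ 2 / 2) = (- (3 * x ^+ 2 / 8)) + (- x ^+ 2 / (s ^+ 2 *+ 2)).
  by rewrite /s -mulr_natr; field.
rewrite expRD mulrA ler_wpM2r ?expR_ge0// expRN ler_pdivrMr ?expR_gt0//.
have h := @expR_ge1Dx R (3 * x ^+ 2 / 8).
have h2 : 0 <= (`|x| - 1) ^+ 2 by exact: sqr_ge0.
have h3 : `|x| ^+ 2 = x ^+ 2 by rewrite real_normK// num_real.
by nra.
Unshelve. all: try by []. Qed.

(** The fundamental theorem on [[-(n+1), n+1]] followed by dominated convergence; it serves as
    integration by parts on the whole line with vanishing boundary terms. *)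
Lemma Rintegral_derive_eq0 (h h' : R -> R) :
  (forall x : R, is_derive x 1 h (h' x)) -> continuous h' ->
  mu.-integrable setT (EFin \o h') ->
  h (n.+1%:R) @[n --> \oo] --> (0 : R) -> h (- n.+1%:R) @[n --> \oo] --> (0 : R) ->
  \int[mu]_x h' x = 0.
Proof.
move=> dh ch' ih' hy hNy.
pose f_ n := (EFin \o h') \_ `[- n.+1%:R, n.+1%:R].
have mh' : measurable_fun setT (EFin \o h') by have /integrableP[] := ih'.
have [] := @dominated_convergence _ _ _ mu setT measurableT f_ (EFin \o h')
  (abse \o (EFin \o h')).
- move=> n; apply: (measurable_restrictT _ (measurable_itv `[- n.+1%:R, n.+1%:R])).1.
  exact: measurable_funTS.
- exact: mh'.
- apply/aeW => x _; apply: cvg_near_cst.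
  near=> n; rewrite /f_ patchE mem_set//= in_itv/= -ler_norml.
  rewrite (@le_trans _ _ n%:R) ?ler_nat//.
  by near: n; exact: nbhs_infty_ger.
- exact: integrable_abse.
- apply/aeW => x n _; rewrite /f_ patchE; case: ifPn => //= _.
  by rewrite normr0 lee_fin.
move=> _ _ /=.
have fE n : (\int[mu]_x f_ n x = (h n.+1%:R - h (- n.+1%:R))%:E)%E.
  rewrite /f_ -integral_mkcond (@continuous_FTC2 _ _ h)//.
  - by rewrite gtrN.
  - exact: continuous_subspaceT.
  - split.
    + by move=> x _; apply: ex_derive.
    + apply: cvg_at_right_filter; apply: differentiable_continuous.
      exact/derivable1_diffP/ex_derive.
    + apply: cvg_at_left_filter; apply: differentiable_continuous.
      exact/derivable1_diffP/ex_derive.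
  - by move=> x _; rewrite derive1E; exact: derive_val.
under eq_fun do rewrite fE.
move=> hc.
have h0 : (h n.+1%:R - h (- n.+1%:R))%:E @[n --> \oo] --> 0%:E.
  apply: cvg_EFin; first exact: nearW.
  by rewrite -[X in _ --> X]subr0; exact: cvgB.
by rewrite /Rintegral (cvg_unique _ hc h0).
Unshelve. all: by end_near. Qed.

Lemma integrable_trig_normal_pdf01 (g : R -> R) : measurable_fun setT g ->
  (forall x, `|g x| <= 1) ->
  mu.-integrable setT (fun x => (g x * normal_pdf 0 1 x)%:E).
Proof.
move=> mg g1; apply: le_integrable (integrable_normal_pdf 0 1) => //.
  by apply/measurable_EFinP/measurable_funM => //; exact: measurable_normal_pdf.
move=> x _; rewrite lee_fin normrM ler_piMl//; exact: g1.
Qed.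

Lemma normal_pdf01_le_inv (x : R) : 0 < x ->
  normal_pdf 0 1 x <= 2 * normal_peak 1 / x ^+ 2.
Proof.
move=> x0; rewrite normal_pdf01E [leRHS](_ : _ = normal_peak 1 * (x ^+ 2 / 2)^-1); last first.
  by rewrite invf_div mulrCA mulrA.
rewrite ler_wpM2l ?normal_peak_ge0//.
rewrite expRN lef_pV2 ?posrE ?expR_gt0 ?divr_gt0 ?exprn_gt0//.
by rewrite (le_trans _ (expR_ge1Dx _))// lerDr.
Qed.

Lemma cvg_harmonic_dominated (u : nat -> R) (c : R) :
  (forall n, `|u n| <= c / n.+1%:R ^+ 2) -> u n @[n --> \oo] --> (0 : R).
Proof.
move=> uc; apply/norm_cvg0P.
have c0 : 0 <= c.
  by have := le_trans (normr_ge0 _) (uc 0%N); rewrite expr1n divr1.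
apply: (@squeeze_cvgr _ _ _ _ (fun=> 0) (fun n => c * harmonic n)).
- near=> n; rewrite normr_ge0/= (le_trans (uc n))// ler_wpM2l//.
  rewrite lef_pV2 ?posrE ?exprn_gt0// expr2 ler_peMl// ?ler1n//.
- exact: cvg_cst.
- by rewrite -[X in _ --> X](mulr0 c); apply: cvgM; [exact: cvg_cst|exact: cvg_harmonic].
Unshelve. all: by end_near. Qed.

(** As a function [C] of [t] the integral solves [C' = - t C]. The phase [phi] lets one real family
    play the role of the complex exponentials: it covers cosine and sine at once. *)
Lemma Rintegral_normal_cos (t phi : R) :
  \int[mu]_x (cos (t * x + phi) * normal_pdf 0 1 x) = expR (- (t ^+ 2 / 2)) * cos phi.
Proof.
pose f (t x : R) := cos (t * x + phi) * normal_pdf 0 1 x.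
pose C t := \int[mu]_x f t x.
have mcos (s : R) : measurable_fun setT (fun x : R => cos (s * x + phi)).
  by apply: continuous_measurable_fun => x; apply: continuous_comp;
    [apply: cvgD; [apply: cvgM; [exact: cvg_cst|exact: cvg_id]|exact: cvg_cst]
    |exact: continuous_cos].
have msin (s : R) : measurable_fun setT (fun x : R => sin (s * x + phi)).
  by apply: continuous_measurable_fun => x; apply: continuous_comp;
    [apply: cvgD; [apply: cvgM; [exact: cvg_cst|exact: cvg_id]|exact: cvg_cst]
    |exact: continuous_sin].
have ncos (y : R) : `|cos y| <= 1 by rewrite ler_norml cos_geN1 cos_le1.
have nsin (y : R) : `|sin y| <= 1 by rewrite ler_norml sin_geN1 sin_le1.
have intf (s : R) : mu.-integrable setT (EFin \o f s).
  by apply: integrable_trig_normal_pdf01 => //.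
have df (s x : R) : is_derive s 1 (f ^~ x) (- (x * normal_pdf 0 1 x * sin (s * x + phi))).
  apply: is_derive_eq.
  rewrite /GRing.scale /= /GRing.scale/=.
  by ring.
have d1f s x : partial1of2 f s x = - (x * normal_pdf 0 1 x * sin (s * x + phi)).
  by rewrite partial1of2E; apply: derive_val.
have intd (s : R) : mu.-integrable setT
    (fun x : R => (x * normal_pdf 0 1 x * sin (s * x + phi))%:E).
  apply: le_integrable integrable_norm_normal_pdf01 => //.
    apply/measurable_EFinP; apply: measurable_funM; last exact: msin.
    by apply: measurable_funM => //; exact: measurable_normal_pdf.
  move=> x _; rewrite lee_fin normrM [leRHS]normrM normr_id normrM ler_piMr// mulr_ge0.
have bound (s x : R) : `|partial1of2 f s x| <= `|x| * normal_pdf 0 1 x.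
  rewrite d1f normrN !normrM (ger0_norm (normal_pdf_ge0 _ _ _)) ler_piMr//.
  by rewrite mulr_ge0// normal_pdf_ge0.
(* The derivative of [sin (s x + phi)] times the density integrates to zero; this turns the
   integrand differentiated in [s] back into [C s]. *)
have ibp (s : R) : \int[mu]_x (x * normal_pdf 0 1 x * sin (s * x + phi)) = s * C s.
  pose h x := sin (s * x + phi) * normal_pdf 0 1 x.
  pose h' x := s * f s x - x * normal_pdf 0 1 x * sin (s * x + phi).
  have h0 : \int[mu]_x h' x = 0.
    apply: (@Rintegral_derive_eq0 h h').
    - move=> x; have ? := is_derive_normal_pdf01 x.
      apply: is_derive_eq.
      rewrite /GRing.scale /= /GRing.scale/= /h' /f.
      by ring.
    - move=> x; apply: cvgB.
      + apply: cvgM; first exact: cvg_cst.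
        apply: cvgM; last exact: continuous_normal_pdf (oner_neq0 _) _.
        apply: (continuous_comp (f := fun x => s * x + phi)); last exact: continuous_cos.
        apply: cvgD; [apply: cvgM; [exact: cvg_cst|exact: cvg_id]|exact: cvg_cst].
      + apply: cvgM.
          apply: cvgM; first exact: cvg_id.
          exact: continuous_normal_pdf (oner_neq0 _) _.
        apply: (continuous_comp (f := fun x => s * x + phi)); last exact: continuous_sin.
        apply: cvgD; [apply: cvgM; [exact: cvg_cst|exact: cvg_id]|exact: cvg_cst].
    - apply: eq_integrable (integrableB measurableT (integrableZl measurableT s (intf s)) (intd s)) => //.
    - apply: (@cvg_harmonic_dominated _ (2 * normal_peak 1)) => n.
      rewrite normrM (ger0_norm (normal_pdf_ge0 _ _ _)).
      rewrite (le_trans _ (normal_pdf01_le_inv _))// ler_piMl// normal_pdf_ge0//.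
    - apply: (@cvg_harmonic_dominated _ (2 * normal_peak 1)) => n.
      rewrite normrM (ger0_norm (normal_pdf_ge0 _ _ _)) normal_pdf01_sym.
      rewrite (le_trans _ (normal_pdf01_le_inv _))// ler_piMl// normal_pdf_ge0//.
  apply/esym/eqP; rewrite -subr_eq0; apply/eqP; rewrite -[RHS]h0 /h' RintegralB//.
    by rewrite RintegralZl.
  by apply: eq_integrable (integrableZl measurableT s (intf s)) => //.
  exact: intd.
have dC (s : R) : is_derive s 1 C (- (s * C s)).
  have Is : `]s - 1, s + 1[%classic s by rewrite /= in_itv/=; apply/andP; split; lra.
  have intG : mu.-integrable setT (EFin \o (fun x : R => `|x| * normal_pdf 0 1 x)).
    exact: integrable_norm_normal_pdf01.
  have G0 (x : R) : 0 <= `|x| * normal_pdf 0 1 x by rewrite mulr_ge0// normal_pdf_ge0.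
  have derf x y : `]s - 1, s + 1[%classic x -> [set: measurableTypeR R] y -> derivable (f ^~ y) x 1.
    by move=> _ _; apply: ex_derive.
  have dCs : derivable C s 1.
    have X := (@derivable_under_integral R _ (measurableTypeR R) mu f _ measurableT _ _ _ Is
      (fun x _ => intf x) derf _ G0 intG (fun x y _ _ => bound x y)).
    exact X.
  apply: (DeriveDef dCs).
  rewrite -derive1E (@differentiation_under_integral R _ (measurableTypeR R) mu f _ measurableT _ _ _ Is
      (fun x _ => intf x) derf _ G0 intG (fun x y _ _ => bound x y)).
  rewrite -ibp -mulN1r -RintegralZl//; last exact: intd.
  by apply: eq_Rintegral => x _; rewrite d1f mulN1r.
(* The integrating factor [exp (x^2/2)] makes the solution of the differential equation constant. *)
have cst : forall x y : R, C x * expR (x ^+ 2 / 2) = C y * expR (y ^+ 2 / 2).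
  move=> x y; apply: (@is_derive_0_is_cst _ (fun s => C s * expR (s ^+ 2 / 2))) => s.
  have ? := dC s.
  apply: is_derive_eq.
  rewrite /GRing.scale /= /GRing.scale/=.
  by field.
have C0 : C 0 = cos phi.
  rewrite /C /f; under eq_Rintegral do rewrite mul0r add0r.
  rewrite RintegralZl//; last exact: integrable_normal_pdf.
  by rewrite /Rintegral integral_normal_pdf mulr1.
have := cst t 0; rewrite C0 expr0n/= mul0r expR0 mulr1 => <-.
by rewrite expRN mulrCA mulVf ?mulr1// gt_eqF// expR_gt0.
Qed.

End normal_char.

(** * Test functions integrated against a bounded weight *)

Section weighted.
Context {R : realType}.
Local Notation mu := (@lebesgue_measure R).
Context d1 (T1 : measurableType d1).
Variables (m1 : {finite_measure set T1 -> \bar R}).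
Variables (X1 : T1 -> R) (w1 : T1 -> R).
Hypotheses (mX1 : measurable_fun setT X1).
Hypotheses (mw1 : measurable_fun setT w1).
Hypotheses (w11 : forall t, `|w1 t| <= 1).

Lemma integrable_weighted (f : R -> R) (M : R) : measurable_fun setT f ->
  (forall x, `|f x| <= M) ->
  m1.-integrable setT (fun t => (f (X1 t) * w1 t)%:E).
Proof.
move=> mf fM; apply: (@measurable_bounded_integrable _ _ _ _ (fun t => f (X1 t) * w1 t)) => //.
- by rewrite -ge0_fin_numE// fin_num_measure.
- by apply: measurable_funM => //; apply: measurableT_comp.
- exists M; split; rewrite ?num_real// => y My t _ /=.
  rewrite normrM (le_trans _ (ltW My))// -[leRHS]mulr1.
  by apply: ler_pM => //; exact: fM.
Qed.

Lemma cvg_weighted (f_ : nat -> R -> R) (f : R -> R) (M : R) :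
  (forall n, measurable_fun setT (f_ n)) -> (forall n x, `|f_ n x| <= M) ->
  (forall x, f_ n x @[n --> \oo] --> f x) ->
  \int[m1]_t (f_ n (X1 t) * w1 t) @[n --> \oo] --> \int[m1]_t (f (X1 t) * w1 t).
Proof.
move=> mf fM fc.
have [] := @dominated_convergence _ _ _ m1 setT measurableT
  (fun n t => (f_ n (X1 t) * w1 t)%:E) (fun t => (f (X1 t) * w1 t)%:E) (fun=> M%:E).
- move=> n; apply/measurable_EFinP/measurable_funM => //.
  by apply: measurableT_comp.
- apply/measurable_EFinP/measurable_funM => //; apply: measurableT_comp => //.
  exact: (measurable_fun_cvg mf).
- apply/aeW => t _; apply: cvg_EFin; first exact: nearW.
  by apply: cvgM; [exact: fc|exact: cvg_cst].
- apply: (@measurable_bounded_integrable _ _ _ _ (fun=> M)) => //.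
  + by rewrite -ge0_fin_numE// fin_num_measure.
  + exact: bounded_cst.
- apply/aeW => t n _; rewrite lee_fin normrM -[leRHS]mulr1.
  by apply: ler_pM => //; exact: fM.
move=> iF _ cF.
rewrite /Rintegral; apply: fine_cvg; rewrite fineK//.
exact: integrable_fin_num.
Qed.

(** The bound [M], uniform in [x], on the integral over [s] gives integrability on the product,
    hence Fubini. The pointwise bound [g s] serves to make each integral over [T1] finite. *)
Lemma weighted_mix (h : R -> R -> R) (g : R -> R) (M : R) :
  measurable_fun setT (fun p : measurableTypeR R * R => h p.1 p.2) ->
  (forall s x, `|h s x| <= g s) ->
  (forall x, \int[mu]_s (`|h s x|%:E) <= M%:E)%E ->
  \int[m1]_t ((\int[mu]_s h s (X1 t)) * w1 t) =
  \int[mu]_s (\int[m1]_t (h s (X1 t) * w1 t)).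
Proof.
move=> mh0 hg hM.
have mh : measurable_fun setT (fun p : T1 * measurableTypeR R => h p.2 (X1 p.1)).
  apply: (measurableT_comp mh0 (g := fun p : T1 * measurableTypeR R => (p.2, X1 p.1))).
  by apply: measurable_fun_pair => //; apply: measurableT_comp.
pose F (p : T1 * measurableTypeR R) := (h p.2 (X1 p.1) * w1 p.1)%:E.
have mF : measurable_fun setT F.
  apply/measurable_EFinP/measurable_funM => //.
  exact: measurableT_comp.
have FM t : (\int[mu]_s `|F (t, s)| <= M%:E)%E.
  apply: le_trans (hM (X1 t)); apply: ge0_le_integral => //.
  - by apply: measurableT_comp => //; exact: measurable_fun_pair2.
  - apply/measurable_EFinP; apply: measurableT_comp => //.
    exact: (measurable_fun_pair2 t mh).
  - by move=> s _; rewrite lee_fin normrM ler_piMr//; exact: w11.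
have M0 : 0 <= M.
  by rewrite -lee_fin (le_trans _ (hM 0))//; apply: integral_ge0.
have maF : measurable_fun setT (abse \o F) by apply: measurableT_comp.
have iF : (m1 \x mu)%E.-integrable setT F.
  apply/integrable12ltyP => //=.
  apply: (@le_lt_trans _ _ (\int[m1]_t M%:E)%E).
    apply: ge0_le_integral => //.
    - by move=> t _; apply: integral_ge0.
    - exact: (@measurable_fun_fubini_tonelli_F _ _ _ _ _ mu (abse \o F) maF (fun=> abse_ge0 _)).
    - by move=> t _; exact: FM.
  rewrite integral_cst//= lte_mul_pinfty// ?lee_fin//.
  by rewrite -ge0_fin_numE// fin_num_measure.
have := Fubini iF.
rewrite {2}/Rintegral {3}/Rintegral => FF; congr (fine _).
rewrite (_ : (\int[m1]_x _)%E = (\int[m1]_x \int[mu]_y F (x, y))%E); last first.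
  apply: eq_integral => t _; rewrite /F /=.
  have ih : mu.-integrable setT (fun s => (h s (X1 t))%:E).
    apply/integrableP; split; last by apply: le_lt_trans (hM (X1 t)) (ltry _).
    by apply/measurable_EFinP; exact: (measurable_fun_pair2 t mh).
  under [in RHS]eq_integral do rewrite EFinM.
  by rewrite integralZr// /Rintegral EFinM fineK//; exact: integrable_fin_num.
rewrite FF; apply: eq_integral => s _; rewrite /F/=.
rewrite /Rintegral fineK//; apply: integrable_fin_num => //.
apply: (@integrable_weighted (h s) (g s)) => //.
exact: (measurable_fun_pair2 (s : measurableTypeR R) mh0).
Qed.

End weighted.

Section normal_tail.
Context {R : realType}.
Local Notation mu := (@lebesgue_measure R).

(** Comparison with the density of standard deviation [2 * sigma] replaces a variance computation.
    The ratio of peaks is 2, and [exp (- 3z / (8 sigma^2)) <= 3 sigma^2 / eta^2] on [E], whence the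
    6. *)
Lemma normal_prob_tail (x sigma eta : R) (E : set R) : 0 < sigma -> 0 < eta ->
  measurable E -> (forall y, E y -> eta <= `|y - x|) ->
  (normal_prob x sigma E <= (6 * sigma ^+ 2 / eta ^+ 2)%:E)%E.
Proof.
move=> s0 e0 mE Eeta.
have s20 : 2 * sigma != 0 by rewrite mulf_neq0// gt_eqF.
have pk : normal_peak sigma = 2 * normal_peak (2 * sigma).
  rewrite /normal_peak.
  have -> : (2 * sigma) ^+ 2 * pi *+ 2 = 2 ^+ 2 * (sigma ^+ 2 * pi *+ 2) by ring.
  by rewrite sqrtrM ?sqr_ge0// sqrtr_sqr ger0_norm// invfM mulrA divff ?mul1r ?pnatr_eq0.
apply: (@le_trans _ _ (\int[mu]_(y in E) ((6 * sigma ^+ 2 / eta ^+ 2)%:E * (normal_pdf x (2 * sigma) y)%:E)))%E.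
  apply: ge0_le_integral => //.
  - by move=> y _; rewrite lee_fin normal_pdf_ge0.
  - by apply/measurable_EFinP/measurable_funTS; exact: measurable_normal_pdf.
  - by apply/measurable_funTS/measurable_EFinP/measurable_funM => //; exact: measurable_normal_pdf.
  move=> y Ey; rewrite lee_fin !normal_pdfE ?gt_eqF ?mulr_gt0//.
  rewrite pk /normal_fun.
  have zeta : eta ^+ 2 <= (y - x) ^+ 2.
    rewrite -(@real_normK _ (y - x)) ?num_real// ler_pXn2r ?nnegrE ?(ltW e0)//.
    exact: Eeta.
  set z := (y - x) ^+ 2 in zeta *.
  have eta2 : 0 < eta ^+ 2 by rewrite exprn_gt0.
  have sg2 : 0 < sigma ^+ 2 by rewrite exprn_gt0.
  have -> : - z / (sigma ^+ 2 *+ 2) = - (3 * z / (8 * sigma ^+ 2)) + - z / ((2 * sigma) ^+ 2 *+ 2).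
    by rewrite -!(mulr_natr (_ ^+ 2)); field; rewrite gt_eqF.
  rewrite expRD.
  have key : expR (- (3 * z / (8 * sigma ^+ 2))) <= 3 * (sigma ^+ 2 / eta ^+ 2).
    rewrite expRN -[leRHS]invrK lef_pV2 ?posrE ?expR_gt0 ?invr_gt0 ?mulr_gt0 ?invr_gt0//.
    rewrite (le_trans _ (expR_ge1Dx _))// invfM invfM invrK.
    have -> : 3 * z / (8 * sigma ^+ 2) = 3 / 8 * (z * (sigma ^+ 2)^-1).
      by field; rewrite gt_eqF.
    have : eta ^+ 2 * (sigma ^+ 2)^-1 <= z * (sigma ^+ 2)^-1 by rewrite ler_pM2r ?invr_gt0.
    have : 0 <= z * (sigma ^+ 2)^-1 by rewrite mulr_ge0 ?invr_ge0 ?sqr_ge0.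
    by rewrite [(sigma ^+ 2)^-1 * _]mulrC; lra.
  set e := expR (- z / _).
  have pe : 0 <= normal_peak (2 * sigma) * e by rewrite mulr_ge0 ?normal_peak_ge0 ?expR_ge0.
  have := ler_wpM2l pe key.
  by rewrite -[_ * sigma ^+ 2 / _]mulrA; lra.
rewrite ge0_integralZl//.
- rewrite -[leRHS]mule1 lee_wpmul2l//; last exact: (@probability_le1 _ _ _ (normal_prob x (2 * sigma)) E mE).
  by rewrite lee_fin; exact: divr_ge0 (mulr_ge0 (ler0n _ 6) (sqr_ge0 _)) (sqr_ge0 _).
- by apply/measurable_EFinP/measurable_funTS; exact: measurable_normal_pdf.
- by move=> y _; rewrite lee_fin normal_pdf_ge0.
- by rewrite lee_fin; exact: divr_ge0 (mulr_ge0 (ler0n _ 6) (sqr_ge0 _)) (sqr_ge0 _).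
Qed.
End normal_tail.

(** * Recovering half-lines from cosines *)

Section halfline.
Context {R : realType}.
Local Notation mu := (@lebesgue_measure R).

Lemma measurable_cos_affine (a b : R) : measurable_fun setT (fun x : R => cos (a * x + b)).
Proof.
apply: continuous_measurable_fun => x.
apply: (continuous_comp (f := fun x => a * x + b)); last exact: continuous_cos.
by apply: cvgD; [apply: cvgM; [exact: cvg_cst|exact: cvg_id]|exact: cvg_cst].
Qed.

Lemma measurable_cos : measurable_fun setT (@cos R).
Proof. by apply: continuous_measurable_fun; exact: continuous_cos. Qed.

Lemma norm_cos_le1 (x : R) : `|cos x| <= 1.
Proof. by rewrite ler_norml cos_geN1 cos_le1. Qed.

(* The indicator of [x <= b] convolved with a normal density: a mixture of Gaussian densities in [x],
   hence, by Fourier inversion, of the functions [cos (s * x + phi)]. *)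
Definition smooth_step (sigma b x : R) : R :=
  \int[mu]_y (\1_`]-oo, b] y * normal_pdf x sigma y).

Lemma smooth_stepE (sigma b x : R) :
  smooth_step sigma b x = fine (normal_prob x sigma `]-oo, b]).
Proof.
rewrite /smooth_step /Rintegral /normal_prob; congr fine.
rewrite [RHS]integral_mkcond epatch_indic; apply: eq_integral => y _.
by rewrite EFinM muleC.
Qed.

Lemma smooth_step_ge0 (sigma b x : R) : 0 <= smooth_step sigma b x.
Proof. by rewrite smooth_stepE fine_ge0. Qed.

Lemma smooth_step_le1 (sigma b x : R) : smooth_step sigma b x <= 1.
Proof.
rewrite smooth_stepE -lee_fin fineK; last exact: fin_num_measure.
exact: (@probability_le1 _ _ _ (normal_prob x sigma)).
Qed.

Lemma smooth_step_right (sigma b x : R) : 0 < sigma -> b < x ->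
  smooth_step sigma b x <= 6 * sigma ^+ 2 / (x - b) ^+ 2.
Proof.
move=> s0 bx; rewrite smooth_stepE -lee_fin fineK; last exact: fin_num_measure.
apply: normal_prob_tail => //; first by rewrite subr_gt0.
move=> y /=; rewrite in_itv/= => yb.
by rewrite ler0_norm ?subr_le0; lra.
Qed.

Lemma smooth_step_left (sigma b x : R) : 0 < sigma -> x < b ->
  1 - smooth_step sigma b x <= 6 * sigma ^+ 2 / (b - x) ^+ 2.
Proof.
move=> s0 bx; rewrite smooth_stepE.
have := @probability_setC _ _ _ (normal_prob x sigma) `]-oo, b]%classic (measurable_itv _).
rewrite setCitvl => e.
have fn : normal_prob x sigma `]-oo, b] \is a fin_num by exact: fin_num_measure.
rewrite -lee_fin EFinB fineK// -e.
apply: normal_prob_tail => //; first by rewrite subr_gt0.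
move=> y /=; rewrite in_itv/= andbT => yb.
by rewrite ger0_norm ?subr_ge0; lra.
Qed.

(** With [e = 1 / (n+1)], the width [e^2] shrinks faster than the shift [e] of the threshold. So
    even [x = b] lies at distance [e] to the right of the threshold, the error there is at most
    [6 e^4 / e^2], and the limit is the strict indicator at every point, without exception. *)
Lemma cvg_smooth_step (b x : R) :
  smooth_step (n.+1%:R^-1 ^+ 2) (b - n.+1%:R^-1) x @[n --> \oo] --> ((x < b)%R%:R : R).
Proof.
pose e (n : nat) : R := n.+1%:R^-1.
have e0 n : 0 < e n by rewrite invr_gt0.
have e1 n : e n <= 1 by rewrite invf_le1// ler1n.
have he : e n @[n --> \oo] --> (0 : R) by exact: cvg_harmonic.
apply/cvgrPdist_le => eps eps0.
have [xb|bx] := ltP x b.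
- have bx0 : 0 < (b - x) / 2 by rewrite divr_gt0// subr_gt0.
  pose c := 6 / ((b - x) / 2) ^+ 2.
  have c0 : 0 < c by rewrite divr_gt0// exprn_gt0.
  have k0 : 0 < Num.min ((b - x) / 2) (eps / c) by rewrite lt_min bx0 divr_gt0.
  have /cvgr_dist_le/(_ _ k0) := he.
  apply: filterS => n; rewrite sub0r normrN (gtr0_norm (e0 n)) le_min => /andP[en1 en2].
  rewrite ger0_norm ?subr_ge0 ?smooth_step_le1//.
  have sn : 0 < e n ^+ 2 by rewrite exprn_gt0.
  have xn : x < b - e n by lra.
  apply: le_trans (smooth_step_left sn xn) _.
  apply: (@le_trans _ _ (c * e n)); last by rewrite mulrC -ler_pdivlMr.
  rewrite /c [leRHS]mulrAC; apply: ler_pM.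
  + by apply: mulr_ge0 => //; exact: sqr_ge0.
  + by rewrite invr_ge0 exprn_ge0//; lra.
  + rewrite ler_wpM2l// -exprM -[leRHS]expr1; apply: ler_wiXn2l => //; exact: ltW.
  + rewrite lef_pV2 ?posrE ?exprn_gt0//; last by lra.
    by apply: lerXn2r; rewrite ?nnegrE; lra.
- have k0 : 0 < eps / 6 by rewrite divr_gt0.
  have /cvgr_dist_le/(_ _ k0) := he.
  apply: filterS => n; rewrite sub0r normrN (gtr0_norm (e0 n)) => en.
  rewrite sub0r normrN ger0_norm ?smooth_step_ge0//.
  have sn : 0 < e n ^+ 2 by rewrite exprn_gt0.
  have xn : b - e n < x by have := e0 n; lra.
  apply: le_trans (smooth_step_right sn xn) _.
  apply: (@le_trans _ _ (6 * e n)); last by rewrite mulrC -ler_pdivlMr.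
  rewrite ler_pdivrMr; last by rewrite exprn_gt0//; have := e0 n; lra.
  rewrite -mulrA ler_wpM2l//.
  apply: (@le_trans _ _ (e n * e n ^+ 2)).
    by rewrite -exprM -exprS; apply: ler_wiXn2l => //; exact: ltW.
  rewrite ler_wpM2l ?(ltW (e0 n))//.
  by apply: lerXn2r; rewrite ?nnegrE; have := e0 n; lra.
Qed.

Lemma measurable_normal_pdf2 (sigma : R) : 0 < sigma ->
  measurable_fun setT (fun p : measurableTypeR R * R => normal_pdf p.2 sigma p.1).
Proof.
move=> s0.
under eq_fun do rewrite normal_pdfE ?gt_eqF// /normal_fun.
apply: measurable_funM => //; apply: measurableT_comp => //.
apply: measurable_funM => //; apply: measurableT_comp => //.
apply: measurable_funX; apply: measurable_funB => //.
Qed.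

Lemma measurable_smooth_step (sigma b : R) : 0 < sigma ->
  measurable_fun setT (smooth_step sigma b).
Proof.
move=> s0; pose F (p : R * measurableTypeR R) := (\1_`]-oo, b] p.2 * normal_pdf p.1 sigma p.2)%:E.
have mF : measurable_fun setT F.
  apply/measurable_EFinP; apply: measurable_funM.
    apply: (measurableT_comp (@measurable_indic _ (measurableTypeR R) R _ _ _)) => //.
  apply: (measurableT_comp (measurable_normal_pdf2 s0)
    (g := fun p : R * measurableTypeR R => (p.2, p.1))).
  exact: measurable_swap.
have F0 p : (0 <= F p)%E by rewrite lee_fin mulr_ge0 ?normal_pdf_ge0// indicE.
apply: (measurableT_comp (fine_measurable _)) => //.
exact: (@measurable_fun_fubini_tonelli_F _ _ _ _ _ mu F mF F0).
Qed.

Context d1 d2 (T1 : measurableType d1) (T2 : measurableType d2).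
Variables (m1 : {finite_measure set T1 -> \bar R}) (m2 : {finite_measure set T2 -> \bar R}).
Variables (X1 : T1 -> R) (X2 : T2 -> R) (w1 : T1 -> R) (w2 : T2 -> R).
Hypotheses (mX1 : measurable_fun setT X1) (mX2 : measurable_fun setT X2).
Hypotheses (mw1 : measurable_fun setT w1) (mw2 : measurable_fun setT w2).
Hypotheses (w11 : forall t, `|w1 t| <= 1) (w21 : forall t, `|w2 t| <= 1).
Hypothesis charE : forall s phi : R,
  \int[m1]_t (cos (s * X1 t + phi) * w1 t) = \int[m2]_t (cos (s * X2 t + phi) * w2 t).

Let matched (f : R -> R) :=
  \int[m1]_t (f (X1 t) * w1 t) = \int[m2]_t (f (X2 t) * w2 t).

Let matched_mix (h : R -> R -> R) (g : R -> R) (M : R) :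
  measurable_fun setT (fun p : measurableTypeR R * R => h p.1 p.2) ->
  (forall s x, `|h s x| <= g s) ->
  (forall x, \int[mu]_s (`|h s x|%:E) <= M%:E)%E ->
  (forall s, matched (h s)) -> matched (fun x => \int[mu]_s h s x).
Proof.
move=> mh hg hM H; rewrite /matched (@weighted_mix _ _ _ m1 X1 w1 _ _ _ h g M)//.
rewrite (@weighted_mix _ _ _ m2 X2 w2 _ _ _ h g M)//.
by apply: eq_Rintegral => s _; exact: H.
Qed.

Let matched_pdf (sigma y : R) : 0 < sigma -> matched (fun x => normal_pdf x sigma y).
Proof.
move=> s0.
pose c := normal_peak sigma : R.
have c0 : 0 <= c by exact: normal_peak_ge0.
pose h s x : R := cos (((y - x) / sigma) * s + 0) * normal_pdf 0 1 s * c.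
(* The normal characteristic function, read at [t = (y - x) / sigma], is itself Gaussian; so the
   density is an average of cosines whose argument is affine in [x]. *)
have hE x : normal_pdf x sigma y = \int[mu]_s h s x.
  rewrite /h RintegralZr//.
    rewrite Rintegral_normal_cos cos0 mulr1 normal_pdfE ?gt_eqF// [RHS]mulrC; congr (_ * expR _).
    by rewrite -mulr_natr; field; rewrite gt_eqF.
  apply: integrable_trig_normal_pdf01; first exact: measurable_cos_affine.
  by move=> s; exact: norm_cos_le1.
rewrite /matched; under eq_Rintegral do rewrite hE.
under [RHS]eq_Rintegral do rewrite hE.
have hg s x : `|h s x| <= normal_pdf 0 1 s * c.
  rewrite /h !normrM (ger0_norm c0) ler_wpM2r//.
  by rewrite (ger0_norm (normal_pdf_ge0 _ _ _)) ler_piMl ?normal_pdf_ge0// norm_cos_le1.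
have mh : measurable_fun setT (fun p : measurableTypeR R * R => h p.1 p.2).
  apply: measurable_funM => //; apply: measurable_funM.
    apply: (measurableT_comp measurable_cos); apply: measurable_funD => //.
    apply: measurable_funM; last exact: measurable_fst.
    apply: measurable_funM => //; apply: measurable_funB => //; exact: measurable_snd.
  apply: (measurableT_comp (@measurable_normal_pdf R 0 1)); exact: measurable_fst.
apply: (@matched_mix h _ c mh hg) => [x|s].
  apply: (@le_trans _ _ (\int[mu]_s ((normal_pdf 0 1 s)%:E * c%:E))%E).
    apply: ge0_le_integral => //.
    - apply/measurable_EFinP; apply: (measurableT_comp (@normr_measurable R setT)).
      exact: (measurable_fun_pair1 (x : R) mh).
    - by apply/measurable_EFinP; apply: measurable_funM => //; exact: measurable_normal_pdf.
    - by move=> s _; rewrite -EFinM lee_fin.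
  rewrite integralZr//; last exact: integrable_normal_pdf.
  by rewrite integral_normal_pdf mul1e.
rewrite /matched.
have split d (T : measurableType d) (m : {finite_measure set T -> \bar R}) (X w : T -> R) :
    measurable_fun setT X -> measurable_fun setT w -> (forall t, `|w t| <= 1) ->
  \int[m]_t (h s (X t) * w t) =
  (normal_pdf 0 1 s * c) * \int[m]_t (cos ((- (s / sigma)) * X t + y / sigma * s) * w t).
  move=> mX mw w_1; rewrite -RintegralZl//.
    apply: eq_Rintegral => t _; rewrite /h.
    rewrite [X in cos X](_ : _ = - (s / sigma) * X t + y / sigma * s); last by ring.
    by ring.
  apply: (@integrable_weighted _ _ _ m X w _ _ _ (fun x => cos (- (s / sigma) * x + y / sigma * s)) 1) => //.
    exact: measurable_cos_affine.
  by move=> x; exact: norm_cos_le1.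
by rewrite !split// charE.
Qed.

Let matched_smooth (sigma b : R) : 0 < sigma -> matched (smooth_step sigma b).
Proof.
move=> s0.
have mh : measurable_fun setT (fun p : measurableTypeR R * R =>
    \1_`]-oo, b] p.1 * normal_pdf p.2 sigma p.1).
  apply: measurable_funM; last exact: measurable_normal_pdf2.
  apply: (measurableT_comp (@measurable_indic _ (measurableTypeR R) R _ _ _)) => //.
have i1 (y : R) : `|\1_`]-oo, b] y| <= 1 :> R.
  by rewrite indicE; case: (y \in _); rewrite ?normr1 ?normr0.
apply: (@matched_mix _ (fun=> normal_peak sigma) 1 mh).
- move=> y x; rewrite normrM (ger0_norm (normal_pdf_ge0 _ _ _)).
  rewrite (le_trans _ (normal_pdf_ub x y (lt0r_neq0 s0)))//.
  by rewrite ler_piMl// normal_pdf_ge0.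
- move=> x; rewrite -(integral_normal_pdf x sigma); apply: ge0_le_integral => //.
  + apply/measurable_EFinP; apply: (measurableT_comp (@normr_measurable R setT)).
    exact: (measurable_fun_pair1 (x : R) mh).
  + by apply/measurable_EFinP; exact: measurable_normal_pdf.
  + move=> y _; rewrite lee_fin normrM (ger0_norm (normal_pdf_ge0 _ _ _)).
    by rewrite ler_piMl// normal_pdf_ge0.
- move=> y; have [yb|yb] := boolP (y \in `]-oo, b]%classic).
  + rewrite /matched; under eq_Rintegral do rewrite indicE yb mul1r.
    under [RHS]eq_Rintegral do rewrite indicE yb mul1r.
    exact: matched_pdf.
  + rewrite /matched; under eq_Rintegral do rewrite indicE (negbTE yb) mul0r mul0r.
    under [RHS]eq_Rintegral do rewrite indicE (negbTE yb) mul0r mul0r.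
    by rewrite /Rintegral !integral0.
Qed.

(** One-dimensional uniqueness with weights. The weights are signed, since they will carry the
    cosine of the other coordinates; hence the conclusion is about integrals and not about
    measures. *)
Lemma char_halfline (b : R) :
  \int[m1]_t ((X1 t < b)%R%:R * w1 t) = \int[m2]_t ((X2 t < b)%R%:R * w2 t).
Proof.
pose f_ n := smooth_step (n.+1%:R^-1 ^+ 2) (b - n.+1%:R^-1).
have fM n x : `|f_ n x| <= 1 by rewrite ger0_norm ?smooth_step_ge0// smooth_step_le1.
have mf n : measurable_fun setT (f_ n).
  by apply: measurable_smooth_step; rewrite exprn_gt0// invr_gt0.
have fc x := @cvg_smooth_step b x.
have c1 := @cvg_weighted _ _ _ m1 X1 w1 mX1 mw1 w11 f_ (fun x => (x < b)%R%:R) 1 mf fM fc.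
have c2 := @cvg_weighted _ _ _ m2 X2 w2 mX2 mw2 w21 f_ (fun x => (x < b)%R%:R) 1 mf fM fc.
have E : (fun n => \int[m1]_t (f_ n (X1 t) * w1 t)) = (fun n => \int[m2]_t (f_ n (X2 t) * w2 t)).
  by apply/funext => n; apply: matched_smooth; rewrite exprn_gt0// invr_gt0.
rewrite E in c1; exact: (cvg_unique _ c1 c2).
Qed.

End halfline.

Lemma measurable_sum_cond {R : realType} d (T : measurableType d) (I : finType) (P : pred I)
    (h : I -> T -> R) : (forall i, measurable_fun setT (h i)) ->
  measurable_fun setT (fun t => \sum_(i | P i) h i t).
Proof. by move=> mh; under eq_fun do rewrite -big_filter; exact: measurable_sum. Qed.

Lemma measurable_prod_cond {R : realType} d (T : measurableType d) (I : finType) (P : pred I)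
    (h : I -> T -> R) : (forall i, measurable_fun setT (h i)) ->
  measurable_fun setT (fun t => \prod_(i | P i) h i t).
Proof. by move=> mh; under eq_fun do rewrite -big_filter; exact: measurable_prod. Qed.

(** * Laws of finite real vectors *)

Section rvec.
Context {R : realType} (I : finType).

Definition coord_sets : set (set (I -> R)) :=
  [set A | exists i b, A = [set f | f i < b]].

(** The product sigma-algebra on [I -> R], generated by strict half-spaces to match the strict
    indicators that [char_halfline] delivers. *)
Definition rvec := g_sigma_algebraType coord_sets.

Definition lower_box (b : I -> R) : set rvec := [set f | forall i, f i < b i].

Lemma measurable_coord (i : I) : measurable_fun setT (fun f : rvec => f i).
Proof.
apply: (measurability _ (RGenInftyO.measurableE R)) => _ [_ [b ->] <-].
rewrite setTI; apply: sub_sigma_algebra; exists i, b.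
by apply/seteqP; split => f /=; rewrite in_itv.
Qed.

Lemma measurable_rvec d (T : measurableType d) (X : I -> T -> R) :
  (forall i, measurable_fun setT (X i)) ->
  measurable_fun setT (fun t => (X ^~ t) : rvec).
Proof.
move=> mX; apply: (@measurability _ _ _ rvec _ _ coord_sets) => // _ [_ [i [b ->]] <-].
have := mX i measurableT `]-oo, b[%classic (measurable_itv _).
by congr (measurable (_ `&` _)); apply/seteqP; split => f /=; rewrite in_itv.
Qed.

Lemma measurable_lower_box b : measurable (lower_box b).
Proof.
have -> : lower_box b = \big[setI/setT]_(i : I) [set f : rvec | f i < b i].
  apply/seteqP; split => f.
    by move=> fb; apply: (big_ind (fun A : set rvec => A f)) => //= A B.
  move=> fb i; move: fb; rewrite (bigD1 i)//=; case=> //.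
apply: bigsetI_measurable => i _.
by apply: sub_sigma_algebra; exists i, (b i).
Qed.

(** A half-space is the union over [n] of boxes whose other sides are [n]. Boxes, unlike
    half-spaces, are closed under intersection, as the uniqueness theorem for measures requires. *)
Lemma measurable_rvecE : @measurable _ rvec = <<s [set lower_box b | b in setT] >>.
Proof.
apply/seteqP; split.
- apply: smallest_sub; first exact: smallest_sigma_algebra.
  move=> _ [i [b ->]].
  have -> : [set f : I -> R | f i < b] =
      \bigcup_n lower_box (fun j => if j == i then b else n%:R).
    apply/seteqP; split => f /=.
    - move=> fb.
      have [n Hn] : exists n, forall j, f j < n%:R.
        exists (Num.truncn (\sum_j `|f j|)).+1 => j.
        apply: le_lt_trans (truncnS_gt _).
        by rewrite (bigD1 j)//= (le_trans (ler_norm _))// lerDl sumr_ge0.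
      by exists n => // j; case: eqP => [->|].
    - by case=> n _ /(_ i); rewrite eqxx.
  apply: sigma_algebra_bigcup => n; apply: sub_sigma_algebra.
  by exists (fun j => if j == i then b else n%:R).
- apply: smallest_sub; first exact: smallest_sigma_algebra.
  by move=> _ [b _ <-]; exact: measurable_lower_box.
Qed.

Section law.
Context d1 d2 (T1 : measurableType d1) (T2 : measurableType d2).
Variables (m1 : {finite_measure set T1 -> \bar R}) (m2 : {finite_measure set T2 -> \bar R}).
Variables (X1 : I -> T1 -> R) (X2 : I -> T2 -> R).
Hypotheses (mX1 : forall i, measurable_fun setT (X1 i)).
Hypotheses (mX2 : forall i, measurable_fun setT (X2 i)).

Let Y1 t : rvec := X1 ^~ t.
Let Y2 t : rvec := X2 ^~ t.
Let mY1 : measurable_fun setT Y1. Proof. exact: measurable_rvec. Qed.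
Let mY2 : measurable_fun setT Y2. Proof. exact: measurable_rvec. Qed.

Lemma law_ext :
  (forall b, m1 (Y1 @^-1` lower_box b) = m2 (Y2 @^-1` lower_box b)) ->
  forall S, measurable S -> m1 (Y1 @^-1` S) = m2 (Y2 @^-1` S).
Proof.
move=> H S mS.
pose n1 : {measure set rvec -> \bar R} := pushforward m1 Y1.
pose n2 : {measure set rvec -> \bar R} := pushforward m2 Y2.
change (n1 mY1 S = n2 mY2 S).
apply: (@measure_unique _ _ _ [set lower_box b | b in setT]
  (fun n => lower_box (fun=> n%:R)) measurable_rvecE _ _ _ (n1 mY1) (n2 mY2)) => //.
- move=> _ _ [a _ <-] [b _ <-]; exists (fun i => Num.min (a i) (b i)) => //.
  apply/seteqP; split => f /=.
    by move=> fab; split => i; have := fab i; rewrite lt_min => /andP[].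
  by move=> [fa fb] i; rewrite lt_min fa fb.
- apply/seteqP; split => // f _.
  exists (Num.truncn (\sum_j `|f j|)).+1 => // j.
  apply: le_lt_trans (truncnS_gt _).
  by rewrite (bigD1 j)//= (le_trans (ler_norm _))// lerDl sumr_ge0.
- by move=> _ [b _ <-]; exact: H.
- move=> n; rewrite /n1 /pushforward -ge0_fin_numE//.
  apply: fin_num_measure; rewrite -[X in measurable X]setTI; apply: mY1 => //.
  exact: measurable_lower_box.
Qed.

Lemma law_integral (g : rvec -> R) (M : R) :
  (forall S, measurable S -> m1 (Y1 @^-1` S) = m2 (Y2 @^-1` S)) ->
  measurable_fun setT g -> (forall f, `|g f| <= M) ->
  \int[m1]_t g (Y1 t) = \int[m2]_t g (Y2 t).
Proof.
move=> H mg gM.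
have mgE : measurable_fun setT (EFin \o g) by exact/measurable_EFinP.
have ig d (T : measurableType d) (m : {finite_measure set T -> \bar R}) (Y : T -> rvec) :
    measurable_fun setT Y -> m.-integrable setT (EFin \o (g \o Y)).
  move=> mY; apply: (@measurable_bounded_integrable _ _ _ _ (g \o Y)) => //.
  - by rewrite -ge0_fin_numE// fin_num_measure.
  - exact: measurableT_comp.
  - exists M; split; rewrite ?num_real// => y My t _ /=.
    exact: le_trans (gM _) (ltW My).
rewrite /Rintegral; congr fine.
have := @integral_pushforward _ _ _ _ _ _ mY1 m1 setT _ mgE (ig _ _ m1 _ mY1) measurableT.
have := @integral_pushforward _ _ _ _ _ _ mY2 m2 setT _ mgE (ig _ _ m2 _ mY2) measurableT.
rewrite !preimage_setT => <- <-.
by apply: eq_measure_integral => S mS _; exact: H.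
Qed.

Hypothesis charE : forall (u : I -> R) (phi : R),
  \int[m1]_t cos (\sum_i u i * X1 i t + phi) =
  \int[m2]_t cos (\sum_i u i * X2 i t + phi).

Let ind (x b : R) : R := (x < b)%R%:R.

Let mind b : measurable_fun setT (ind^~ b).
Proof.
rewrite (_ : ind^~ b = \1_`]-oo, b[); first exact: measurable_indic.
by apply/funext => x; rewrite /ind indicE mem_setE in_itv.
Qed.

Let mtail d (T : measurableType d) (X : I -> T -> R) (J : {set I}) b u phi :
  (forall i, measurable_fun setT (X i)) ->
  measurable_fun setT (fun t => (\prod_(i in J) ind (X i t) (b i)) *
     cos (\sum_(i in ~: J) u i * X i t + phi)).
Proof.
move=> mX; apply: measurable_funM.
  apply: measurable_prod_cond => i _; exact: (measurableT_comp (mind _)).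
apply: (measurableT_comp (@measurable_cos R)); apply: measurable_funD => //.
by apply: measurable_sum_cond => i; apply: measurable_funM.
Qed.

Let tail1 T (X : I -> T -> R) (J : {set I}) b u phi (t : T) :
  `|(\prod_(i in J) ind (X i t) (b i)) * cos (\sum_(i in ~: J) u i * X i t + phi)| <= 1.
Proof.
rewrite normrM -[leRHS]mulr1; apply: ler_pM => //; last exact: norm_cos_le1.
rewrite normr_prod; apply: prodr_ile1 => i _; rewrite normr_ge0/=.
by rewrite /ind; case: (_ < _); rewrite ?normr1 ?normr0.
Qed.

(* Induction hypothesis of the uniqueness theorem: the trigonometric test functions are traded for
   indicators of half-lines one coordinate at a time. *)
Let mixed (J : {set I}) := forall (b : I -> R) (u : I -> R) (phi : R),
  \int[m1]_t ((\prod_(i in J) ind (X1 i t) (b i)) * cos (\sum_(i in ~: J) u i * X1 i t + phi)) =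
  \int[m2]_t ((\prod_(i in J) ind (X2 i t) (b i)) * cos (\sum_(i in ~: J) u i * X2 i t + phi)).

Let mixedS (J : {set I}) (i : I) : i \notin J -> mixed J -> mixed (i |: J).
Proof.
move=> iJ H b u phi.
pose w T (X : I -> T -> R) t := (\prod_(j in J) ind (X j t) (b j)) *
  cos (\sum_(j in ~: (i |: J)) u j * X j t + phi).
have step T (X : I -> T -> R) t : (\prod_(j in i |: J) ind (X j t) (b j)) *
     cos (\sum_(j in ~: (i |: J)) u j * X j t + phi) = ind (X i t) (b i) * w T X t.
  by rewrite big_setU1//= mulrA.
under eq_Rintegral do rewrite step.
under [RHS]eq_Rintegral do rewrite step.
have mw d (T : measurableType d) (X : I -> T -> R) : (forall i, measurable_fun setT (X i)) ->
    measurable_fun setT (w T X).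
  move=> mX.
  apply: measurable_funM.
    apply: measurable_prod_cond => j _; exact: (measurableT_comp (mind _)).
  apply: (measurableT_comp (@measurable_cos R)); apply: measurable_funD => //.
  by apply: measurable_sum_cond => j; apply: measurable_funM.
have w1 T (X : I -> T -> R) t : `|w T X t| <= 1.
  rewrite normrM -[leRHS]mulr1; apply: ler_pM => //; last exact: norm_cos_le1.
  rewrite normr_prod; apply: prodr_ile1 => j _; rewrite normr_ge0/=.
  by rewrite /ind; case: (_ < _); rewrite ?normr1 ?normr0.
apply: (@char_halfline _ _ _ _ _ m1 m2) => //; [exact: mw|exact: mw|].
move=> s psi.
(* Product-to-sum: [cos a cos b = (cos (a + b) + cos (a - b)) / 2]. The two cosines have
   coefficients [up 1] and [up (-1)] and fall under the hypothesis for [J]. *)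
pose up e (j : I) := if j == i then s else e * u j.
have prod d (T : measurableType d) (m : {finite_measure set T -> \bar R}) (X : I -> T -> R) :
    (forall i, measurable_fun setT (X i)) ->
  \int[m]_t (cos (s * X i t + psi) * w T X t) =
  2^-1 * (\int[m]_t ((\prod_(j in J) ind (X j t) (b j)) *
     cos (\sum_(j in ~: J) up 1 j * X j t + (psi + phi))) +
   \int[m]_t ((\prod_(j in J) ind (X j t) (b j)) *
     cos (\sum_(j in ~: J) up (-1) j * X j t + (psi - phi)))).
  move=> mX.
  have it v q : m.-integrable setT (EFin \o (fun t => (\prod_(j in J) ind (X j t) (b j)) *
     cos (\sum_(j in ~: J) v j * X j t + q))).
    apply: measurable_bounded_integrable => //.
    - by rewrite -ge0_fin_numE// fin_num_measure.
    - exact: mtail.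
    - exists 1; split; rewrite ?num_real// => y My t _ /=.
      exact: le_trans (tail1 _ _ _ _ _ _) (ltW My).
  rewrite -RintegralD//; try exact: it.
  rewrite -RintegralZl//; last first.
    apply: eq_integrable (integrableD measurableT (it (up 1) (psi + phi)) (it (up (-1)) (psi - phi))) => //.
  apply: eq_Rintegral => t _.
  have sumE e : \sum_(j in ~: J) up e j * X j t =
      s * X i t + e * \sum_(j in ~: (i |: J)) u j * X j t.
    rewrite (bigD1 i) ?inE//= /up eqxx; congr (_ + _).
    rewrite mulr_sumr; apply: eq_big => [j|j /andP[_ /negbTE ->]]; last by rewrite mulrA.
    by rewrite !inE negb_or andbC.
  rewrite !sumE mul1r mulN1r /w.
  set A := s * X i t; set B := \sum_(j in ~: (i |: J)) _; set p := \prod_(_ in _) _.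
  have -> : A + B + (psi + phi) = (A + psi) + (B + phi) by ring.
  have -> : A - B + (psi - phi) = (A + psi) - (B + phi) by ring.
  by rewrite (cosD (A + psi)) (cosB (A + psi)); field.
by rewrite !prod// !H.
Qed.

Lemma char_ext b : m1 (Y1 @^-1` lower_box b) = m2 (Y2 @^-1` lower_box b).
Proof.
have mixedT : mixed [set: I]%SET.
  have : forall n (J : {set I}), #|J| = n -> mixed J.
    elim=> [J /eqP|n IH J Jn].
      rewrite cards_eq0 => /eqP -> b' u phi.
      have cosE T (X : I -> T -> R) t : (\prod_(i in finset.set0) ind (X i t) (b' i)) *
          cos (\sum_(i in ~: finset.set0) u i * X i t + phi) = cos (\sum_i u i * X i t + phi).
        rewrite big_set0 mul1r finset.setC0; congr (cos (_ + _)).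
        by apply: eq_bigl => i; rewrite finset.in_setT.
      under eq_Rintegral do rewrite cosE.
      by under [RHS]eq_Rintegral do rewrite cosE.
    have /card_gt0P[i iJ] : (0 < #|J|)%N by rewrite Jn.
    rewrite -(finset.setD1K iJ); apply: mixedS; first by rewrite !inE eqxx.
    by apply: IH; move: Jn; rewrite (cardsD1 i) iJ => -[].
  exact.
(* Once all coordinates are traded, the cosine is [cos 0 = 1] and the product is the indicator of
   the box. *)
have toP d (T : measurableType d) (m : {finite_measure set T -> \bar R}) (X : I -> T -> R) :
    (forall i, measurable_fun setT (X i)) ->
  m ((fun t => (X ^~ t) : rvec) @^-1` lower_box b) =
  (\int[m]_t ((\prod_(i in [set: I]%SET) ind (X i t) (b i)) *
     cos (\sum_(i in ~: [set: I]%SET) 0 * X i t + 0)))%:E.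
  move=> mX.
  set A := _ @^-1` _.
  have mA : measurable A.
    rewrite -[A]setTI; apply: (measurable_rvec mX) => //; exact: measurable_lower_box.
  rewrite -[LHS]fineK; last exact: fin_num_measure.
  rewrite -[in LHS](setIT A) -(integral_indic m measurableT mA).
  congr (_%:E); apply: eq_Rintegral => t _.
  rewrite finset.setCT big_set0 addr0 cos0 mulr1 indicE.
  have [tA|tA] := boolP (t \in A).
    move/set_mem : tA => tA; rewrite big1// => i _; rewrite /ind.
    by have := tA i => ->.
  have [i ti] : exists i, ~ (X i t < b i).
    by apply/existsNP => H; move/negP: tA; apply; exact/mem_set.
  rewrite (bigD1 i) ?inE//= /ind; move/negP/negbTE : ti => ->; by rewrite mul0r.
by rewrite (toP _ _ m1)// (toP _ _ m2)// (mixedT b (fun=> 0) 0).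
Qed.

End law.
End rvec.

Lemma Rintegral_prod_bounded {R : realType} d1 d2 (T1 : measurableType d1)
    (T2 : measurableType d2) (P1 : probability T1 R) (P2 : probability T2 R)
    (f : T1 * T2 -> R) (M : R) :
  measurable_fun setT f -> (forall z, `|f z| <= M) ->
  \int[(P1 \x P2)%E]_z f z = \int[P1]_x (\int[P2]_y f (x, y)).
Proof.
move=> mf fM.
have iF : (P1 \x P2)%E.-integrable setT (EFin \o f).
  apply: measurable_bounded_integrable => //.
  - apply: (@le_lt_trans _ _ 1%E); last exact: ltry.
    exact: (@probability_le1 _ _ _ ((P1 \x P2)%E : probability _ R)).
  - exists M; split; rewrite ?num_real// => y My t _ /=.
    exact: le_trans (fM _) (ltW My).
rewrite {1}/Rintegral -(integral12_prod_meas1 iF) {1}/Rintegral; congr fine.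
apply: eq_integral => x _; rewrite /fubini_F /Rintegral fineK//.
apply: integrable_fin_num => //.
apply: (@measurable_bounded_integrable _ _ _ _ (fun y => f (x, y))) => //.
- by rewrite -ge0_fin_numE// fin_num_measure.
- exact: measurable_fun_pair2.
- exists M; split; rewrite ?num_real// => y My t _ /=.
  exact: le_trans (fM _) (ltW My).
Qed.

(* Independence of two blocks of coordinates, stated as the invariance of the law when the second
   block is read from an independent copy of the sample point. *)
Section split.
Context {R : realType} (I : finType) d (T : measurableType d) (P : probability T R).
Variable (X : I -> T -> R).
Hypothesis (mX : forall i, measurable_fun setT (X i)).

Definition split_pair (J : {set I}) (i : I) (w : T * T) : R :=
  if i \in J then X i w.1 else X i w.2.

Lemma measurable_split_pair J i : measurable_fun setT (split_pair J i).
Proof.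
by rewrite /split_pair; case: (i \in J); apply: (measurableT_comp (mX i)).
Qed.

(** A lower box pulls back under [split_pair] to a product of two boxes, one per block, so the
    hypothesis is agreement on a class of sets that determines the law. *)
Lemma split_law_box (J : {set I}) :
  (forall b : I -> R, P [set w | forall i, X i w < b i] =
     (P [set w | forall i, i \in J -> (X i w < b i)%R] *
      P [set w | forall i, i \notin J -> (X i w < b i)%R])%E) ->
  forall S : set (@rvec R I), measurable S ->
  P ((fun w => X ^~ w : @rvec R I) @^-1` S) =
  (P \x P)%E ((fun w => (split_pair J) ^~ w : @rvec R I) @^-1` S).
Proof.
move=> H S mS.
pose PP : probability (T * T)%type R := (P \x P)%E.
apply: (@law_ext _ _ _ _ _ _ P PP X (split_pair J)) => //.
  exact: measurable_split_pair.
move=> b; rewrite [LHS]H.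
have mI (Q : pred I) : measurable [set w | forall i, Q i -> X i w < b i].
  pose A i : set T := X i @^-1` `]-oo, b i[.
  rewrite (_ : [set w | _] = \big[setI/setT]_(i | Q i) A i); last first.
    apply/seteqP; split => w.
      move=> wb; apply: (big_ind (fun E : set T => E w)) => //= i Qi; exact: wb.
    move=> wb i Qi; move: wb; rewrite (bigD1 i)//= => -[].
    by rewrite /A/= in_itv.
  apply: bigsetI_measurable => i _.
  by have := mX i measurableT (measurable_itv `]-oo, b i[); rewrite setTI.
rewrite -[RHS]/((P \x P)%E _) -product_measure1E; [|exact: mI|exact: mI].
congr ((P \x P)%E _); apply/seteqP; split => [[x y] /= [h1 h2] i|[x y] /= h].
  by rewrite /split_pair; case: ifPn => iJ /=; [exact: h1|exact: h2].
by split => i iJ; have := h i; rewrite /split_pair ?iJ ?(negbTE iJ).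
Qed.

Definition restrict_to (J : {set I}) (u : I -> R) (i : I) : R :=
  if i \in J then u i else 0.

(** The second block is integrated first, the first block being absorbed in the phase; additivity of
    the exponent [Q] over the blocks then restores the original characteristic function. *)
Lemma split_law_char (J : {set I}) (Q : (I -> R) -> R) :
  (forall u phi, \int[P]_w cos (\sum_i u i * X i w + phi) = expR (- Q u) * cos phi) ->
  (forall u, Q u = Q (restrict_to J u) + Q (restrict_to (~: J)%SET u)) ->
  forall S : set (@rvec R I), measurable S ->
  P ((fun w => X ^~ w : @rvec R I) @^-1` S) =
  (P \x P)%E ((fun w => (split_pair J) ^~ w : @rvec R I) @^-1` S).
Proof.
move=> H HQ S mS.
pose PP : probability (T * T)%type R := (P \x P)%E.
apply: (@law_ext _ _ _ _ _ _ P PP X (split_pair J)) => //.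
  exact: measurable_split_pair.
apply: (@char_ext _ _ _ _ _ _ P PP X (split_pair J)) => //.
  exact: measurable_split_pair.
move=> u phi; rewrite H.
rewrite (@Rintegral_prod_bounded _ _ _ _ _ _ _ _ 1); last 2 first.
- apply: (measurableT_comp (@measurable_cos R)); apply: measurable_funD => //.
  apply: measurable_sum_cond => i; apply: measurable_funM => //.
  exact: measurable_split_pair.
- by move=> z; exact: norm_cos_le1.
have E x y : \sum_i u i * split_pair J i (x, y) + phi =
   \sum_i restrict_to (~: J)%SET u i * X i y + (\sum_i restrict_to J u i * X i x + phi).
  rewrite addrA; congr (_ + _); rewrite -big_split/=; apply: eq_bigr => i _.
  rewrite /split_pair /restrict_to finset.in_setC.
  by case: (i \in J) => /=; rewrite mul0r ?add0r ?addr0.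
under [RHS]eq_Rintegral => x _.
  under eq_Rintegral do rewrite E.
  rewrite H.
over.
rewrite RintegralZl//; last first.
  apply: (@measurable_bounded_integrable _ _ _ _ (fun x => cos _)) => //.
  - by rewrite -ge0_fin_numE// fin_num_measure.
  - apply: (measurableT_comp (@measurable_cos R)); apply: measurable_funD => //.
    by apply: measurable_sum_cond => i; apply: measurable_funM => //.
  - exists 1; split; rewrite ?num_real// => y My t _ /=.
    exact: le_trans (norm_cos_le1 _) (ltW My).
by rewrite H mulrA -expRD HQ opprD [in RHS]addrC.
Qed.

End split.

(** * The chi-square law *)

Section density.
Context {R : realType} d (T : measurableType d) (m : {measure set T -> \bar R}).
Variables (w : T -> R).
Hypotheses (mw : measurable_fun setT w) (w0 : forall x, 0 <= w x).

Definition density_measure (_ : measurable_fun setT w) (_ : forall x, 0 <= w x)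
  (A : set T) : \bar R := (\int[m]_(x in A) (w x)%:E)%E.

Let nu := density_measure mw w0.

Let nu0 : nu set0 = 0%E. Proof. exact: integral_set0. Qed.

Let nu_ge0 A : (0 <= nu A)%E.
Proof. by apply: integral_ge0 => x _; rewrite lee_fin. Qed.

Let nu_sigma_additive : semi_sigma_additive nu.
Proof.
move=> F mF tF mUF; rewrite /nu /density_measure ge0_integral_bigcup//.
- by apply: is_cvg_ereal_nneg_natsum_cond => n _ _; exact: nu_ge0.
- by apply/measurable_EFinP/measurable_funTS.
- by move=> x _; rewrite lee_fin.
Qed.

HB.instance Definition _ := isMeasure.Build _ _ _
  (density_measure mw w0) nu0 nu_ge0 nu_sigma_additive.

End density.


Section ge0_integral_density.
Context {R : realType}.
Local Notation mu := (@lebesgue_measure R).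

Lemma layer_cake (x : R) : 0 <= x -> (x%:E = \int[mu]_s (\1_`[0, x[ s)%:E)%E.
Proof.
move=> x0; rewrite integral_indic// setIT -[RHS]/(lebesgue_measure _) lebesgue_measure_itv/=.
by case: ifPn => [|]; rewrite lte_fin ?sube0// -leNgt => ?; congr _%:E; apply/eqP; rewrite eq_le x0 andbT.
Qed.


Context d1 d2 (T1 : measurableType d1) (T2 : measurableType d2).
Variables (m : {sigma_finite_measure set T1 -> \bar R}) (nu : {sigma_finite_measure set T2 -> \bar R}).
Variables (phi : T1 -> T2) (w : T1 -> R).
Hypotheses (mw : measurable_fun setT w) (w0 : forall x, 0 <= w x).
Hypotheses (mphi : measurable_fun setT phi).
Hypothesis nuE : forall A, measurable A -> (nu A = \int[m]_(x in phi @^-1` A) (w x)%:E)%E.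

(** Writing [f x] as the length of [[0, f x[] and exchanging integrals by Tonelli reduces the claim
    to the superlevel sets of [f], where [nuE] applies. *)
Lemma ge0_integral_density (f : T2 -> R) : measurable_fun setT f -> (forall x, 0 <= f x) ->
  (\int[nu]_x (f x)%:E = \int[m]_x (f (phi x) * w x)%:E)%E.
Proof.
move=> mf f0.
pose U : set (T2 * measurableTypeR R) := [set p | 0 <= p.2 < f p.1].
have mU : measurable U.
  suff mU' : measurable (U : set (T2 * R)) by exact: mU'.
  have -> : (U : set (T2 * R)) = [set p : T2 * R | 0 <= p.2] `&` [set p : T2 * R | p.2 < f p.1].
    by apply/seteqP; split => p /=; [move/andP|move=> h; exact/andP].
  apply: measurableI.
    have := @measurable_snd _ _ T2 R measurableT `[0, +oo[%classic (measurable_itv _).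
    by rewrite setTI; congr measurable; apply/seteqP; split => p /=; rewrite in_itv/= andbT.
  have mg : measurable_fun setT (fun p : T2 * R => f p.1 - p.2).
    by apply: measurable_funB => //; apply: measurableT_comp.
  have := mg measurableT `]0, +oo[%classic (measurable_itv _).
  by rewrite setTI; congr measurable; apply/seteqP; split => p /=; rewrite in_itv/= andbT subr_gt0.
have mUs s : measurable [set x | U (x, s)].
  have := @measurable_ysection _ _ _ _ U s mU.
  by congr measurable; apply/seteqP; split => x; rewrite /ysection/= ?inE.
have indE (x : T2) (s : R) : \1_`[0, f x[ s = \1_U (x, s) :> R.
  by rewrite !indicE; congr ((_ : bool)%:R); apply/idP/idP; rewrite !inE /U/= in_itv.
transitivity (\int[nu]_x \int[mu]_s (\1_U (x, s))%:E)%E.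
  apply: eq_integral => x _; rewrite (layer_cake (f0 x)).
  by apply: eq_integral => s _; rewrite indE.
have mI : measurable_fun setT (fun p : T2 * measurableTypeR R => (\1_U p : R)%:E).
  by apply/measurable_EFinP; exact: measurable_indic.
rewrite (@fubini_tonelli _ _ _ _ _ nu mu (fun p => (\1_U p : R)%:E))//; last first.
transitivity (\int[mu]_s \int[m]_x (\1_U (phi x, s) * w x)%:E)%E.
  apply: eq_integral => s _.
  rewrite (_ : (fun x => (\1_U (x, s))%:E) = (fun x => (\1_[set x | U (x, s)] x)%:E)); last first.
    by apply/funext => x; rewrite !indicE; congr ((_ : bool)%:R%:E); apply/idP/idP; rewrite !inE.
  rewrite integral_indic// setIT -[LHS]/(nu _) nuE//.
  rewrite [LHS]integral_mkcond epatch_indic; apply: eq_integral => x _.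
  by rewrite EFinM muleC; congr (_%:E * _)%E.
have mJ : measurable_fun setT (fun p : measurableTypeR R * T1 => (\1_U (phi p.2, p.1) * w p.2)%:E).
  apply/measurable_EFinP/measurable_funM; last exact: (measurableT_comp mw).
  apply: (measurableT_comp (@measurable_indic _ (T2 * measurableTypeR R)%type R _ _ mU)
    (g := fun p : measurableTypeR R * T1 => (phi p.2, p.1))).
  by apply: measurable_fun_pair => //; apply: (measurableT_comp mphi).
rewrite (@fubini_tonelli _ _ _ _ _ mu m (fun p => (\1_U (phi p.2, p.1) * w p.2)%:E))//=; last first.
  by move=> p; rewrite lee_fin mulr_ge0// indicE.
apply: eq_integral => x _.
under eq_integral do rewrite EFinM muleC -indE.
rewrite ge0_integralZl//.
- by rewrite -layer_cake// muleC.
- by apply/measurable_EFinP; exact: measurable_indic.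
- by rewrite lee_fin.
Qed.

End ge0_integral_density.

Section change_of_variables.
Context {R : realType}.
Local Notation mu := (@lebesgue_measure R).
Variables (phi psi w : R -> R).
Hypotheses (mw : measurable_fun setT w) (w0 : forall x, 0 <= w x).
Hypotheses (mphi : measurable_fun setT phi) (psiK : cancel psi phi).
Hypothesis phi_mono : forall x y, (phi x < phi y) = (x < y).
Hypothesis phi_ftc : forall a b : R, a < b ->
  (\int[mu]_(x in `]a, b]) (w x)%:E = (phi b - phi a)%:E)%E.

Let phi' : measurableTypeR R -> measurableTypeR R := phi.
Let mphi' : measurable_fun setT phi'. Proof. exact: mphi. Qed.

(** Lebesgue measure is determined by half-open intervals. By [phi_mono] and [psiK] the preimage of
    []a, b]] is []psi a, psi b]], over which [phi_ftc] gives the integral of [w]. *)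
Lemma lebesgue_measure_cov (A : set R) : measurable A ->
  (mu A = \int[mu]_(x in phi @^-1` A) (w x)%:E)%E.
Proof.
pose dm : {measure set (measurableTypeR R) -> \bar R} := density_measure mu mw w0.
pose nu : {measure set (measurableTypeR R) -> \bar R} := pushforward dm phi'.
apply: (@lebesgue_measure_unique R (nu mphi')) => _ [[a b] _ <-].
rewrite [RHS](_ : _ = dm (phi @^-1` `]a, b]))// /dm /density_measure /=.
have -> : phi @^-1` `]a, b] = `]psi a, psi b]%classic.
  have hl x : (psi a < x) = (a < phi x) by rewrite -phi_mono psiK.
  have hr x : (x <= psi b) = (phi x <= b) by rewrite !leNgt -phi_mono psiK.
  by apply/seteqP; split => x /=; rewrite !in_itv/= hl hr.
rewrite lebesgue_measure_itv/= /density_measure lte_fin; case: ifPn => [|] ab.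
  by rewrite phi_ftc ?psiK// -(phi_mono (psi a)) !psiK.
rewrite set_itv_ge ?integral_set0//.
by rewrite bnd_simp -(phi_mono (psi a)) !psiK.
Qed.

Lemma ge0_integral_cov (f : R -> R) : measurable_fun setT f -> (forall x, 0 <= f x) ->
  (\int[mu]_x (f x)%:E = \int[mu]_x (f (phi x) * w x)%:E)%E.
Proof.
move=> mf f0.
exact: (@ge0_integral_density _ _ _ (measurableTypeR R) (measurableTypeR R) mu mu phi w mw w0
  mphi lebesgue_measure_cov f).
Qed.

End change_of_variables.

Section lebesgue_substitutions.
Context {R : realType}.
Local Notation mu := (@lebesgue_measure R).

Let integral_cst_oc (c a b : R) : a < b ->
  (\int[mu]_(x in `]a, b]) c%:E = (c * (b - a))%:E)%E.
Proof. by move=> ab; rewrite integral_cst//= lebesgue_measure_itv/= lte_fin ab EFinM. Qed.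

Lemma ge0_integral_scale (c : R) (f : R -> R) : 0 < c ->
  measurable_fun setT f -> (forall x, 0 <= f x) ->
  (\int[mu]_x (f x)%:E = \int[mu]_x (f (c * x) * c)%:E)%E.
Proof.
move=> c0 mf f0.
apply: (@ge0_integral_cov _ (fun x => c * x) (fun x => c^-1 * x) (fun=> c)) => //.
- by move=> x; exact: ltW.
- exact: measurable_funM.
- by move=> x; rewrite mulrA divff ?mul1r// gt_eqF.
- by move=> x y; rewrite ltr_pM2l.
- by move=> a b ab; rewrite integral_cst_oc// mulrBr.
Qed.

Lemma ge0_integral_shift (p : R) (f : R -> R) :
  measurable_fun setT f -> (forall x, 0 <= f x) ->
  (\int[mu]_x (f x)%:E = \int[mu]_x (f (x + p))%:E)%E.
Proof.
move=> mf f0.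
rewrite (@ge0_integral_cov _ (fun x => x + p) (fun x => x - p) (fun=> 1))//.
- by apply: eq_integral => x _; rewrite mulr1.
- exact: measurable_funD.
- by move=> x; rewrite subrK.
- by move=> x y; rewrite ltrD2r.
- by move=> a b ab; rewrite integral_cst_oc// mul1r; congr _%:E; ring.
Qed.

Lemma is_derive_signed_square (x : R) :
  is_derive x 1 (fun x : R => x * `|x|) (2 * `|x|).
Proof.
have [x0|x0|->] := ltgtP x 0.
- have e : \near x, (fun x : R => - (x ^+ 2)) x = x * `|x|.
    near=> y; rewrite ltr0_norm ?mulrN ?expr2//; near: y; exact: lt_nbhsl.
  apply: (@near_eq_is_derive R R^o R^o (fun x : R => - (x ^+ 2)) _ x 1 _ e).
  apply: is_derive_eq; rewrite /GRing.scale/= ltr0_norm//; ring.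
- have e : \near x, (fun x : R => x ^+ 2) x = x * `|x|.
    near=> y; rewrite gtr0_norm ?expr2//; near: y; exact: lt_nbhsr.
  apply: (@near_eq_is_derive R R^o R^o (fun x : R => x ^+ 2) _ x 1 _ e).
  apply: is_derive_eq; rewrite /GRing.scale/= gtr0_norm//; ring.
- rewrite normr0 mulr0.
  have c : h^-1 *: (((fun x : R => x * `|x|) \o shift 0) (h *: (1 : R)) - 0 * `|0 : R|)
      @[h --> (0 : R)^'] --> (0 : R).
    have : `|h| @[h --> (0 : R)^'] --> (0 : R).
      rewrite -[X in _ --> X](@normr0 _ R); apply: cvg_within_filter; exact: norm_continuous.
    apply: cvg_trans; apply: near_eq_cvg; near=> h.
    have h0 : h != 0 by near: h; exact: nbhs_dnbhs_neq.
    by rewrite /= addr0 mul0r subr0 /GRing.scale/= mulr1 mulrA mulVf// mul1r.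
  apply: DeriveDef; first by apply/cvg_ex; exists 0.
  by apply/cvg_lim.
Unshelve. all: by end_near. Qed.

(** Squaring is not injective, whereas [x |x|] is an increasing bijection of the line with
    derivative [2 |x|]; on functions of [|x|] it acts as the square. *)
Lemma ge0_integral_square (f : R -> R) :
  measurable_fun setT f -> (forall x, 0 <= f x) ->
  (\int[mu]_x (f x)%:E = \int[mu]_x (f (x * `|x|) * (2 * `|x|))%:E)%E.
Proof.
move=> mf f0.
have mn : measurable_fun setT (fun x : R => `|x|) by exact: normr_measurable.
apply: (@ge0_integral_cov _ (fun x => x * `|x|) (fun y => Num.sg y * Num.sqrt `|y|) (fun x => 2 * `|x|)) => //.
- by apply: measurable_funM.
- by apply: measurable_funM.
- move=> y; rewrite normrM (ger0_norm (sqrtr_ge0 _)) normr_sg mulrACA -expr2 sqr_sqrtr//.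
  by have [->|y0] := eqVneq y 0; rewrite ?normr0 ?mulr0// mulr1 -numEsg.
- have mono (x y : R) : x < y -> x * `|x| < y * `|y|.
    move=> xy; have [x0|x0] := lerP 0 x.
      have y0 : 0 < y := le_lt_trans x0 xy.
      by rewrite (ger0_norm x0) (gtr0_norm y0); nra.
    have [y0|y0] := lerP 0 y.
      by rewrite (ltr0_norm x0) (ger0_norm y0); nra.
    by rewrite (ltr0_norm x0) (ltr0_norm y0); nra.
  move=> x y; have [xy|yx|->] := ltgtP x y; last by rewrite ltxx.
    exact: mono.
  by apply/negbTE; rewrite -leNgt; apply/ltW/mono.
- move=> a b ab.
  rewrite integral_itv_obnd_cbnd//; last first.
    by apply/measurable_EFinP/measurable_funTS; exact: measurable_funM.
  rewrite (@continuous_FTC2 _ _ (fun x => x * `|x|))//.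
  + apply: continuous_subspaceT => x; apply: cvgM; [exact: cvg_cst|exact: norm_continuous].
  + have dc (x : R) : {for x, continuous (fun x : R => x * `|x|)}.
      by apply: cvgM; [exact: cvg_id|exact: norm_continuous].
    split.
    * by move=> x _; apply: ex_derive; exact: is_derive_signed_square.
    * by apply: cvg_at_right_filter; exact: dc.
    * by apply: cvg_at_left_filter; exact: dc.
  + by move=> x _; rewrite derive1E; have ? := is_derive_signed_square x; exact: derive_val.
Qed.

Lemma ge0_integral_even (f : R -> R) :
  measurable_fun setT f -> (forall x, 0 <= f x) -> (forall x, f (- x) = f x) ->
  (\int[mu]_x (f x)%:E = 2%:E * \int[mu]_(x in `[0%R, +oo[) (f x)%:E)%E.
Proof.
move=> mf f0 fe.
have mfE : measurable_fun setT (fun x => (f x)%:E) by exact/measurable_EFinP.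
have f0E x : (0 <= (f x)%:E)%E by rewrite lee_fin.
rewrite (_ : [set: _] = `]-oo, 0[ `|` `[0, +oo[)%classic; last first.
  apply/seteqP; split => // x _ /=; rewrite !in_itv/= andbT.
  by case: (ltP x 0); [left|right].
rewrite ge0_integral_setU//=; last 2 first.
- exact: measurable_funTS.
- apply/disj_setPRL => x /=; rewrite !in_itv/= andbT => h; apply/negP; by rewrite -leNgt.
rewrite integral_itv_bndo_bndc//; last exact: measurable_funTS.
rewrite (@ge0_integration_by_substitution0 _ (fun x => (f x)%:E))//.
rewrite mule_natl mule2n.
by congr (_ + _)%E; apply: eq_integral => x _; rewrite fe.
Qed.

End lebesgue_substitutions.

Section std_normal.
Context {R : realType} d (T : measurableType d) (P : probability T R).
Local Notation mu := (@lebesgue_measure R).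
Variable X : T -> R.
Hypothesis mX : measurable_fun setT X.

Lemma ge0_integral_std_normal (g : R -> R) :
  (forall A, measurable A -> P (X @^-1` A) = normal_prob 0 1 A) ->
  measurable_fun setT g -> (forall x, 0 <= g x) ->
  (\int[P]_t (g (X t))%:E = \int[mu]_x (g x * normal_pdf 0 1 x)%:E)%E.
Proof.
move=> H mg g0.
have mgE : measurable_fun setT (EFin \o g) by exact/measurable_EFinP.
pose X' : T -> measurableTypeR R := X.
have mX' : measurable_fun setT X' by exact: mX.
pose gE : measurableTypeR R -> \bar R := EFin \o g.
have mgE' : measurable_fun setT gE by exact: mgE.
have := @ge0_integral_pushforward _ _ _ _ _ _ mX' P setT gE measurableT mgE' (fun y _ => g0 y).
rewrite preimage_setT => <-.
transitivity (\int[normal_prob 0 1]_y (g y)%:E)%E.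
  by apply: eq_measure_integral => A mA _; exact: H.
apply: (@ge0_integral_density _ _ _ (measurableTypeR R) (measurableTypeR R) mu
  (normal_prob 0 1) id (normal_pdf 0 1)) => //.
  exact: measurable_normal_pdf.
by move=> x; exact: normal_pdf_ge0.
Qed.

Lemma std_normal_char :
  (forall A, measurable A -> P (X @^-1` A) = normal_prob 0 1 A) ->
  forall s phi, \int[P]_t cos (s * X t + phi) = expR (- (s ^+ 2 / 2)) * cos phi.
Proof.
move=> H s phi.
(* Adding 1 makes the test function nonnegative, so that the change of variables for nonnegative
   functions applies; the 1 cancels at the end. *)
pose g x : R := 1 + cos (s * x + phi).
have mg : measurable_fun setT g by apply: measurable_funD => //; exact: measurable_cos_affine.
have g0 x : 0 <= g x by rewrite /g; have := cos_geN1 (s * x + phi); lra.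
have ic : P.-integrable setT (EFin \o (fun t => cos (s * X t + phi))).
  apply: measurable_bounded_integrable => //.
  - by rewrite -ge0_fin_numE// fin_num_measure.
  - exact: (measurableT_comp (measurable_cos_affine s phi)).
  - exists 1; split; rewrite ?num_real// => y My t _ /=.
    exact: le_trans (norm_cos_le1 _) (ltW My).
have i1 : P.-integrable setT (EFin \o (fun=> 1 : R)).
  exact: (@finite_measure_integrable_cst _ _ _ P).
have E1 : \int[P]_t g (X t) = 1 + \int[P]_t cos (s * X t + phi).
  rewrite RintegralD//; congr (_ + _).
  rewrite Rintegral_cst// mul1r. by rewrite -[RHS]/(fine 1%E) -(probability_setT P).
have E2 : \int[mu]_x (g x * normal_pdf 0 1 x) = 1 + expR (- (s ^+ 2 / 2)) * cos phi.
  rewrite -Rintegral_normal_cos.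
  under eq_Rintegral do rewrite mulrDl mul1r.
  rewrite RintegralD//.
  - by rewrite {1}/Rintegral integral_normal_pdf.
  - exact: integrable_normal_pdf.
  - apply: integrable_trig_normal_pdf01; first exact: measurable_cos_affine.
    by move=> x; exact: norm_cos_le1.
have := ge0_integral_std_normal H mg g0; move/(congr1 fine).
by rewrite -/(Rintegral _ _ _) -/(Rintegral _ _ _) E1 E2; lra.
Qed.

End std_normal.

Section std_normal_conv.
Context {R : realType} d (T : measurableType d) (P : probability T R).
Variable X : T -> R.
Hypothesis mX : measurable_fun setT X.

Lemma char_std_normal :
  (forall s phi, \int[P]_t cos (s * X t + phi) = expR (- (s ^+ 2 / 2)) * cos phi) ->
  forall A, measurable A -> P (X @^-1` A) = normal_prob 0 1 A.
Proof.
move=> H A mA.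
pose Y : 'I_1 -> measurableTypeR R -> R := fun=> id.
pose N : probability (measurableTypeR R) R := normal_prob 0 1.
have mN : measurable_fun setT (id : measurableTypeR R -> R) by [].
have := @law_ext R 'I_1 _ _ T (measurableTypeR R) P N (fun=> X) Y (fun=> mX) (fun=> mN).
move=> /(_ _ [set f | A (f ord0)]); apply.
- apply: char_ext => // u phi.
  under eq_Rintegral do rewrite big_ord1.
  under [RHS]eq_Rintegral do rewrite big_ord1.
  by rewrite H /Y (@std_normal_char _ _ _ N id).
- have := @measurable_coord R 'I_1 ord0 measurableT A mA.
  by rewrite setTI.
Qed.

End std_normal_conv.

(** * The radial law, one coordinate at a time *)

Section chi.
Context {R : realType}.
Local Notation mu := (@lebesgue_measure R).

(* Unnormalized law of [rho ^+ 2], where [`|rho|] has the chi law with [k + 1] degrees of freedom. *)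
Definition chi_fun (k : nat) (S : set R) (rho : R) : R :=
  \1_S (rho ^+ 2) * (`|rho| ^+ k * expR (- (rho ^+ 2 / 2))).

Definition chi_mass (k : nat) (S : set R) : \bar R :=
  (\int[mu]_rho (chi_fun k S rho)%:E)%E.

Lemma chi_fun_ge0 k S rho : 0 <= chi_fun k S rho.
Proof. by rewrite /chi_fun indicE !mulr_ge0// ?expR_ge0// exprn_ge0. Qed.

Lemma chi_mass_ge0 k S : (0 <= chi_mass k S)%E.
Proof. by apply: integral_ge0 => x _; rewrite lee_fin chi_fun_ge0. Qed.

Lemma measurable_chi_fun k S : measurable S -> measurable_fun setT (chi_fun k S).
Proof.
move=> mS; apply: measurable_funM.
  exact: (measurableT_comp (measurable_indic mS)).
apply: measurable_funM.
  by apply: measurable_funX; exact: normr_measurable.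
apply: measurableT_comp => //; apply: measurableT_comp => //.
by apply: measurable_funM => //; apply: measurable_funX.
Qed.

(** Polar coordinates with the slope in place of the angle: [z = |rho| t] has Jacobian [|rho|], and
    for fixed [t] the sum of squares is [(1 + t^2) rho^2], which rescaling [rho] normalizes. The
    integral in [t] factors out and is left unevaluated. *)
Lemma chi_mass_step (k : nat) (S : set R) : measurable S ->
  (\int[mu]_z \int[mu]_rho
     (chi_fun k [set r | S (r + z ^+ 2)] rho * expR (- (z ^+ 2 / 2)))%:E =
   (\int[mu]_t ((Num.sqrt (1 + t ^+ 2)) ^- k.+2)%:E) * chi_mass k.+1 S)%E.
Proof.
move=> mS.
pose e (r : R) : R := expR (- (r ^+ 2 / 2)).
have me : measurable_fun setT e.
  apply: measurableT_comp => //; apply: measurableT_comp => //.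
  by apply: measurable_funM => //; apply: measurable_funX.
pose F (p : R * R) : R := \1_S (p.2 ^+ 2 + p.1 ^+ 2) * (`|p.2| ^+ k * e p.2) * e p.1.
have FE (z rho : R) : chi_fun k [set r | S (r + z ^+ 2)] rho * expR (- (z ^+ 2 / 2)) = F (z, rho).
  by rewrite /chi_fun /F /= !indicE.
have m2 : measurable_fun setT (fun p : R * R => p.2) by exact: measurable_snd.
have m1 : measurable_fun setT (fun p : R * R => p.1) by exact: measurable_fst.
have mF : measurable_fun setT F.
  apply: measurable_funM; last exact: (measurableT_comp me).
  apply: measurable_funM.
    apply: (measurableT_comp (measurable_indic mS)).
    by apply: measurable_funD; apply: measurable_funX.
  apply: measurable_funM; last exact: (measurableT_comp me).
  by apply: measurable_funX; exact: (measurableT_comp (@normr_measurable R setT)).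
have e0 r : 0 <= e r by exact: expR_ge0.
have F0 p : 0 <= F p by rewrite /F indicE !mulr_ge0// exprn_ge0.
under eq_integral do under eq_integral do rewrite FE.
have mFE : measurable_fun setT (fun p : measurableTypeR R * measurableTypeR R => (F p)%:E).
  by apply/measurable_EFinP; exact: mF.
have F0E (p : measurableTypeR R * measurableTypeR R) : (0 <= (F p)%:E)%E by rewrite lee_fin.
rewrite (@fubini_tonelli _ _ (measurableTypeR R) (measurableTypeR R) _ mu mu _ mFE F0E).
pose G (t rho : R) : R := \1_S (rho ^+ 2 + (`|rho| * t) ^+ 2) *
   (`|rho| ^+ k * e rho) * e (`|rho| * t) * `|rho|.
have mG : measurable_fun setT (fun p : R * R => G p.1 p.2).
  have mn : measurable_fun setT (fun p : R * R => `|p.2|).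
    exact: (measurableT_comp (@normr_measurable R setT)).
  apply: measurable_funM => //; apply: measurable_funM; last first.
    by apply: (measurableT_comp me); exact: measurable_funM.
  apply: measurable_funM.
    apply: (measurableT_comp (measurable_indic mS)).
    by apply: measurable_funD; apply: measurable_funX => //; exact: measurable_funM.
  apply: measurable_funM; last exact: (measurableT_comp me).
  exact: measurable_funX.
have G0 t rho : 0 <= G t rho by rewrite /G indicE !mulr_ge0// exprn_ge0.
have mGE : measurable_fun setT (fun p : measurableTypeR R * measurableTypeR R => (G p.1 p.2)%:E).
  by apply/measurable_EFinP; exact: mG.
have G0E (p : measurableTypeR R * measurableTypeR R) : (0 <= (G p.1 p.2)%:E)%E by rewrite lee_fin.
have mFz (rho : R) : measurable_fun setT (fun z => F (z, rho)).
  exact: (measurable_fun_pair1 rho mF).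
transitivity (\int[mu]_rho \int[mu]_t (G t rho)%:E)%E.
  apply: ge0_ae_eq_integral => //.
  - exact: (@measurable_fun_fubini_tonelli_G _ _ _ _ _ mu _ mFE F0E).
  - exact: (@measurable_fun_fubini_tonelli_G _ _ _ _ _ mu _ mGE G0E).
  - by move=> x _; apply: integral_ge0 => y _; rewrite lee_fin.
  - by move=> x _; apply: integral_ge0 => y _; rewrite lee_fin.
  (* The scaling by [|rho|] degenerates only at [rho = 0], a null set. *)
  - exists [set 0]; split => //; first exact: lebesgue_measure_set1.
    move=> rho /=; apply: contra_notP => /eqP rho0 _.
    have n0 : 0 < `|rho| by rewrite normr_gt0.
    rewrite (@ge0_integral_scale _ `|rho| (fun z => F (z, rho)) n0 (mFz rho))//.
rewrite -(@fubini_tonelli _ _ (measurableTypeR R) (measurableTypeR R) _ mu mu _ mGE G0E)/=.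
have s0 t : 0 < Num.sqrt (1 + t ^+ 2) :> R.
  by rewrite sqrtr_gt0 ltr_pwDl// sqr_ge0.
have Gt (t : R) : (\int[mu]_rho (G t rho)%:E = (Num.sqrt (1 + t ^+ 2) ^- k.+2)%:E * chi_mass k.+1 S)%E.
  set s := Num.sqrt (1 + t ^+ 2).
  have ss0 : 0 < s by exact: s0.
  have s2 : s ^+ 2 = 1 + t ^+ 2 by rewrite sqr_sqrtr// addr_ge0// sqr_ge0.
  rewrite /chi_mass (@ge0_integral_scale _ s (chi_fun k.+1 S) ss0)//; last 2 first.
  - exact: measurable_chi_fun.
  - by move=> x; exact: chi_fun_ge0.
  rewrite -ge0_integralZl//; last 3 first.
  - apply/measurable_EFinP; apply: measurable_funM => //.
    by apply: (measurableT_comp (measurable_chi_fun k.+1 mS)); exact: measurable_funM.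
  - by move=> x _; rewrite lee_fin mulr_ge0 ?chi_fun_ge0// ltW.
  - by rewrite lee_fin invr_ge0 exprn_ge0// ltW.
  apply: eq_integral => rho _; rewrite -EFinM; congr (_%:E).
  rewrite /G /chi_fun /e.
  have -> : rho ^+ 2 + (`|rho| * t) ^+ 2 = (s * rho) ^+ 2.
    by rewrite !exprMn s2 real_normK ?num_real//; ring.
  have -> : expR (- ((s * rho) ^+ 2 / 2)) = expR (- (rho ^+ 2 / 2)) * expR (- ((`|rho| * t) ^+ 2 / 2)).
    by rewrite -expRD; congr expR; rewrite !exprMn s2 real_normK ?num_real//; ring.
  have -> : `|s * rho| ^+ k.+1 = s ^+ k.+1 * (`|rho| ^+ k * `|rho|).
    by rewrite normrM (gtr0_norm ss0) exprMn [X in _ * X]exprSr.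
  have -> : s ^- k.+2 = (s ^+ k.+1)^-1 * s^-1 by rewrite exprS invfM mulrC.
  have sk : s ^+ k.+1 != 0 by rewrite expf_neq0// gt_eqF.
  have sn : s != 0 by rewrite gt_eqF.
  by field; rewrite sn sk.
under eq_integral do rewrite Gt.
rewrite ge0_integralZr//.
- apply/measurable_EFinP.
  apply: continuous_measurable_fun => x.
  apply: cvgV; first by rewrite expf_neq0// gt_eqF// s0.
  apply: (continuous_comp (f := fun x : R => Num.sqrt (1 + x ^+ 2)) (g := fun y : R => y ^+ k.+2)); last exact: exprn_continuous.
  apply: (continuous_comp (f := fun x : R => 1 + x ^+ 2) (g := Num.sqrt)); last exact: sqrt_continuous.
  by apply: cvgD; [exact: cvg_cst|exact: exprn_continuous].
- exact: chi_mass_ge0.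
Qed.

End chi.

Section gaussian_family.
Context {R : realType} (I : finType) d (T : measurableType d) (P : probability T R).
Local Notation mu := (@lebesgue_measure R).
Variable X : I -> T -> R.
Hypothesis mX : forall i, measurable_fun setT (X i).
Hypothesis stdX : forall (u : I -> R) phi,
  \int[P]_w cos (\sum_i u i * X i w + phi) = expR (- ((\sum_i u i ^+ 2) / 2)) * cos phi.

Lemma std_gaussian_split (J : {set I}) (S : set (@rvec R I)) : measurable S ->
  P ((fun w => X ^~ w : @rvec R I) @^-1` S) =
  (P \x P)%E ((fun w => (split_pair X J) ^~ w : @rvec R I) @^-1` S).
Proof.
apply: (split_law_char mX (Q := fun u => (\sum_i u i ^+ 2) / 2)) => // u.
rewrite -mulrDl -big_split/=; congr (_ / _); apply: eq_bigr => i _.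
by rewrite /restrict_to finset.in_setC; case: (i \in J) => /=; rewrite expr0n/= ?addr0 ?add0r.
Qed.

Lemma std_gaussian_marginal i (A : set R) : measurable A ->
  P (X i @^-1` A) = normal_prob 0 1 A.
Proof.
apply: char_std_normal => // s phi.
have := stdX (fun j => if j == i then s else 0) phi.
rewrite [in expR _](bigD1 i)//= eqxx big1 ?addr0 => [<-|j /negbTE ->]; last by rewrite expr0n.
apply: eq_Rintegral => t _; congr (cos (_ + _)).
by rewrite (bigD1 i)//= eqxx big1 ?addr0// => j /negbTE ->; rewrite mul0r.
Qed.

Let sqn (J : {set I}) w := \sum_(i in J) X i w ^+ 2.

Let msqn J : measurable_fun setT (sqn J).
Proof. by apply: measurable_sum_cond => i; apply: measurable_funX. Qed.

(** [std_gaussian_split] reads the new coordinate [i] from the first sample point; given its value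
    [z], the event for the others is [S] translated by [z^2], to which the hypothesis on [J]
    applies. *)
Lemma chi_law_step (J : {set I}) (i : I) k (c : R) : i \notin J -> 0 <= c ->
  (forall S, measurable S -> P (sqn J @^-1` S) = (c%:E * chi_mass k S)%E) ->
  exists2 c' : R, 0 <= c' &
  forall S, measurable S -> P (sqn (i |: J)%SET @^-1` S) = (c'%:E * chi_mass k.+1 S)%E.
Proof.
move=> iJ c0 IH.
have peak0 := @normal_peak_ge0 R 1.
pose C : \bar R := ((c * normal_peak 1)%:E * (\int[mu]_t ((Num.sqrt (1 + t ^+ 2)) ^- k.+2)%:E))%E.
have main S : measurable S -> P (sqn (i |: J)%SET @^-1` S) = (C * chi_mass k.+1 S)%E.
  move=> mS.
  pose A : set (@rvec R I) := [set f | S (\sum_(j in i |: J) f j ^+ 2)].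
  have mA : measurable A.
    have mg : measurable_fun setT (fun f : @rvec R I => \sum_(j in i |: J) f j ^+ 2).
      by apply: measurable_sum_cond => j; apply: measurable_funX; exact: measurable_coord.
    by have := mg measurableT S mS; rewrite setTI.
  rewrite -[LHS]/(P ((fun w => X ^~ w : @rvec R I) @^-1` A)) (std_gaussian_split [set i]%SET mA).
  rewrite /product_measure1.
  pose Sh (z : R) : set R := [set r | S (r + z ^+ 2)].
  have mSz z : measurable (Sh z).
    have mg : measurable_fun setT (fun r : R => r + z ^+ 2) by exact: measurable_funD.
    by have := mg measurableT S mS; rewrite setTI.
  have secE x : xsection ((fun w => (split_pair X [set i]%SET)^~ w : @rvec R I) @^-1` A) x =
      sqn J @^-1` Sh (X i x).
    have sE y : \sum_(j in i |: J) split_pair X [set i]%SET j (x, y) ^+ 2 = sqn J y + X i x ^+ 2.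
      rewrite big_setU1//= addrC /split_pair !inE eqxx; congr (_ + _).
      apply: eq_bigr => j jJ; rewrite inE; case: eqP => // ji.
      by rewrite -ji jJ in iJ.
    by apply/seteqP; split => y; rewrite /xsection /= inE /A/= sE.
  pose g z := fine (c%:E * chi_mass k (Sh z))%E.
  have gE z : (g z)%:E = (c%:E * chi_mass k (Sh z))%E.
    by rewrite /g fineK// -IH//; apply: fin_num_measure; rewrite -[X in measurable X]setTI; exact: msqn.
  have g0 z : 0 <= g z by rewrite -lee_fin gE mule_ge0 ?lee_fin ?chi_mass_ge0.
  pose F (p : measurableTypeR R * measurableTypeR R) : \bar R := (chi_fun k (Sh p.1) p.2)%:E.
  have mF : measurable_fun setT F.
    apply/measurable_EFinP.
    rewrite (_ : (fun p : measurableTypeR R * measurableTypeR R => _) = (fun p : measurableTypeR R * measurableTypeR R =>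
      \1_S ((p.2 : R) ^+ 2 + (p.1 : R) ^+ 2) * (`|p.2 : R| ^+ k * expR (- ((p.2 : R) ^+ 2 / 2))))); last first.
      by apply/funext => p; rewrite /chi_fun !indicE.
    have m2 : measurable_fun setT (fun p : R * R => p.2) by exact: measurable_snd.
    have m1 : measurable_fun setT (fun p : R * R => p.1) by exact: measurable_fst.
    apply: measurable_funM.
      apply: (measurableT_comp (measurable_indic mS)).
      by apply: measurable_funD; apply: measurable_funX.
    apply: (measurableT_comp (f := fun r : R => `|r| ^+ k * expR (- (r ^+ 2 / 2)))) => //.
    apply: measurable_funM; first by apply: measurable_funX; exact: normr_measurable.
    apply: measurableT_comp => //; apply: measurableT_comp => //.
    by apply: measurable_funM => //; apply: measurable_funX.
  have F0 p : (0 <= F p)%E by rewrite lee_fin chi_fun_ge0.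
  have mchi : measurable_fun setT (fun z : R => chi_mass k (Sh z)).
    exact: (@measurable_fun_fubini_tonelli_F _ _ _ _ _ mu F mF F0).
  have mg : measurable_fun setT g.
    apply: (measurableT_comp (fine_measurable _)) => //.
    by apply: emeasurable_funM => //; exact: measurable_cst.
  under eq_integral do rewrite /= secE IH// -gE.
  rewrite (ge0_integral_std_normal (mX i) _ mg g0); last exact: std_gaussian_marginal.
  rewrite /C -muleA -chi_mass_step//.
  rewrite -ge0_integralZl//; last 3 first.
  - have mFe : measurable_fun setT (fun p : measurableTypeR R * measurableTypeR R =>
        (chi_fun k (Sh p.1) p.2 * expR (- ((p.1 : R) ^+ 2 / 2)))%:E).
      apply/measurable_EFinP; apply: measurable_funM; first by apply/measurable_EFinP; exact: mF.
      apply: (measurableT_comp (f := fun r : R => expR (- (r ^+ 2 / 2)))) => //.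
      apply: measurableT_comp => //; apply: measurableT_comp => //.
      by apply: measurable_funM => //; apply: measurable_funX.
    apply: (@measurable_fun_fubini_tonelli_F _ _ _ _ _ mu _ mFe) => p.
    by rewrite lee_fin mulr_ge0 ?expR_ge0 ?chi_fun_ge0.
  - by move=> z _; apply: integral_ge0 => r _; rewrite lee_fin mulr_ge0 ?expR_ge0 ?chi_fun_ge0.
  - by rewrite lee_fin mulr_ge0.
  apply: eq_integral => z _.
  under [in RHS]eq_integral do rewrite EFinM.
  have mcf : measurable_fun setT (fun r : measurableTypeR R => (chi_fun k (Sh z) r)%:E).
    by apply/measurable_EFinP; exact: (measurable_chi_fun k (mSz z)).
  have cf0 r : [set: measurableTypeR R] r -> (0 <= (chi_fun k (Sh z) r)%:E)%E.
    by move=> _; rewrite lee_fin chi_fun_ge0.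
  rewrite (ge0_integralZr mu measurableT mcf cf0); last by rewrite lee_fin expR_ge0.
  rewrite -/(chi_mass _ _) EFinM gE normal_pdf01E !EFinM.
  by rewrite !muleA; congr (_ * _)%E; rewrite -!muleA; congr (_ * _)%E; rewrite muleC.
have := main setT measurableT; rewrite preimage_setT probability_setT => C1.
have C0 : (0 <= C)%E.
  rewrite mule_ge0 ?lee_fin ?mulr_ge0//; apply: integral_ge0 => t _.
  by rewrite lee_fin invr_ge0 exprn_ge0// sqrtr_ge0.
(* Finiteness comes without estimating the integral: an infinite [C] contradicts [C1], which says
   that [C] times a nonnegative mass equals 1. *)
have Cfin : C \is a fin_num.
  rewrite ge0_fin_numE//; case: C C0 C1 {main} => [r| |]//; first by rewrite ltry.
  move=> _; have := @chi_mass_ge0 R k.+1 setT; case: (chi_mass _ _) => [r| |]//.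
  rewrite lee_fin le_eqVlt => /predU1P[<-|r0]; first by rewrite mule0 => -[/eqP]; rewrite oner_eq0.
  by rewrite gt0_mulye ?lte_fin.
exists (fine C); first exact: fine_ge0.
by move=> S mS; rewrite fineK// main.
Qed.

(** The factor [c] stays existential; taking [S = setT] later shows that it normalizes the mass to
    1, which is all the tail estimates ask of it. *)
Lemma chi_law (J : {set I}) k : #|J| = k.+1 ->
  exists2 c : R, 0 <= c &
  forall S, measurable S -> P (sqn J @^-1` S) = (c%:E * chi_mass k S)%E.
Proof.
elim: k J => [J /eqP/cards1P[i ->]|k IH J Jk].
  exists (normal_peak 1); first exact: normal_peak_ge0.
  move=> S mS.
  rewrite /sqn; under eq_fun do rewrite big_set1.
  have mSq : measurable [set z : R | S (z ^+ 2)].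
    have mg : measurable_fun setT (fun r : R => r ^+ 2) by exact: measurable_funX.
    by have := mg measurableT S mS; rewrite setTI.
  rewrite -[LHS]/(P (X i @^-1` [set z | S (z ^+ 2)])) std_gaussian_marginal//.
  rewrite /normal_prob /chi_mass -ge0_integralZl//; last 3 first.
  - by apply/measurable_EFinP; exact: measurable_chi_fun.
  - by move=> r _; rewrite lee_fin chi_fun_ge0.
  - by rewrite lee_fin normal_peak_ge0.
  rewrite [LHS]integral_mkcond epatch_indic; apply: eq_integral => z _.
  rewrite -!EFinM normal_pdf01E /chi_fun expr0 mul1r !indicE; congr (_%:E).
  by rewrite mulrC mulrCA.
have /card_gt0P[i iJ] : (0 < #|J|)%N by rewrite Jk.
have [c c0 H] : exists2 c : R, 0 <= c &
  forall S, measurable S -> P (sqn (J :\ i)%SET @^-1` S) = (c%:E * chi_mass k S)%E.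
  by apply: IH; move: Jk; rewrite (cardsD1 i) iJ => -[].
rewrite -(finset.setD1K iJ); apply: (chi_law_step (c := c)) => //.
by rewrite !inE eqxx.
Qed.

End gaussian_family.

(** * Comparison of shifted chi-square variables *)

Section chi_square_privacy.
Context {R : realType}.
Local Notation mu := (@lebesgue_measure R).

(** The unnormalized chi-square density with [k = m + 2] degrees of freedom: the usual power
    [r^(k/2 - 1)] is [sqrt r ^+ m]. *)
Definition chi_square_fun (m : nat) (r : R) : R :=
  \1_`[0, +oo[%classic r * (Num.sqrt r ^+ m * expR (- (r / 2))).

Lemma chi_square_fun_ge0 m r : 0 <= chi_square_fun m r.
Proof. by rewrite /chi_square_fun indicE !mulr_ge0// ?expR_ge0// exprn_ge0// sqrtr_ge0. Qed.

Lemma measurable_sqrt : measurable_fun setT (@Num.sqrt R).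
Proof. by apply: continuous_measurable_fun; exact: sqrt_continuous. Qed.

Lemma measurable_chi_square_fun m : measurable_fun setT (chi_square_fun m).
Proof.
apply: measurable_funM; first exact: measurable_indic.
apply: measurable_funM; first by apply: measurable_funX; exact: measurable_sqrt.
apply: measurableT_comp => //; apply: measurableT_comp => //.
exact: measurable_funM.
Qed.

(** The substitution [r = rho |rho|]. One of the [m + 1] powers of [|rho|] pays for the Jacobian, so
    the formula starts at two degrees of freedom. The 1/2 in [f] cancels the 2 of the Jacobian and,
    on the other side, the 2 from evenness. *)
Lemma chi_massE (m : nat) (S : set R) : measurable S ->
  (chi_mass m.+1 S = \int[mu]_r (\1_S r * chi_square_fun m r)%:E)%E.
Proof.
move=> mS.
pose f (x : R) := \1_S `|x| * (Num.sqrt `|x| ^+ m * expR (- (`|x| / 2))) / 2.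
have mf : measurable_fun setT f.
  apply: measurable_funM => //; apply: measurable_funM.
    by apply: (measurableT_comp (measurable_indic mS)); exact: normr_measurable.
  apply: measurable_funM.
    by apply: measurable_funX; apply: (measurableT_comp measurable_sqrt); exact: normr_measurable.
  apply: measurableT_comp => //; apply: measurableT_comp => //.
  by apply: measurable_funM => //; exact: normr_measurable.
have f0 x : 0 <= f x by rewrite /f indicE !mulr_ge0// ?expR_ge0// exprn_ge0// sqrtr_ge0.
transitivity (\int[mu]_x (f x)%:E)%E.
  rewrite (ge0_integral_square mf f0); apply: eq_integral => x _; congr (_%:E).
  rewrite /f /chi_fun !normrM normr_id -expr2 sqrtr_sqr normr_id real_normK ?num_real//.
  by rewrite [`|x| ^+ m.+1]exprSr; field.
rewrite (ge0_integral_even mf f0); last by move=> x; rewrite /f normrN.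
rewrite -ge0_integralZl//; last 2 first.
- exact/measurable_EFinP/measurable_funTS.
- by move=> x _; rewrite lee_fin.
rewrite integral_mkcond epatch_indic; apply: eq_integral => x _.
rewrite -!EFinM /chi_square_fun /f; congr (_%:E).
rewrite [\1_`[0, +oo[%classic x]indicE mem_setE in_itv/= andbT.
have [x0|x0] := leP 0 x; last by rewrite mulr0 mul0r mulr0.
by rewrite ger0_norm//; field.
Qed.

Variables (m : nat) (c : R).
Hypothesis c0 : 0 <= c.
Hypothesis mass1 : (c%:E * chi_mass m.+1 setT = 1)%E.

Let chi_square_prob (S : set R) : \bar R := (c%:E * chi_mass m.+1 S)%E.

Let mshift p (S : set R) : measurable S -> measurable [set r | S (r + p)].
Proof.
move=> mS; have mg : measurable_fun setT (fun r : R => r + p) by exact: measurable_funD.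
by have := mg measurableT S mS; rewrite setTI.
Qed.

Let mind (S : set R) : measurable S ->
  measurable_fun setT (fun r => (\1_S r * chi_square_fun m r)%:E).
Proof.
move=> mS; apply/measurable_EFinP; apply: measurable_funM; first exact: measurable_indic.
exact: measurable_chi_square_fun.
Qed.

Let mindS (S : set R) p : measurable S ->
  measurable_fun setT (fun r => (\1_S r * chi_square_fun m (r + p))%:E).
Proof.
move=> mS; apply/measurable_EFinP; apply: measurable_funM; first exact: measurable_indic.
apply: (measurableT_comp (@measurable_chi_square_fun m)); exact: measurable_funD.
Qed.

Let ind_ge0 (S : set R) p r : (0 <= (\1_S r * chi_square_fun m (r + p))%:E)%E.
Proof. by rewrite lee_fin mulr_ge0 ?chi_square_fun_ge0// indicE. Qed.

(** Off [E] the pointwise ratio gives the factor [expR eps]; on [E] the indicator of [S] is dropped.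
    As [E] restricts [r + p], the argument of the density on the left, translation invariance turns
    this part into the mass of [E] under the unshifted density. *)
Let compare (S E : set R) (p q eps : R) : measurable S -> measurable E ->
  (forall r, r + p \notin E -> chi_square_fun m (r + p) <= expR eps * chi_square_fun m (r + q)) ->
  (\int[mu]_r (\1_S r * chi_square_fun m (r + p))%:E <=
   (expR eps)%:E * \int[mu]_r (\1_S r * chi_square_fun m (r + q))%:E +
   \int[mu]_r (\1_E r * chi_square_fun m r)%:E)%E.
Proof.
move=> mS mE H.
have shE : (\int[mu]_r (\1_E r * chi_square_fun m r)%:E =
    \int[mu]_r (\1_E (r + p) * chi_square_fun m (r + p))%:E)%E.
  rewrite (@ge0_integral_shift _ p (fun r => \1_E r * chi_square_fun m r))//.
    by apply/measurable_EFinP; exact: mind.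
  by move=> x; rewrite mulr_ge0 ?chi_square_fun_ge0// indicE.
have mSq : measurable_fun setT (fun r : measurableTypeR R => (\1_S r * chi_square_fun m (r + q))%:E).
  exact: mindS.
have Sq0 (r : measurableTypeR R) : [set: measurableTypeR R] r ->
    (0 <= (\1_S r * chi_square_fun m (r + q))%:E)%E.
  by move=> _; exact: ind_ge0.
rewrite shE -(ge0_integralZl mu measurableT mSq Sq0); last by rewrite lee_fin expR_ge0.
have mEs : measurable_fun setT (fun r : R => (\1_E (r + p) * chi_square_fun m (r + p))%:E).
  apply/measurable_EFinP; apply: (measurableT_comp (f := fun r : R => \1_E r * chi_square_fun m r)).
    by apply/measurable_EFinP; exact: mind.
  exact: measurable_funD.
rewrite -ge0_integralD//; last 3 first.
- by move=> r _; rewrite mule_ge0 ?lee_fin ?expR_ge0// -lee_fin ind_ge0.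
- by apply: emeasurable_funM => //; exact: mindS.
- by move=> r _; rewrite lee_fin mulr_ge0 ?chi_square_fun_ge0// indicE.
apply: ge0_le_integral => //.
- exact: mindS.
- apply: emeasurable_funD => //; apply: emeasurable_funM => //; exact: mindS.
move=> r _; rewrite -EFinM -EFinD lee_fin.
have [rE|rE] := boolP (r + p \in E).
  rewrite [\1_E _]indicE rE mul1r.
  apply: (@le_trans _ _ (chi_square_fun m (r + p))).
    by rewrite ler_piMl ?chi_square_fun_ge0// indicE; case: (_ \in _).
  by rewrite lerDr mulr_ge0 ?expR_ge0// mulr_ge0 ?chi_square_fun_ge0// indicE.
rewrite [\1_E _]indicE (negbTE rE) mul0r addr0 [leRHS]mulrCA.
by apply: ler_wpM2l; [rewrite indicE|exact: H].
Qed.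

Let massS (S : set R) : measurable S -> chi_square_prob S =
  (c%:E * \int[mu]_r (\1_S r * chi_square_fun m (r + 0))%:E)%E.
Proof.
move=> mS; rewrite /chi_square_prob chi_massE//; congr (_ * _)%E.
by apply: eq_integral => r _; rewrite addr0.
Qed.

Let massSp (S : set R) p : measurable S -> chi_square_prob [set r | S (r + p)%R] =
  (c%:E * \int[mu]_r (\1_S r * chi_square_fun m (r + - p))%:E)%E.
Proof.
move=> mS; rewrite /chi_square_prob chi_massE//; last exact: mshift.
rewrite (@ge0_integral_shift _ p (fun r => \1_S r * chi_square_fun m (r + - p)))//.
- by congr (_ * _)%E; apply: eq_integral => r _; rewrite addrK !indicE.
- by apply/measurable_EFinP; exact: mindS.
- by move=> r; rewrite -lee_fin; exact: ind_ge0.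
Qed.

Let compare_prob (S E : set R) (p q eps : R) : measurable S -> measurable E ->
  (forall r, r + p \notin E -> chi_square_fun m (r + p) <= expR eps * chi_square_fun m (r + q)) ->
  (c%:E * \int[mu]_r (\1_S r * chi_square_fun m (r + p))%:E <=
   (expR eps)%:E * (c%:E * \int[mu]_r (\1_S r * chi_square_fun m (r + q))%:E) +
   chi_square_prob E)%E.
Proof.
move=> mS mE H; rewrite /chi_square_prob chi_massE// muleCA.
rewrite -ge0_muleDr; last 2 first.
- by rewrite mule_ge0 ?lee_fin ?expR_ge0//; apply: integral_ge0 => r _; exact: ind_ge0.
- by apply: integral_ge0 => r _; rewrite lee_fin mulr_ge0 ?chi_square_fun_ge0// indicE.
by rewrite lee_wpmul2l ?lee_fin//; exact: compare.
Qed.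

Lemma sqrt_expR_le (x y t : R) (k : nat) : 0 <= x -> 0 <= y -> x <= y * expR t ->
  Num.sqrt x ^+ k <= Num.sqrt y ^+ k * expR (k%:R * (t / 2)).
Proof.
move=> x0 y0 xy; rewrite mulrC expRM_natl mulrC -exprMn; apply: lerXn2r.
- by rewrite nnegrE sqrtr_ge0.
- by rewrite nnegrE mulr_ge0 ?sqrtr_ge0 ?expR_ge0.
rewrite -(@ler_pXn2r _ 2)// ?nnegrE ?sqrtr_ge0 ?mulr_ge0 ?sqrtr_ge0 ?expR_ge0//.
rewrite exprMn !sqr_sqrtr// -expRM_natl.
by have -> : 2%:R * (t / 2) = t :> R by field.
Qed.

(** The shifted variable has at [r] the original density at [r - p], and the ratio to the density at
    [r] is [e^(p/2) (1 - p/r)^(m/2)]. The second factor compensates least for large [r], so the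
    upper tail is cut off; the rest is [1 - p/r <= e^(-p/r)]. *)
Lemma chi_square_add (p r1 eps : R) (S : set R) : 0 <= p -> 0 < r1 ->
  p / 2 - m%:R * (p / (r1 + p) / 2) <= eps -> measurable S ->
  (chi_square_prob [set r | S (r + p)%R] <=
   (expR eps)%:E * chi_square_prob S + chi_square_prob `]r1, +oo[%classic)%E.
Proof.
move=> p0 r10 heps mS; rewrite massSp// massS//; apply: compare_prob => // r.
rewrite mem_setE in_itv/= andbT -leNgt addr0 => rr1.
rewrite /chi_square_fun; set x := r + - p in rr1 *.
have rx : r = x + p by rewrite /x subrK.
rewrite rx !indicE !mem_setE !in_itv/= !andbT.
have [x0|x0] := leP 0 x; last by rewrite mul0r !mulr_ge0 ?expR_ge0// exprn_ge0// sqrtr_ge0.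
rewrite addr_ge0// !mul1r.
have xle : x <= (x + p) * expR (- (p / (r1 + p))).
  have [xp0|xp0] := eqVneq (x + p) 0.
    by rewrite xp0 mul0r; lra.
  have xp : 0 < x + p by rewrite lt_def xp0 addr_ge0.
  apply: (@le_trans _ _ ((x + p) * expR (- (p / (x + p))))); last first.
    rewrite ler_wpM2l ?(ltW xp)// ler_expR lerN2 ler_wpM2l// lef_pV2 ?posrE//; lra.
  apply: (@le_trans _ _ ((x + p) * (1 + - (p / (x + p))))); last by rewrite ler_wpM2l ?(ltW xp)// expR_ge1Dx.
  by rewrite mulrDr mulr1 mulrN mulrCA divff// mulr1 addrK.
have := sqrt_expR_le m x0 (addr_ge0 x0 p0) xle.
move=> /(ler_wpM2r (expR_ge0 (- (x / 2)))) /le_trans; apply.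
rewrite -[leLHS]mulrA -expRD [leRHS]mulrCA -expRD ler_wpM2l ?exprn_ge0 ?sqrtr_ge0// ler_expR.
rewrite mulNr mulrN; move: heps; lra.
Qed.

(** The inverse ratio [e^(-p/2) (r / (r - p))^(m/2)] blows up as [r] decreases to [p], so the lower
    tail is cut off at some [r0 > p]; there [r / (r - p) <= e^(p / (r - p))]. *)
Lemma chi_square_sub (p r0 eps : R) (S : set R) : 0 <= p -> p < r0 ->
  m%:R * (p / (r0 - p) / 2) - p / 2 <= eps -> measurable S ->
  (chi_square_prob S <=
   (expR eps)%:E * chi_square_prob [set r | S (r + p)%R] + chi_square_prob `]-oo, r0[%classic)%E.
Proof.
move=> p0 pr0 heps mS; rewrite massSp// massS//; apply: compare_prob => // r.
rewrite mem_setE in_itv/= -leNgt addr0 => rr0.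
rewrite /chi_square_fun !indicE !mem_setE !in_itv/= !andbT.
have rp : 0 < r - p by lra.
have r00 : 0 <= r by lra.
rewrite r00 (ltW rp) !mul1r.
have xle : r <= (r - p) * expR (p / (r0 - p)).
  apply: (@le_trans _ _ ((r - p) * expR (p / (r - p)))); last first.
    rewrite ler_wpM2l ?(ltW rp)// ler_expR ler_wpM2l// lef_pV2 ?posrE//; lra.
  apply: (@le_trans _ _ ((r - p) * (1 + (p / (r - p))))); last by rewrite ler_wpM2l ?(ltW rp)// expR_ge1Dx.
  by rewrite mulrDr mulr1 mulrCA divff ?gt_eqF// mulr1 subrK.
have := sqrt_expR_le m r00 (ltW rp) xle.
move=> /(ler_wpM2r (expR_ge0 (- (r / 2)))) /le_trans; apply.
rewrite -[leLHS]mulrA -expRD [leRHS]mulrCA -expRD ler_wpM2l ?exprn_ge0 ?sqrtr_ge0// ler_expR.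
move: heps; lra.
Qed.

(* The exponential tilt turns the density of the radius [rho] into that of [rho / s]. *)
Lemma chi_square_chernoff (s : R) (S : set R) : 0 < s -> measurable S ->
  (forall r, S r -> 0 <= (1 - (s ^+ 2)^-1) * (r - m.+2%:R * s ^+ 2)) ->
  (chi_square_prob S <= (s ^+ m.+2 * expR (- (m.+2%:R / 2 * (s ^+ 2 - 1))))%:E)%E.
Proof.
move=> s0 mS HS.
set k := m.+2.
have sn0 : s != 0 by rewrite gt_eqF.
set e := expR _.
have e0 : 0 <= e by exact: expR_ge0.
have si0 : 0 < s^-1 by rewrite invr_gt0.
have mT := measurable_chi_fun m.+1 (@measurableT _ R).
have key : (chi_mass m.+1 S <= (s ^+ k * e)%:E * chi_mass m.+1 setT)%E.
  rewrite {2}/chi_mass (ge0_integral_scale si0 mT (chi_fun_ge0 _ _)).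
  rewrite -ge0_integralZl//; last 3 first.
  - apply/measurable_EFinP; apply: measurable_funM => //.
    by apply: (measurableT_comp mT); exact: measurable_funM.
  - by move=> x _; rewrite lee_fin mulr_ge0 ?chi_fun_ge0// ltW.
  - by rewrite lee_fin mulr_ge0// exprn_ge0// ltW.
  apply: ge0_le_integral => //.
  - by move=> x _; rewrite lee_fin chi_fun_ge0.
  - by apply/measurable_EFinP; exact: measurable_chi_fun.
  - apply: emeasurable_funM => //; apply/measurable_EFinP; apply: measurable_funM => //.
    by apply: (measurableT_comp mT); exact: measurable_funM.
  move=> x _; rewrite -EFinM lee_fin /chi_fun.
  have -> : \1_[set: R] ((s^-1 * x) ^+ 2) = 1 :> R by rewrite indicE mem_set.
  rewrite mul1r.
  rewrite normrM (gtr0_norm si0) exprMn.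
  have -> : s ^+ k * e * (s^-1 ^+ m.+1 * `|x| ^+ m.+1 * expR (- ((s^-1 * x) ^+ 2 / 2)) * s^-1) =
    `|x| ^+ m.+1 * (e * expR (- ((s^-1 * x) ^+ 2 / 2))).
    rewrite /k exprS exprVn; have sk : s ^+ m.+1 != 0 by rewrite expf_neq0.
    by field; rewrite sn0 sk.
  rewrite mulrCA ler_wpM2l ?exprn_ge0//.
  rewrite indicE; have [/set_mem xS|_] := boolP (x ^+ 2 \in S); last first.
    by rewrite mul0r mulr_ge0 ?expR_ge0.
  rewrite mul1r /e -expRD ler_expR.
  have := HS _ xS; rewrite -/k => H.
  (* The surplus in the exponent is half the quantity that the hypothesis on [S] makes nonnegative.
     This covers both tails: [s > 1] with [r >= k s^2], and [s < 1] with [r <= k s^2]. *)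
  have -> : - (k%:R / 2 * (s ^+ 2 - 1)) + - ((s^-1 * x) ^+ 2 / 2) =
    - (x ^+ 2 / 2) + (1 - (s ^+ 2)^-1) * (x ^+ 2 - k%:R * s ^+ 2) / 2.
    by field.
  by rewrite lerDl divr_ge0.
rewrite -[leRHS]mule1 -mass1 muleCA /chi_square_prob lee_wpmul2l ?lee_fin//.
Qed.

End chi_square_privacy.

(** * Arithmetic of the privacy budget *)

Section privacy_budget.
Context {R : realType}.

(** The square of [1 + x/2 <= e^(x/2)]. Its term [x^2/4] matters for the rates below, where [x] is
    smaller than [y - 1] and the linear bound [1 + x] falls short. *)
Lemma expR_le_sqr (x y : R) : 0 <= 1 + x / 2 -> y <= (1 + x / 2) ^+ 2 -> y <= expR x.
Proof.
move=> x0 /le_trans; apply.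
have -> : expR x = expR (x / 2) ^+ 2 by rewrite -expRM_natl; congr expR; field.
by apply: lerXn2r; rewrite ?nnegrE ?expR_ge0//; exact: expR_ge1Dx.
Qed.

(* The tails are cut at the radii [sqrt k * (1 + u)] and [sqrt k * (1 - u)] with [w = 1 / sqrt C2].
   Taking [u = 7/8 * w] instead of [w] leaves room for the terms of order [Q / k] in the losses. *)
Section chernoff_rates.
Variables (L w : R) (k : nat).
Hypotheses (w01 : 0 < w < 1) (kw : 2 * L <= k%:R * w ^+ 2).

Let u : R := 7 / 8 * w.

Lemma upper_chernoff_rate :
  (1 + u) ^+ k * expR (- (k%:R / 2 * ((1 + u) ^+ 2 - 1))) <= expR (- L).
Proof.
have /andP[w0 w1] := w01.
have u0 : 0 < u by rewrite /u; lra.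
have u1 : u < 7 / 8 by rewrite /u; lra.
(* Here and in the lower tail, 15/98 is [32/49 - 1/2]: the terms linear in [u] cancel and, with
   [u = 7/8 w], the exponent left is exactly [- k (32/49) u^2 = - k w^2 / 2]. *)
pose x := u - 15 / 98 * u ^+ 2.
have ux : 1 + u <= expR x.
  by apply: expR_le_sqr; rewrite /x; nra.
apply: (@le_trans _ _ (expR x ^+ k * expR (- (k%:R / 2 * ((1 + u) ^+ 2 - 1))))).
  by rewrite ler_wpM2r ?expR_ge0//; apply: lerXn2r; rewrite ?nnegrE ?expR_ge0//; lra.
rewrite -expRM_natl -expRD ler_expR.
have -> : k%:R * x + - (k%:R / 2 * ((1 + u) ^+ 2 - 1)) = - (k%:R * w ^+ 2 / 2).
  by rewrite /x /u; field.
by rewrite lerN2 ler_pdivlMr// mulrC.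
Qed.

Lemma lower_chernoff_rate :
  (1 - u) ^+ k * expR (- (k%:R / 2 * ((1 - u) ^+ 2 - 1))) <= expR (- L).
Proof.
have /andP[w0 w1] := w01.
have u0 : 0 < u by rewrite /u; lra.
have u1 : u < 7 / 8 by rewrite /u; lra.
pose x := - u - 15 / 98 * u ^+ 2.
have ux : 1 - u <= expR x.
  by apply: expR_le_sqr; rewrite /x; nra.
apply: (@le_trans _ _ (expR x ^+ k * expR (- (k%:R / 2 * ((1 - u) ^+ 2 - 1))))).
  by rewrite ler_wpM2r ?expR_ge0//; apply: lerXn2r; rewrite ?nnegrE ?expR_ge0//; lra.
rewrite -expRM_natl -expRD ler_expR.
have -> : k%:R * x + - (k%:R / 2 * ((1 - u) ^+ 2 - 1)) = - (k%:R * w ^+ 2 / 2).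
  by rewrite /x /u; field.
by rewrite lerN2 ler_pdivlMr// mulrC.
Qed.

End chernoff_rates.

Section loss.
Variables (eps w Q : R) (m : nat).
Hypotheses (eps01 : 0 < eps < 1) (w01 : 0 < w < 1).
Hypotheses (Q0 : 0 <= Q) (Qle : Q * (2 * w) <= eps * (1 - w) ^+ 2).
Hypothesis kw : 4 <= m.+2%:R * w ^+ 2.

Let u : R := 7 / 8 * w.
Let K : R := m.+2%:R.
Let r1 := K * (1 + u) ^+ 2.
Let r0 := K * (1 - u) ^+ 2.

Let mK : m%:R = K - 2 :> R. Proof. by rewrite /K -[m.+2]addn2 natrD addrK. Qed.

(** The exponents required by [chi_square_add] at [r1] and by [chi_square_sub] at [r0], made uniform
    in [p <= Q], with numerator and denominator divided by [K]. *)
Definition loss_add : R := Q / 2 * ((2 * u + u ^+ 2 + (Q + 2) / K) / (1 + u) ^+ 2).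
Definition loss_sub : R := Q / 2 * ((2 * u - u ^+ 2 + Q / K) / ((1 - u) ^+ 2 - Q / K)).

Let e := Q / K.
Let e0 : 0 <= e. Proof. by rewrite divr_ge0// ltW. Qed.

(** From [eps < 1] comes [Q <= (1 - w)^2 / (2 w)], and from [kw] comes [1 / K <= w^2 / 4]. *)
Let ew : e <= w * (1 - w) ^+ 2 / 8.
Proof.
have /andP[w0 w1] := w01; have /andP[eps0 eps1] := eps01.
rewrite /e ler_pdivrMr//.
have h : Q * (2 * w) <= (1 - w) ^+ 2.
  apply: (le_trans Qle); rewrite ler_piMl ?sqr_ge0//; exact: ltW.
have w20 : 0 < 2 * w by lra.
rewrite -(ler_pM2r w20); apply: (le_trans h).
have kw' : 4 <= K * w ^+ 2 by exact: kw.
have sq : 0 <= (1 - w) ^+ 2 by exact: sqr_ge0.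
have := ler_wpM2l sq kw'.
by rewrite !expr2; lra.
Qed.

(** The gap [w - u = w / 8] is spent here: [(1 - u)^2 - (1 - w)^2] is at least [w (1 - w) / 8],
    which dominates [e]. *)
Let D2 : (1 - w) ^+ 2 <= (1 - u) ^+ 2 - e.
Proof.
have /andP[w0 w1] := w01; have := ew; have := e0; rewrite /u => e0' ew'.
have : w * (1 - w) ^+ 2 <= w * (1 - w) by rewrite expr2; nra.
by nra.
Qed.

Lemma loss_add_ge0 : 0 <= loss_add.
Proof.
have /andP[w0 w1] := w01.
have u0 : 0 < u by rewrite /u; lra.
apply: mulr_ge0; first exact: divr_ge0.
apply: divr_ge0; last exact: sqr_ge0.
apply: addr_ge0; first by have := sqr_ge0 u; lra.
by apply: divr_ge0; [rewrite addr_ge0|exact: ltW].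
Qed.

(** Over the common denominator [(1 - w)^2] the numerators add up to at most [4 w], and
    [Q / 2 * 4 w / (1 - w)^2 <= eps] is [Qle]. The [u^2] terms of the two losses have opposite
    signs, which is why the sum is bounded rather than each loss. *)
Lemma lossD_le : loss_add + loss_sub <= eps.
Proof.
have /andP[w0 w1] := w01; have /andP[eps0 eps1] := eps01.
have u0 : 0 < u by rewrite /u; lra.
have e0' := e0; have ew' := ew; have D2' := D2.
have [t [tE t0 tw]] : exists t, [/\ t = 2 / K, 0 <= t & t <= w ^+ 2 / 2].
  exists (2 / K); split => //; first by apply: divr_ge0 => //; exact: ltW.
  rewrite ler_pdivrMr// mulrAC ler_pdivlMr// [w ^+ 2 * K]mulrC.
  by apply: le_trans kw; lra.
pose N1 := 2 * u + u ^+ 2 + e + t.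
pose N2 := 2 * u - u ^+ 2 + e.
have N10 : 0 <= N1 by rewrite /N1; have := sqr_ge0 u; lra.
have u1 : u < 1 by rewrite /u; lra.
have N20 : 0 <= N2 by rewrite /N2; nra.
have w10 : 0 < (1 - w) ^+ 2 by rewrite exprn_gt0//; lra.
have u10 : 0 < (1 + u) ^+ 2 by rewrite exprn_gt0//; lra.
have h1 : N1 / (1 + u) ^+ 2 <= N1 * (1 - w) / (1 - w) ^+ 2.
  have -> : N1 * (1 - w) / (1 - w) ^+ 2 = N1 / (1 - w) by field; lra.
  by rewrite ler_wpM2l// lef_pV2 ?posrE//; nra.
have h2 : N2 / ((1 - u) ^+ 2 - e) <= N2 / (1 - w) ^+ 2.
  by rewrite ler_wpM2l// lef_pV2 ?posrE//; apply: lt_le_trans D2'.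
(* The leading terms give at most [4 u = 7/2 w]; the remainders [e], [e (1 - w)] and [t (1 - w)] are
   at most [w / 8] each. *)
have h3 : N1 * (1 - w) + N2 <= 4 * w.
  have : w * (1 - w) ^+ 2 <= w by rewrite expr2; nra.
  have : e * (1 - w) <= e by nra.
  have : t * (1 - w) <= w ^+ 2 / 2 * (1 - w) by rewrite ler_wpM2r//; lra.
  have : w ^+ 2 / 2 * (1 - w) <= w / 8 by have := sqr_ge0 (w - 1 / 2); nra.
  rewrite /N1 /N2 /u; nra.
have -> : loss_add = Q / 2 * (N1 / (1 + u) ^+ 2) by rewrite /loss_add /N1 tE /e [(Q + 2) / _]mulrDl addrA.
have -> : loss_sub = Q / 2 * (N2 / ((1 - u) ^+ 2 - e)) by [].
rewrite -mulrDr.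
apply: (@le_trans _ _ (Q / 2 * (4 * w / (1 - w) ^+ 2))).
  rewrite ler_wpM2l ?divr_ge0//; apply: (le_trans (lerD h1 h2)).
  by rewrite -mulrDl ler_pM2r ?invr_gt0.
rewrite mulrA ler_pdivrMr//; move: Qle; lra.
Qed.

(** With [m = K - 2] the exponent is [p / 2] times [(r1 + p - K + 2) / (r1 + p)]; in the numerator
    [p] is raised to [Q], and the denominator is lowered to [r1]. *)
Lemma loss_addP p : 0 <= p <= Q -> p / 2 - m%:R * (p / (r1 + p) / 2) <= loss_add.
Proof.
move=> /andP[p0 pQ]; have /andP[w0 w1] := w01.
have u0 : 0 < u by rewrite /u; lra.
have u10 : 0 < (1 + u) ^+ 2 by rewrite exprn_gt0//; lra.
have r10 : 0 < r1 by rewrite mulr_gt0.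
have r1p : 0 < r1 + p by lra.
have -> : p / 2 - m%:R * (p / (r1 + p) / 2) = p / 2 * ((r1 + p - K + 2) / (r1 + p)).
  by rewrite mK; field; lra.
have -> : loss_add = Q / 2 * ((K * (2 * u + u ^+ 2) + Q + 2) / r1).
  by rewrite /loss_add /r1; field; apply/andP; split; rewrite gt_eqF//; lra.
have N0 : 0 <= r1 + p - K + 2.
  rewrite /r1; have -> : K * (1 + u) ^+ 2 + p - K + 2 = K * (2 * u + u ^+ 2) + p + 2 by ring.
  have : 0 <= K * (2 * u + u ^+ 2).
    by apply: mulr_ge0; [exact: ltW|have := sqr_ge0 u; lra].
  by lra.
apply: ler_pM; rewrite ?divr_ge0// ?(ltW r1p)//; first by lra.
apply: ler_pM; rewrite ?invr_ge0 ?(ltW r1p)//.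
  have -> : r1 = K + K * (2 * u + u ^+ 2) by rewrite /r1; ring.
  by lra.
by rewrite lef_pV2 ?posrE//; lra.
Qed.

Lemma loss_sub_lt : Q < r0.
Proof.
have /andP[w0 w1] := w01.
have w10 : 0 < (1 - w) ^+ 2 by rewrite exprn_gt0//; lra.
have : 0 < (1 - u) ^+ 2 - e by apply: lt_le_trans D2.
by rewrite subr_gt0 /e ltr_pdivrMr// mulrC.
Qed.

Lemma loss_subP p : 0 <= p <= Q -> m%:R * (p / (r0 - p) / 2) - p / 2 <= loss_sub.
Proof.
move=> /andP[p0 pQ]; have /andP[w0 w1] := w01.
have u0 : 0 < u by rewrite /u; lra.
have u1 : u < 1 by rewrite /u; lra.
have Qr0 := loss_sub_lt.
have r0p : 0 < r0 - p by lra.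
have r0Q : 0 < r0 - Q by lra.
have -> : m%:R * (p / (r0 - p) / 2) - p / 2 = p / 2 * ((K - 2 - r0 + p) / (r0 - p)).
  by rewrite mK; field; lra.
have -> : loss_sub = Q / 2 * ((K * (2 * u - u ^+ 2) + Q) / (r0 - Q)).
  rewrite /loss_sub /r0; congr (_ * _).
  have -> : K * (1 - u) ^+ 2 - Q = K * ((1 - u) ^+ 2 - Q / K) by field; rewrite gt_eqF.
  have -> : K * (2 * u - u ^+ 2) + Q = K * (2 * u - u ^+ 2 + Q / K) by field; rewrite gt_eqF.
  by rewrite -mulf_div divff ?mul1r// gt_eqF.
have uu : 0 <= 2 * u - u ^+ 2 by nra.
have KU : 0 <= K * (2 * u - u ^+ 2) by rewrite mulr_ge0// ltW.
have r0E : r0 = K - K * (2 * u - u ^+ 2) by rewrite /r0; ring.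
apply: (@le_trans _ _ (p / 2 * ((K * (2 * u - u ^+ 2) + Q) / (r0 - Q)))); last first.
  apply: ler_wpM2r; last by rewrite ler_wpM2r ?invr_ge0.
  by apply: divr_ge0; [exact: addr_ge0|exact: ltW].
rewrite ler_wpM2l ?divr_ge0//.
apply: (@le_trans _ _ ((K * (2 * u - u ^+ 2) + Q) / (r0 - p))).
  apply: ler_wpM2r; first by rewrite invr_ge0 ltW.
  by rewrite r0E; lra.
by rewrite ler_wpM2l ?addr_ge0// lef_pV2 ?posrE// lerD2l lerN2.
Qed.

End loss.
End privacy_budget.

(** * Characteristic functions of independent sums *)

Section independent_sum.
Context {R : realType} (I : finType) d (T : measurableType d) (P : probability T R).
Variables (Z : I -> T -> R) (q : I -> R).
Hypothesis mZ : forall i, measurable_fun setT (Z i).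
Hypothesis charZ : forall i phi, \int[P]_w cos (Z i w + phi) = expR (- q i) * cos phi.
Hypothesis indepZ : forall (b : I -> R) (J : {set I}),
  P [set w | forall i, i \in J -> Z i w < b i] =
  (\prod_(i in J) P [set w | (Z i w < b i)%R])%E.

(** Induction on the size of [J]: one variable is read from a separate sample point and, for a fixed
    value, joins the phase of the remaining sum, which the induction hypothesis leaves arbitrary. *)
Lemma independent_sum_char (J : {set I}) phi :
  \int[P]_w cos (\sum_(i in J) Z i w + phi) = expR (- \sum_(i in J) q i) * cos phi.
Proof.
elim: {J}#|J| {-2}J (erefl #|J|) phi => [J /cards0_eq -> phi|k IH J Jk phi].
  under eq_Rintegral do rewrite big_set0 add0r.
  rewrite big_set0 oppr0 expR0 mul1r Rintegral_cst//.
  rewrite -[RHS]mulr1; congr (_ * _).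
  by rewrite -[RHS]/(fine 1%E) -(probability_setT P).
have /card_gt0P[i iJ] : (0 < #|J|)%N by rewrite Jk.
set K := (J :\ i)%SET.
have iK : i \notin K by rewrite !inE eqxx.
have JE : J = (i |: K)%SET by rewrite finset.setD1K.
have Kk : #|K| = k by move: Jk; rewrite (cardsD1 i) iJ => -[].
pose X := split_pair Z [set i]%SET.
pose PP : probability (T * T)%type R := (P \x P)%E.
pose g (f : @rvec R I) := cos (f i + \sum_(j in K) f j + phi).
have mg : measurable_fun setT g.
  apply: (measurableT_comp (@measurable_cos R)); apply: measurable_funD => //.
  apply: measurable_funD; first exact: measurable_coord.
  by apply: measurable_sum_cond => j; exact: measurable_coord.
have split S : measurable S -> P ((fun w => Z ^~ w : @rvec R I) @^-1` S) =
    PP ((fun w => X ^~ w : @rvec R I) @^-1` S).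
  apply: split_law_box => // b.
  have := indepZ b [set: I]%SET; have := indepZ b [set i]%SET; have := indepZ b (~: [set i])%SET.
  have -> : [set w | forall j, j \in (~: [set i])%SET -> Z j w < b j] =
      [set w | forall j, j \notin [set i]%SET -> Z j w < b j].
    by apply: eq_set => w; under eq_forall do rewrite finset.in_setC.
  move=> -> ->.
  have -> : [set w | forall j, j \in [set: I]%SET -> Z j w < b j] =
      [set w | forall j, Z j w < b j].
    by apply/seteqP; split => w h j; [apply: h; rewrite inE|move=> _; exact: h].
  move=> ->; rewrite big_set1 (bigD1 i) ?inE//=; congr (_ * _)%E.
  by apply: eq_bigl => j; rewrite !inE.
have mX j : measurable_fun setT (X j) by exact: measurable_split_pair.
have := @law_integral R I _ _ T (T * T)%type P PP Z X mZ mX g 1 split mg.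
move=> /(_ (fun f => norm_cos_le1 _)).
rewrite /g; under [LHS]eq_Rintegral => w _.
  rewrite -big_setU1// -JE.
over.
move=> ->.
have XE x y : X i (x, y) + \sum_(j in K) X j (x, y) + phi =
    Z i x + (\sum_(j in K) Z j y + phi).
  rewrite addrA /X /split_pair !inE eqxx; congr (_ + _ + _).
  by apply: eq_bigr => j jK; rewrite inE; case: eqP => // ji; rewrite ji (negbTE iK) in jK.
rewrite (@Rintegral_prod_bounded _ _ _ _ _ _ _ _ 1); last 2 first.
- apply: (measurableT_comp (@measurable_cos R)); apply: measurable_funD => //.
  by apply: measurable_funD => //; apply: measurable_sum_cond.
- by move=> z; exact: norm_cos_le1.
under eq_Rintegral => x _.
  under eq_Rintegral do rewrite XE addrCA.
  rewrite IH//.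
over.
rewrite RintegralZl//; last first.
  apply: (@measurable_bounded_integrable _ _ _ _ (fun x => cos (Z i x + phi))) => //.
  - by rewrite -ge0_fin_numE// fin_num_measure.
  - by apply: (measurableT_comp (@measurable_cos R)); apply: measurable_funD.
  - exists 1; split; rewrite ?num_real// => y My t _ /=.
    exact: le_trans (norm_cos_le1 _) (ltW My).
rewrite charZ mulrA -expRD JE big_setU1//= opprD addrC //.
Qed.
End independent_sum.

(** * Reduction to the chi-square law *)

Section linear_algebra.
Context {R : realType}.

Lemma sum_sqr_gt0 (n : nat) (v : 'rV[R]_n) : v != 0 -> 0 < \sum_j v 0 j ^+ 2.
Proof.
move=> v0; rewrite lt_def sumr_ge0 ?andbT => [|j _]; last exact: sqr_ge0.
apply: contraNneq v0 => /eqP; rewrite psumr_eq0 => [|j _]; last exact: sqr_ge0.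
move=> /allP H; apply/eqP/rowP => j; rewrite mxE.
by have := H j (mem_index_enum _); rewrite sqrf_eq0 => /eqP.
Qed.

Lemma exists_unit_kernel (p n : nat) (M : 'M[R]_(p, n)) : (\rank M < n)%N ->
  exists2 v : 'rV[R]_n, v *m v^T = 1%:M & v *m M^T = 0.
Proof.
move=> rM; have : kermx M^T != 0.
  by rewrite -mxrank_eq0 mxrank_ker mxrank_tr subn_eq0 -ltnNge.
move=> /rowV0Pn[v /sub_kermxP vM v0].
have vv := sum_sqr_gt0 v0; set s := \sum_j _ in vv.
exists ((Num.sqrt s)^-1 *: v); last by rewrite -scalemxAl vM scaler0.
apply/matrixP => i j; rewrite !ord1 -scalemxAl linearZ/= -scalemxAr !mxE.
rewrite (eq_bigr (fun j => v 0 j ^+ 2)) => [|l _]; last by rewrite mxE expr2.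
rewrite -/s mulrA -invfM -expr2 sqr_sqrtr ?(ltW vv)// eqxx mulVf ?gt_eqF//.
Qed.

(** Rows are chosen one by one. While [m < k], the next is a unit vector in the kernel of [M]
    stacked on the previous rows, whose rank is at most [\rank M + m < n]; from [k] on, only
    orthogonality to the previous rows is imposed. *)
Lemma exists_orthonormal_kernel (p n k : nat) (M : 'M[R]_(p, n)) : (\rank M + k <= n)%N ->
  exists O : 'M[R]_n, O *m O^T = 1%:M /\
    forall j : 'I_n, (j < k)%N -> row j O *m M^T = 0.
Proof.
move=> rMk.
have H m : (m <= n)%N -> exists r : nat -> 'rV[R]_n,
    (forall i j, (i < m)%N -> (j < m)%N -> r i *m (r j)^T = (i == j)%:R%:M) /\
    (forall i, (i < m)%N -> (i < k)%N -> r i *m M^T = 0).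
  elim: m => [_|m IH mn]; first by exists (fun=> 0).
  have [r [oo oM]] := IH (ltnW mn).
  pose W := \matrix_(i < m) r i.
  have rW : (\rank W <= m)%N by exact: rank_leq_row.
  have [v [vv vW vM]] : exists v : 'rV[R]_n, [/\ v *m v^T = 1%:M, v *m W^T = 0 &
      (m < k)%N -> v *m M^T = 0].
    have [mk|km] := ltnP m k.
      have [ |v vv] := @exists_unit_kernel _ _ (col_mx M W).
        have [h _] := mxrank_adds_leqif M W; rewrite addsmxE in h.
        apply: leq_ltn_trans h _; apply: leq_ltn_trans (leq_add (leqnn _) rW) _.
        by apply: leq_trans rMk; rewrite ltn_add2l.
      rewrite tr_col_mx mul_mx_row -row_mx0 => /eq_row_mx[vM vW].
      by exists v.
    have [v vv vW] := @exists_unit_kernel _ _ W (leq_ltn_trans rW mn).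
    by exists v; split => //; rewrite ltnNge km.
  have vo i : (i < m)%N -> v *m (r i)^T = 0.
    move=> im; apply/rowP => a; rewrite !ord1.
    have := congr1 (fun A : 'rV_m => A 0 (Ordinal im)) vW; rewrite !mxE => {2}<-.
    by apply: eq_bigr => l _; rewrite !mxE.
  exists (fun i => if i == m then v else r i); split => i.
    move=> j; rewrite !ltnS => im jm.
    have [{im}im|{im}im] : i = m \/ (i < m)%N by apply/predU1P; rewrite -leq_eqVlt.
      have [{jm}jm|{jm}jm] : j = m \/ (j < m)%N by apply/predU1P; rewrite -leq_eqVlt.
        by rewrite im jm eqxx vv.
      by rewrite im eqxx (ltn_eqF jm) (gtn_eqF jm) vo// raddf0.
    have [{jm}jm|{jm}jm] : j = m \/ (j < m)%N by apply/predU1P; rewrite -leq_eqVlt.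
      by rewrite jm eqxx (ltn_eqF im) -[LHS]trmxK trmx_mul trmxK vo// trmx0 raddf0.
    by rewrite (ltn_eqF im) (ltn_eqF jm) oo.
  rewrite ltnS => im ik; case: (ltngtP i m) im => // [im _|E _]; first by rewrite oM.
  by rewrite vM// -E.
have [r [oo oM]] := H n (leqnn n).
exists (\matrix_(i < n) r i); split; last by move=> j jk; rewrite rowK oM.
apply/row_matrixP => i; rewrite row_mul rowK; apply/rowP => j.
have := oo i j (ltn_ord i) (ltn_ord j) => /(congr1 (fun A : 'M[R]_(1, 1) => A 0 0)).
rewrite !mxE => h.
transitivity (\sum_l r i 0 l * (r j)^T l 0); first by apply: eq_bigr => l _; rewrite !mxE.
by rewrite h eqxx.
Qed.

Lemma cV_norm_sqr (n : nat) (x : 'cV[R]_n) : l2norm_col x ^+ 2 = (x^T *m x) 0 0.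
Proof.
rewrite /l2norm_col sqr_sqrtr ?sumr_ge0// => [|i _]; last exact: sqr_ge0.
by rewrite mxE; apply: eq_bigr => i _; rewrite mxE expr2.
Qed.

Lemma sum_mul_sqr_le (n : nat) (x y : 'I_n -> R) :
  (\sum_i x i * y i) ^+ 2 <= (\sum_i x i ^+ 2) * (\sum_i y i ^+ 2).
Proof.
set S := \sum_i x i * y i; set X := \sum_i x i ^+ 2; set Y := \sum_i y i ^+ 2.
have Y0 : 0 <= Y by apply: sumr_ge0 => i _; exact: sqr_ge0.
have [Yz|Yn] := eqVneq Y 0.
  have -> : S = 0.
    apply: big1 => i _; have := Yz => /eqP; rewrite psumr_eq0 => [|j _]; last exact: sqr_ge0.
    by move=> /allP/(_ i (mem_index_enum _)); rewrite sqrf_eq0 => /eqP ->; rewrite mulr0.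
  by rewrite Yz expr0n/= mulr0.
have Yp : 0 < Y by rewrite lt_def Yn.
have : 0 <= \sum_i (Y * x i - S * y i) ^+ 2 by apply: sumr_ge0 => i _; exact: sqr_ge0.
have -> : \sum_i (Y * x i - S * y i) ^+ 2 = Y * (X * Y - S ^+ 2).
  rewrite (eq_bigr (fun i => Y ^+ 2 * x i ^+ 2 - 2 * Y * S * (x i * y i) + S ^+ 2 * y i ^+ 2)).
    by rewrite big_split sumrB /= -!mulr_sumr -/S -/X -/Y; ring.
  by move=> i _; ring.
by rewrite pmulr_rge0// subr_ge0.
Qed.

Lemma cauchy_schwarz_cV (n : nat) (x y : 'cV[R]_n) :
  (x^T *m y) 0 0 <= l2norm_col x * l2norm_col y.
Proof.
have [S0|S0] := lerP ((x^T *m y) 0 0) 0.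
  by apply: (le_trans S0); rewrite mulr_ge0// sqrtr_ge0.
rewrite -(@ler_pXn2r _ 2)// ?nnegrE ?(ltW S0) ?mulr_ge0 ?sqrtr_ge0//.
rewrite exprMn !cV_norm_sqr !mxE.
have := sum_mul_sqr_le (fun i => x i 0) (fun i => y i 0).
by congr (_ ^+ 2 <= _ * _); apply: eq_bigr => i _; rewrite mxE ?expr2.
Qed.

Lemma sigma_min_le (n : nat) (V : 'M[R]_n) (x : 'cV[R]_n) :
  sigma_min V * l2norm_col x <= l2norm_col (V *m x).
Proof.
have scale (c : R) (y : 'cV[R]_n) : 0 <= c -> l2norm_col (c *: y) = c * l2norm_col y.
  move=> c0; rewrite /l2norm_col; under eq_bigr do rewrite mxE exprMn.
  by rewrite -mulr_sumr sqrtrM ?sqr_ge0// sqrtr_sqr ger0_norm.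
have [x0|x0] := eqVneq (l2norm_col x) 0; first by rewrite x0 mulr0 sqrtr_ge0.
have xp : 0 < l2norm_col x by rewrite lt_def x0 sqrtr_ge0.
set y := (l2norm_col x)^-1 *: x.
have y1 : l2norm_col y = 1 by rewrite scale ?invr_ge0 ?(ltW xp)// mulVf.
have -> : l2norm_col (V *m x) = l2norm_col (V *m y) * l2norm_col x.
  by rewrite -scalemxAr scale ?invr_ge0 ?(ltW xp)// mulrAC mulVf ?mul1r.
rewrite ler_pM2r//; apply: ge_inf; last by exists y.
by exists 0 => _ [z _ <-]; exact: sqrtr_ge0.
Qed.

Lemma posdef_unitmx (n : nat) (V : 'M[R]_n) : posdef V -> V \in unitmx.
Proof.
move=> [Vt Vp]; rewrite -row_free_unit -kermx_eq0; apply: contraT => /rowV0Pn[v /sub_kermxP vV v0].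
have vt0 : v^T != 0 by rewrite -(inj_eq trmx_inj) trmxK trmx0.
by have := Vp _ vt0; rewrite trmxK vV mul0mx mxE ltxx.
Qed.

(** This avoids the spectral theorem: with [b = invmx V *m a] the form equals [b^T a <= |b| |a|],
    and [C |b| <= |V b| = |a|]. *)
Lemma posdef_inv_form (n : nat) (V : 'M[R]_n) (C : R) (a : 'cV[R]_n) :
  posdef V -> 0 < C -> C <= sigma_min V -> a != 0 ->
  0 < (a^T *m invmx V *m a) 0 0 <= l2norm_col a ^+ 2 / C.
Proof.
move=> hV C0 hC a0; have uV := posdef_unitmx hV; have [Vt Vp] := hV.
set b := invmx V *m a.
have aE : a = V *m b by rewrite mulmxA mulmxV// mul1mx.
have b0 : b != 0 by apply: contraNneq a0 => b0; rewrite aE b0 mulmx0.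
have -> : a^T *m invmx V *m a = b^T *m V *m b by rewrite -mulmxA -/b {1}aE trmx_mul Vt.
rewrite Vp//= -mulmxA -aE ler_pdivlMr//.
apply: (@le_trans _ _ (l2norm_col b * l2norm_col a * C)).
  by rewrite ler_wpM2r ?(ltW C0)// cauchy_schwarz_cV.
rewrite expr2 mulrAC ler_wpM2r ?sqrtr_ge0// mulrC.
apply: le_trans (ler_wpM2r _ hC) _; first exact: sqrtr_ge0.
by rewrite [in leRHS]aE; exact: sigma_min_le.
Qed.

End linear_algebra.

(** * Borel sets of matrices *)

Section matrix_borel.
Context {R : realType}.

Lemma mx_borel_open (m n : nat) (U : set 'M[R]_(m, n)) : open U -> mx_borel U.
Proof. exact: sub_sigma_algebra. Qed.

Lemma continuous_form_lt (n : nat) (c : 'cV[R]_n) (b : R) :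
  open [set g : 'cV[R]_n | (c^T *m g) 0 0 < b].
Proof.
have cont : continuous (fun g : 'cV[R]_n => (c^T *m g) 0 0).
  rewrite (_ : (fun g : 'cV[R]_n => _) = (fun g => \sum_j c^T 0 j * g j 0)); last first.
    by apply/funext => g; rewrite mxE.
  have ac : continuous (fun x : R^o * R^o => x.1 + x.2).
    by move=> x; apply: cvgD; [exact: cvg_fst|exact: cvg_snd].
  apply: (continuous_big ac) => j _ g.
  by apply: (@continuousM R _ (fun=> c^T 0 j) (fun g : 'cV[R]_n => g j 0));
    [exact: cst_continuous|exact: coord_continuous].
have -> : [set g : 'cV[R]_n | (c^T *m g) 0 0 < b] =
    (fun g : 'cV[R]_n => (c^T *m g) 0 0) @^-1` [set x | x < b] by [].
by apply: open_comp => [g _|]; [exact: cont|exact: open_lt].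
Qed.

Context d (T : measurableType d).

Lemma mx_rv_coord (m n : nat) (X : T -> 'M[R]_(m, n)) i j : mx_rv X ->
  measurable_fun setT (fun w => X w i j).
Proof.
move=> mX; apply: (measurability _ (RGenInftyO.measurableE R)) => _ [_ [b ->] <-].
rewrite setTI.
have oU : open [set M : 'M[R]_(m, n) | M i j < b].
  apply: (open_comp (f := fun M : 'M[R]_(m, n) => M i j) (D := [set x | x < b])).
    by move=> g _; exact: coord_continuous.
  exact: open_lt.
have := mX _ (mx_borel_open oU).
by congr measurable; apply/seteqP; split => w /=; rewrite in_itv.
Qed.

(** An open set is a countable union of balls with rational centre and radius [1 / (k+1)], and a
    ball of matrices is a finite intersection of conditions on single entries. *)
Lemma measurable_mx_borel (m n : nat) (X : T -> 'M[R]_(m, n)) :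
  (forall i j, measurable_fun setT (fun w => X w i j)) -> mx_rv X.
Proof.
move=> mX S; pose A := [set S : set 'M[R]_(m, n) | measurable (X @^-1` S)].
apply: (_ : <<s open >> `<=` A); apply: smallest_sub.
  split.
  - by rewrite /A /= preimage_set0; exact: measurable0.
  - by move=> B mB; rewrite /A/= setTD preimage_setC; exact: measurableC.
  - by move=> F mF; rewrite /A/= preimage_bigcup; exact: bigcupT_measurable.
move=> U oU; rewrite /A/=.
pose box (p : 'M[rat]_(m, n) * nat) := ball (map_mx (fun q : rat => ratr q : R) p.1) (p.2.+1%:R^-1 : R).
have UE : U = \bigcup_(p in setT) (if `[< box p `<=` U >] then box p else set0).
  apply/seteqP; split => [M UM|M [p _]]; last by case: asboolP => // pU /pU.
  have /nbhs_ballP[e e0 eU] : nbhs M U by exact: open_nbhs_nbhs.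
  have [k ke] : exists k : nat, (k.+1%:R^-1 : R) < e / 2.
    have e20 : 0 < e / 2 by rewrite divr_gt0.
    exists (Num.truncn (e / 2)^-1); rewrite invf_plt ?posrE//; exact: truncnS_gt.
  set r : R := k.+1%:R^-1 in ke.
  have r0 : 0 < r by rewrite invr_gt0.
  have qE i j : exists q : rat, `|M i j - ratr q| < r.
    have /rat_in_itvoo[q] : M i j - r < M i j + r by lra.
    rewrite in_itv/= => /andP[h1 h2]; exists q; rewrite ltr_norml; apply/andP; split; lra.
  pose qi i := choice (qE i).
  pose Q : 'M[rat]_(m, n) := \matrix_(i, j) projT1 (qi i) j.
  have MQ : box (Q, k) M.
    by split => // i j; rewrite !mxE /ball/= distrC; exact: (projT2 (qi i)).
  exists (Q, k) => //; case: asboolP => // nU; exfalso; apply: nU => M' QM'.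
  apply: eU; apply: (@le_ball _ _ M (r + r)); first by lra.
  by apply: ball_triangle QM'; exact: ball_sym.
rewrite UE preimage_bigcup; apply: countable_bigcupT_measurable => [|p].
  exact: countableP.
case: ifPn => _; last by rewrite preimage_set0.
have -> : X @^-1` box p = \big[setI/setT]_(ij : 'I_m * 'I_n)
    [set w | `|ratr (p.1 ij.1 ij.2) - X w ij.1 ij.2| < (p.2.+1%:R^-1 : R)].
  apply/seteqP; split => w.
    move=> [_ wb]; apply: (big_ind (fun E : set T => E w)) => // ij _.
    by have := wb ij.1 ij.2; rewrite mxE.
  move=> wb; split => // i j; move: wb; rewrite (bigD1 (i, j))//= mxE => -[].
  by [].
apply: bigsetI_measurable => ij _.
have mf : measurable_fun setT (fun w => `|ratr (p.1 ij.1 ij.2) - X w ij.1 ij.2| : R).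
  by apply: (measurableT_comp (@normr_measurable R setT)); exact: measurable_funB.
have := mf measurableT _ (measurable_itv `]-oo, (p.2.+1%:R^-1 : R)[).
by rewrite setTI; congr measurable; apply/seteqP; split => w /=; rewrite in_itv.
Qed.

End matrix_borel.

(** * Gaussian vectors *)

Section gaussian_vectors.
Context {R : realType} d (T : measurableType d) (P : probability T R).

Lemma measurable_form (n : nat) (c : 'cV[R]_n) (g : T -> 'cV[R]_n) : mx_rv g ->
  measurable_fun setT (fun w => (c^T *m g w) 0 0).
Proof.
move=> mg; under eq_fun do rewrite mxE.
by apply: measurable_sum_cond => j; apply: measurable_funM => //; exact: mx_rv_coord.
Qed.

(** Dividing [c] by the standard deviation [s] of its functional yields a standard normal. The case
    [c = 0] is apart, because [gaussian_vec] speaks of nonzero functionals. *)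
Lemma gaussian_vec_char (n : nat) (V : 'M[R]_n) (g : T -> 'cV[R]_n) (c : 'cV[R]_n) phi :
  posdef V -> gaussian_vec P V g ->
  \int[P]_w cos ((c^T *m g w) 0 0 + phi) =
  expR (- ((c^T *m V *m c) 0 0 / 2)) * cos phi.
Proof.
move=> [Vt Vp] [mg law].
have [->|c0] := eqVneq c 0.
  under eq_Rintegral do rewrite trmx0 mul0mx mxE add0r.
  rewrite mulmx0 mxE mul0r oppr0 expR0 mul1r Rintegral_cst//.
  rewrite -[RHS]mulr1; congr (_ * _).
  by rewrite -[RHS]/(fine 1%E) -(probability_setT P).
have q0 := Vp _ c0; set q := (c^T *m V *m c) 0 0 in q0 *.
pose s := Num.sqrt q.
have s0 : 0 < s by rewrite sqrtr_gt0.
have s2 : s ^+ 2 = q by rewrite sqr_sqrtr// ltW.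
pose c' := s^-1 *: c.
have c'0 : c' != 0 by rewrite scaler_eq0 invr_eq0 gt_eqF.
have ct : c'^T = s^-1 *: c^T by rewrite /c' linearZ.
have q1 : (c'^T *m V *m c') 0 0 = 1.
  rewrite ct -!scalemxAl -scalemxAr scalerA mxE -/q -s2.
  by rewrite -invfM -expr2 mulVf// expf_neq0// gt_eqF.
have H A : measurable A -> P ((fun w => (c'^T *m g w) 0 0) @^-1` A) = normal_prob 0 1 A.
  by move=> mA; rewrite law// q1 sqrtr1.
have := std_normal_char (measurable_form c' mg) H s phi; rewrite s2 => <-.
apply: eq_Rintegral => w _; congr (cos (_ + _)).
by rewrite ct -scalemxAl [in RHS]mxE mulrA divff ?mul1r// gt_eqF.
Qed.

Lemma gaussian_family_char (nu n : nat) (V : 'M[R]_n) (g : 'I_nu -> T -> 'cV[R]_n)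
    (c : 'I_nu -> 'cV[R]_n) phi :
  posdef V -> (forall i, gaussian_vec P V (g i)) -> mutually_independent P g ->
  \int[P]_w cos (\sum_i ((c i)^T *m g i w) 0 0 + phi) =
  expR (- \sum_i (((c i)^T *m V *m c i) 0 0 / 2)) * cos phi.
Proof.
move=> hV hg ind.
have mg i : mx_rv (g i) by have [] := hg i.
have := @independent_sum_char R 'I_nu _ T P (fun i w => ((c i)^T *m g i w) 0 0)
  (fun i => ((c i)^T *m V *m c i) 0 0 / 2) _ _ _ [set: 'I_nu]%SET phi.
have sT (F : 'I_nu -> R) : \sum_(i in [set: 'I_nu]%SET) F i = \sum_i F i.
  by apply: eq_bigl => i; rewrite finset.in_setT.
rewrite sT => <-; first by under [in RHS]eq_Rintegral do rewrite sT.
- by move=> i; exact: measurable_form.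
- by move=> i psi; exact: gaussian_vec_char.
- move=> b J.
  (* [mutually_independent] speaks of the whole family; the full space at indices outside [J] yields
     subfamilies. *)
  pose S i : set 'cV[R]_n := if i \in J then [set v | ((c i)^T *m v) 0 0 < b i] else setT.
  have mS i : mx_borel (S i).
    rewrite /S; case: (i \in J); apply: mx_borel_open; last exact: openT.
    exact: continuous_form_lt.
  have -> : [set w | forall i, i \in J -> ((c i)^T *m g i w) 0 0 < b i] =
      [set w | forall i, S i (g i w)].
    apply/seteqP; split => w h i; rewrite /S; first by case: ifPn => // /h.
    by move=> iJ; have := h i; rewrite /S iJ.
  rewrite ind// [RHS]big_mkcond/=; apply: eq_bigr => i _; rewrite /S; case: (i \in J) => //.
  by rewrite preimage_setT; exact: probability_setT.
Qed.

End gaussian_vectors.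

Section privacy_by_sections.
Context {R : realType} d1 d2 (T1 : measurableType d1) (T2 : measurableType d2).
Variables (P1 : probability T1 R) (P2 : probability T2 R).

(** The inequality holds conditionally on the first component with constants independent of it, so
    it survives integration against a probability. *)
Lemma product_privacy (A0 A1 : set (T1 * T2)) (a delta : R) :
  measurable A0 -> measurable A1 -> 0 <= a -> 0 <= delta ->
  (forall x, (P2 (xsection A0 x) <= a%:E * P2 (xsection A1 x) + delta%:E)%E) ->
  ((P1 \x P2) A0 <= a%:E * (P1 \x P2) A1 + delta%:E)%E.
Proof.
move=> mA0 mA1 a0 delta0 H; rewrite /product_measure1.
have m0 := measurable_fun_xsection P2 mA0; have m1 := measurable_fun_xsection P2 mA1.
have -> : delta%:E = (\int[P1]_x delta%:E)%E.
  rewrite integral_cst// -[LHS]mule1; congr (_ * _)%E.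
  exact/esym/(probability_setT P1).
rewrite -ge0_integralZl// -ge0_integralD//; last 2 first.
- by move=> x _; rewrite mule_ge0.
- by apply: emeasurable_funM.
apply: ge0_le_integral => //.
  by apply: emeasurable_funD => //; apply: emeasurable_funM.
by move=> x _; exact: H.
Qed.

End privacy_by_sections.

Section rotation.
Context {R : realType} (nu : nat) d (T : measurableType d) (P : probability T R).
Variable x : 'I_nu -> T -> R.
Hypothesis mx : forall i, measurable_fun setT (x i).
Hypothesis stdx : forall (u : 'I_nu -> R) phi,
  \int[P]_w cos (\sum_i u i * x i w + phi) = expR (- ((\sum_i u i ^+ 2) / 2)) * cos phi.
Variable O : 'M[R]_nu.
Hypothesis OO : O *m O^T = 1%:M.

Definition rotate (j : 'I_nu) (w : T) : R := \sum_i O j i * x i w.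

Lemma measurable_rotate j : measurable_fun setT (rotate j).
Proof. by apply: measurable_sum_cond => i; apply: measurable_funM. Qed.

Let tOO : O^T *m O = 1%:M. Proof. exact: mulmx1C. Qed.

Lemma rotateK i w : x i w = \sum_j O j i * rotate j w.
Proof.
transitivity (\sum_l (O^T *m O) i l * x l w).
  rewrite tOO (bigD1 i)//= mxE eqxx mul1r big1 ?addr0// => l li.
  by rewrite mxE eq_sym (negbTE li) mul0r.
under eq_bigr do rewrite mxE mulr_suml.
rewrite exchange_big/=; apply: eq_bigr => j _; rewrite /rotate mulr_sumr.
by apply: eq_bigr => l _; rewrite mxE mulrA.
Qed.

Lemma rotate_sqr_norm w : \sum_i x i w ^+ 2 = \sum_j rotate j w ^+ 2.
Proof.
transitivity (\sum_i \sum_j O j i * rotate j w * x i w).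
  by apply: eq_bigr => i _; rewrite expr2 {1}rotateK mulr_suml.
rewrite exchange_big/=; apply: eq_bigr => j _; rewrite expr2 {1}/rotate mulr_suml.
by apply: eq_bigr => i _; rewrite mulrAC.
Qed.

Lemma rotate_std (u : 'I_nu -> R) phi :
  \int[P]_w cos (\sum_j u j * rotate j w + phi) = expR (- ((\sum_j u j ^+ 2) / 2)) * cos phi.
Proof.
pose c i := \sum_j u j * O j i.
have sumc w : \sum_j u j * rotate j w = \sum_i c i * x i w.
  under [RHS]eq_bigr do rewrite mulr_suml.
  rewrite exchange_big/=; apply: eq_bigr => j _; rewrite /rotate mulr_sumr.
  by apply: eq_bigr => i _; rewrite mulrA.
under eq_Rintegral do rewrite sumc.
rewrite stdx; congr (expR (- (_ / 2)) * _).
transitivity (\sum_j \sum_l u j * u l * (O *m O^T) j l).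
  under eq_bigr => i _ do rewrite expr2 {1}/c mulr_suml.
  rewrite exchange_big/=; apply: eq_bigr => j _.
  under eq_bigr => i _ do rewrite /c mulr_sumr.
  rewrite exchange_big/=; apply: eq_bigr => l _.
  rewrite mxE mulr_sumr; apply: eq_bigr => i _; rewrite mxE; ring.
apply: eq_bigr => j _; rewrite (bigD1 j)//= big1 ?addr0 => [|l lj].
  by rewrite OO mxE eqxx mulr1 expr2.
by rewrite OO mxE eq_sym (negbTE lj) mulr0.
Qed.

End rotation.

Definition chi_square_private {R : realType} (m : nat) (q0 q1 a delta : R) :=
  forall c : R, 0 <= c -> (c%:E * chi_mass m.+1 setT = 1)%E ->
  forall S : set R, measurable S ->
  (c%:E * chi_mass m.+1 [set r | S (r + q0)%R] <=
   a%:E * (c%:E * chi_mass m.+1 [set r | S (r + q1)%R]) + delta%:E)%E.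

(** * Comparison given the residuals *)

Section fixed_residual.
Context {R : realType} (nu n m : nat) d (T : measurableType d) (P : probability T R).
Variable x : 'I_nu -> T -> R.
Hypothesis mx : forall i, measurable_fun setT (x i).
Hypothesis stdx : forall (u : 'I_nu -> R) phi,
  \int[P]_w cos (\sum_i u i * x i w + phi) = expR (- ((\sum_i u i ^+ 2) / 2)) * cos phi.
Variables (K : 'M[R]_n) (u v : 'cV[R]_n) (h : 'I_nu -> 'cV[R]_n).
Hypotheses (u0 : u != 0) (uh : forall i, u^T *m h i = 0) (num : (m.+2 + n = nu.+1)%N).
Variables (q0 q1 a delta : R).
Hypotheses (a0 : 0 <= a) (delta0 : 0 <= delta).
Hypothesis priv : chi_square_private m q0 q1 a delta.

Let X (q : R) w := K + q *: (v *m v^T) + \sum_i (x i w *: v + h i) *m (x i w *: v + h i)^T.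

Lemma fixed_residual_privacy (S : set 'M[R]_n) : mx_borel S ->
  (P (X q0 @^-1` S) <= a%:E * P (X q1 @^-1` S) + delta%:E)%E.
Proof.
move=> mS.
pose H : 'M[R]_(n, nu) := \matrix_(r, i) h i r 0.
(* The columns of [H] are the residuals, all orthogonal to the nonzero [u], so [\rank H <= n - 1];
   with [num], the kernel of [H] has dimension at least [m + 2]. *)
have rH : (\rank H + m.+2 <= nu)%N.
  rewrite -ltnS -num addnC ltn_add2l ltn_neqAle rank_leq_row andbT.
  rewrite -[_ == _]/(row_free H) -kermx_eq0; apply/rowV0Pn; exists u^T.
    apply/sub_kermxP/rowP => i; have := congr1 (fun A : 'M[R]_(1, 1) => A 0 0) (uh i).
    rewrite [in RHS]mxE => E; rewrite [RHS]mxE -[RHS]E !mxE.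
    by apply: eq_bigr => r _; rewrite !mxE.
  by rewrite -(inj_eq trmx_inj) trmxK trmx0.
have [W [WW WH]] := exists_orthonormal_kernel rH.
pose y := rotate x W.
have my j : measurable_fun setT (y j) by exact: measurable_rotate.
pose z (j : 'I_nu) := \sum_i W j i *: h i.
have z0 (j : 'I_nu) : (j < m.+2)%N -> z j = 0.
  move=> jm; apply/colP => r; have := congr1 (fun A : 'rV_n => A 0 r) (WH j jm).
  rewrite [in RHS]mxE => E; rewrite summxE [RHS]mxE -[RHS]E mxE.
  by apply: eq_bigr => i _; rewrite !mxE.
pose J : {set 'I_nu} := [set j : 'I_nu | (m.+2 <= j)%N]%SET.
(* When the products are expanded, the squares sum to the squared norm of [y], and the cross terms
   involve only the rotated coordinates in [J], where [z] may be nonzero. The first [m + 2]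
   coordinates survive only in [r], through their sum of squares. *)
pose Phi (f : 'I_nu -> R) (r : R) : 'M[R]_n :=
  K + \sum_i h i *m (h i)^T + \sum_(j in J) f j *: (v *m (z j)^T + z j *m v^T) +
  (r + \sum_(j in J) f j ^+ 2) *: (v *m v^T).
pose chi (f : 'I_nu -> R) := \sum_(j in ~: J) f j ^+ 2.
have XE q w : X q w = Phi (y ^~ w) (chi (y ^~ w) + q).
  have sumxh : \sum_i x i w *: h i = \sum_(j in J) y j w *: z j.
    transitivity (\sum_j y j w *: z j); last first.
      rewrite [RHS]big_mkcond/=; apply: eq_bigr => j _; rewrite inE.
      by case: leqP => // jm; rewrite z0// scaler0.
    under eq_bigr => i _ do rewrite (rotateK _ WW) scaler_suml.
    rewrite exchange_big/=; apply: eq_bigr => j _; rewrite /z scaler_sumr.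
    by apply: eq_bigr => i _; rewrite scalerA mulrC.
  have sumx2 : \sum_i x i w ^+ 2 = chi (y ^~ w) + \sum_(j in J) y j w ^+ 2.
    rewrite (rotate_sqr_norm _ WW) (bigID (mem J))/= addrC; congr (_ + _).
    by apply: eq_bigl => j; rewrite finset.in_setC.
  have term i : (x i w *: v + h i) *m (x i w *: v + h i)^T =
      x i w ^+ 2 *: (v *m v^T) + v *m (x i w *: h i)^T + (x i w *: h i) *m v^T + h i *m (h i)^T.
    rewrite linearD/= !linearZ/= mulmxDl !mulmxDr -!scalemxAl -!scalemxAr scalerA expr2 !addrA.
    by [].
  rewrite /X /Phi (eq_bigr _ (fun i _ => term i)) !big_split/=.
  rewrite -scaler_suml sumx2 -mulmx_sumr -mulmx_suml -linear_sum sumxh.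
  set Z := \sum_(j in J) y j w *: z j.
  have -> : \sum_(j in J) y j w *: (v *m (z j)^T + z j *m v^T) = v *m Z^T + Z *m v^T.
    rewrite /Z linear_sum mulmx_sumr mulmx_suml -big_split/=; apply: eq_bigr => j _.
    by rewrite linearZ/= -scalemxAr -scalemxAl scalerDr.
  rewrite -[matrix_trmx__canonical__GRing_Linear _ _ _ Z]/(Z^T).
  move: (v *m Z^T) (Z *m v^T) (\sum_(i < nu) h i *m (h i)^T) (v *m v^T) => A B C D.
  move: (chi _) (\sum_(j in J) _) => s1 s2.
  by apply/matrixP => i j; rewrite !mxE; ring.
pose event q : set (@rvec R 'I_nu) := [set f | S (Phi f (chi f + q))].
have mchi : measurable_fun setT (fun f : @rvec R 'I_nu => chi f).
  by apply: measurable_sum_cond => j; apply: measurable_funX; exact: measurable_coord.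
have mPhi d' (T' : measurableType d') (F : T' -> @rvec R 'I_nu) (r : T' -> R) :
    (forall j, measurable_fun setT (fun t => F t j)) -> measurable_fun setT r ->
    measurable [set t | S (Phi (F t) (r t))].
  move=> mF mr.
  apply: (@measurable_mx_borel R _ T' n n (fun t => Phi (F t) (r t)) _ S mS) => i j.
  pose G t : R := (K + \sum_i h i *m (h i)^T) i j +
    \sum_(l in J) F t l * (v *m (z l)^T + z l *m v^T) i j +
    (r t + \sum_(l in J) F t l ^+ 2) * (v *m v^T) i j.
  have mG : measurable_fun setT G.
    apply: measurable_funD.
      apply: measurable_funD => //.
      by apply: measurable_sum_cond => l; apply: measurable_funM.
    apply: measurable_funM => //; apply: measurable_funD => //.
    by apply: measurable_sum_cond => l; apply: measurable_funX.
  rewrite (_ : (fun t => _) = G)//; apply/funext => t.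
  rewrite /Phi /G [LHS]mxE [X in X + _ = _]mxE [X in _ + X = _]mxE summxE.
  by congr (_ + _ + _); apply: eq_bigr => l _; rewrite mxE.
have mevent q : measurable (event q).
  by apply: mPhi; [exact: measurable_coord|exact: measurable_funD].
pose Y := split_pair y J.
pose sp w : @rvec R 'I_nu := Y ^~ w.
have mY j : measurable_fun setT (Y j) by exact: measurable_split_pair.
(* The coordinates in [J] are read from the first sample point and the chi-square block from the
   second, so a section fixes everything except the chi-square variable. *)
have law q : P (X q @^-1` S) = (P \x P)%E (sp @^-1` (event q)).
  rewrite -(std_gaussian_split my (rotate_std stdx WW) J (mevent q)).
  by congr (P _); apply/seteqP; split => w /=; rewrite XE.
rewrite !law; apply: product_privacy => //.
- by rewrite -[X in measurable X]setTI; apply: (measurable_rvec mY).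
- by rewrite -[X in measurable X]setTI; apply: (measurable_rvec mY).
move=> w.
have cJ : #|(~: J)%SET| = m.+2.
  have -> : (~: J)%SET = [set j : 'I_nu | (j < m.+2)%N]%SET.
    by apply/setP => j; rewrite !inE -ltnNge.
  have mnu : (m.+2 <= nu)%N by apply: leq_trans rH; rewrite leq_addl.
  rewrite cardsE -sum1_card -[RHS]card_ord -sum1_card.
  by rewrite (big_ord_widen _ (fun=> 1%N) mnu).
have [c c0 chiE] := chi_law my (rotate_std stdx WW) cJ.
pose S' : set R := [set r | S (Phi (fun j => y j w) r)].
have mS' : measurable S'.
  by apply: (mPhi _ R (fun=> (fun j => y j w)) id) => //.
have mSq q : measurable [set r | S' (r + q)].
  have mg : measurable_fun setT (fun r : R => r + q) by exact: measurable_funD.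
  by have := mg measurableT S' mS'; rewrite setTI.
have PhiE w' q : Phi (sp (w, w')) (chi (sp (w, w')) + q) =
    Phi (fun j => y j w) (\sum_(j in ~: J) y j w' ^+ 2 + q).
  have YJ j : j \in J -> sp (w, w') j = y j w by move=> jJ; rewrite /sp /Y /split_pair jJ.
  have YC j : j \in ~: J -> sp (w, w') j = y j w'.
    by rewrite finset.in_setC => jJ; rewrite /sp /Y /split_pair (negbTE jJ).
  have -> : chi (sp (w, w')) = \sum_(j in ~: J) y j w' ^+ 2.
    by apply: eq_bigr => j jJ; rewrite YC.
  rewrite /Phi; congr (_ + _ + (_ + _) *: _); apply: eq_bigr => j jJ; by rewrite YJ.
have secE q : P (xsection (sp @^-1` (event q)) w) = (c%:E * chi_mass m.+1 [set r | S' (r + q)%R])%E.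
  rewrite -chiE//; congr (P _); apply/seteqP.
  by split => w'; rewrite /xsection /= inE /event /= PhiE.
rewrite !secE; apply: priv => //.
have := chiE setT measurableT; rewrite preimage_setT => <-.
exact: probability_setT.
Qed.

End fixed_residual.

(** * Comparison with random residuals *)

Section rank_one.
Context {R : realType} (nu n m : nat) d (T : measurableType d) (P : probability T R).
Variables (V : 'M[R]_n) (g : 'I_nu -> T -> 'cV[R]_n).
Hypotheses (hV : posdef V) (hg : forall i, gaussian_vec P V (g i)).
Hypothesis indg : mutually_independent P g.
Variables (K : 'M[R]_n) (u : 'cV[R]_n).
Hypotheses (u1 : (u^T *m V *m u) 0 0 = 1) (num : (m.+2 + n = nu.+1)%N).
Variables (q0 q1 a delta : R).
Hypotheses (a0 : 0 <= a) (delta0 : 0 <= delta).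
Hypothesis priv : chi_square_private m q0 q1 a delta.

Let v := V *m u.
Let x i w : R := (u^T *m g i w) 0 0.
Let h i w : 'cV[R]_n := g i w - x i w *: v.

Let mg i : mx_rv (g i). Proof. by have [] := hg i. Qed.

Let mx i : measurable_fun setT (x i).
Proof. exact: measurable_form. Qed.

Let mh i r : measurable_fun setT (fun w => h i w r 0).
Proof.
rewrite (_ : (fun w => _) = (fun w => g i w r 0 - x i w * v r 0)); last first.
  by apply/funext => w; rewrite !mxE.
apply: measurable_funB; first exact: mx_rv_coord.
exact: measurable_funM.
Qed.

Let u0 : u != 0.
Proof.
apply/eqP => u0; have := u1; rewrite u0 mulmx0 mxE => /eqP.
by rewrite eq_sym oner_eq0.
Qed.

Let uv : u^T *m v = 1%:M.
Proof. by apply/matrixP => i j; rewrite !ord1 /v mulmxA u1 mxE. Qed.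

Let uh i w : u^T *m h i w = 0.
Proof.
rewrite /h mulmxBr -scalemxAr uv; apply/matrixP => r s.
by rewrite !ord1 !mxE /= mulr1 [x i w]mxE subrr.
Qed.

Let gE i w : g i w = x i w *: v + h i w.
Proof. by rewrite addrC subrK. Qed.

Let stdx (s : 'I_nu -> R) phi :
  \int[P]_w cos (\sum_i s i * x i w + phi) = expR (- ((\sum_i s i ^+ 2) / 2)) * cos phi.
Proof.
have := gaussian_family_char (fun i => s i *: u) phi hV hg indg.
have tZ i : (s i *: u)^T = s i *: u^T by rewrite linearZ.
have -> : \sum_i ((s i *: u)^T *m V *m (s i *: u)) 0 0 / 2 = (\sum_i s i ^+ 2) / 2.
  rewrite mulr_suml; apply: eq_bigr => i _.
  by rewrite tZ -!scalemxAl -scalemxAr scalerA [LHS]mulrC mxE u1 mulr1 mulrC expr2.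
move=> <-; apply: eq_Rintegral => w _; congr (cos (_ + _)); apply: eq_bigr => i _.
by rewrite tZ -scalemxAl [RHS]mxE.
Qed.

Let I : finType := ('I_nu + 'I_nu * 'I_n)%type.

Let Y (k : I) (w : T) : R :=
  match k with inl i => x i w | inr ir => h ir.1 w ir.2 0 end.

Let mY k : measurable_fun setT (Y k).
Proof. by case: k => [i|[i r]] /=; [exact: mx|exact: mh]. Qed.

Let J : {set I} := [set k : I | if k is inr _ then true else false]%SET.

Let resid (f : I -> R) (i : 'I_nu) : 'cV[R]_n := \col_r f (inr (i, r)).

(** Since [h i = g i - x i *: v], any combination of [x i] and the entries of [h i] is a linear
    functional of [g i]; this is its vector. The subtracted product with [v] accounts for the [x i]
    hidden in [h i]. *)
Let coefficient (f : I -> R) (i : 'I_nu) : 'cV[R]_n :=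
  (f (inl i) - ((resid f i)^T *m v) 0 0) *: u + resid f i.

Let sumY f w : \sum_k f k * Y k w = \sum_i ((coefficient f i)^T *m g i w) 0 0.
Proof.
have pairE : \sum_(p : 'I_nu * 'I_n) f (inr p) * h p.1 w p.2 0 =
    \sum_i \sum_r f (inr (i, r)) * h i w r 0.
  by rewrite pair_bigA; apply: eq_bigr => -[i r].
rewrite big_sumType/= pairE.
rewrite -big_split/=; apply: eq_bigr => i _.
have -> : \sum_r f (inr (i, r)) * h i w r 0 = ((resid f i)^T *m h i w) 0 0.
  by rewrite mxE; apply: eq_bigr => r _; rewrite !mxE.
have -> : (coefficient f i)^T = (f (inl i) - ((resid f i)^T *m v) 0 0) *: u^T + (resid f i)^T.
  by rewrite /coefficient linearD/= linearZ.
rewrite mulmxDl -scalemxAl [RHS]mxE [X in _ = X + _]mxE -/(x i w).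
rewrite /h mulmxBr -scalemxAr [X in _ + X = _]mxE [X in _ + (_ + X) = _]mxE [X in _ + (_ - X) = _]mxE.
by ring.
Qed.

Let Q f : R := \sum_i (((coefficient f i)^T *m V *m coefficient f i) 0 0 / 2).

Let charY f phi : \int[P]_w cos (\sum_k f k * Y k w + phi) = expR (- Q f) * cos phi.
Proof.
under eq_Rintegral do rewrite sumY.
exact: gaussian_family_char.
Qed.

(* [x i] and [h i] are uncorrelated since [V *m u = v] and [u^T *m v = 1]. *)
Let splitQ f : Q f = Q (restrict_to J f) + Q (restrict_to (~: J)%SET f).
Proof.
rewrite /Q -big_split/=; apply: eq_bigr => i _.
have rJ : resid (restrict_to J f) i = resid f i.
  by apply/colP => r; rewrite !mxE /restrict_to !inE.
have lJ : restrict_to J f (inl i) = 0 by rewrite /restrict_to !inE.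
have rC : resid (restrict_to (~: J)%SET f) i = 0.
  by apply/colP => r; rewrite !mxE /restrict_to !inE.
have lC : restrict_to (~: J)%SET f (inl i) = f (inl i) by rewrite /restrict_to !inE.
rewrite /coefficient rJ lJ rC lC trmx0 mul0mx [(0 : 'M[R]_(1, 1)) 0 0]mxE subr0 add0r addr0.
set t := resid f i; set s := f (inl i); set b := (t^T *m v) 0 0.
have [Vt _] := hV.
have tVu : t^T *m V *m u = b%:M.
  by rewrite -mulmxA -/v; apply/matrixP => p q; rewrite !ord1 [RHS]mxE.
have uVt : u^T *m V *m t = b%:M.
  by have := congr1 trmx tVu; rewrite !trmx_mul trmxK Vt tr_scalar_mx mulmxA.
have uVu : u^T *m V *m u = 1%:M by rewrite -mulmxA uv.
have tZ c : (c *: u)^T = c *: u^T by rewrite linearZ.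
have tD c : (c *: u + t)^T = c *: u^T + t^T by rewrite linearD/= tZ.
have quadu c : ((c *: u)^T *m V *m (c *: u)) 0 0 = c ^+ 2.
  by rewrite tZ -!scalemxAl -scalemxAr scalerA uVu !mxE mulr1 expr2.
have quad c : ((c *: u + t)^T *m V *m (c *: u + t)) 0 0 = c ^+ 2 + 2 * c * b + (t^T *m V *m t) 0 0.
  rewrite tD !mulmxDl -!scalemxAl !mulmxDr -!scalemxAr uVu uVt tVu.
  by rewrite !mxE /= !mulr1n; ring.
by rewrite !quad quadu; field.
Qed.

Let X (q : R) w := K + q *: (v *m v^T) + \sum_i g i w *m (g i w)^T.

Lemma rank_one_privacy (S : set 'M[R]_n) : mx_borel S ->
  (P (X q0 @^-1` S) <= a%:E * P (X q1 @^-1` S) + delta%:E)%E.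
Proof.
move=> mS.
pose Phi q (f : I -> R) : 'M[R]_n := K + q *: (v *m v^T) +
  \sum_i (f (inl i) *: v + resid f i) *m (f (inl i) *: v + resid f i)^T.
pose event q : set (@rvec R I) := [set f | S (Phi q f)].
have mevent q : measurable (event q).
  apply: (@measurable_mx_borel R _ (@rvec R I) n n (Phi q) _ S mS) => i j.
  pose G (f : @rvec R I) : R := (K + q *: (v *m v^T)) i j +
    \sum_l (f (inl l) * v i 0 + f (inr (l, i))) * (f (inl l) * v j 0 + f (inr (l, j))).
  have mcf l r : measurable_fun setT (fun f : @rvec R I => f (inl l) * v r 0 + f (inr (l, r))).
    apply: measurable_funD; last exact: measurable_coord.
    by apply: measurable_funM => //; exact: measurable_coord.
  have mG : measurable_fun setT G.
    apply: measurable_funD => //; apply: measurable_sum_cond => l.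
    by apply: measurable_funM; exact: mcf.
  rewrite (_ : (fun f => _) = G)//; apply/funext => f.
  rewrite /Phi /G [LHS]mxE summxE; congr (_ + _); apply: eq_bigr => l _.
  by rewrite mxE big_ord1 !mxE.
have XE q w : X q w = Phi q (Y ^~ w).
  rewrite /X /Phi; congr (_ + _); apply: eq_bigr => i _.
  have -> : resid (Y ^~ w) i = h i w by apply/colP => r; rewrite mxE.
  by rewrite /= -gE.
(* The residuals come from the first sample point and the [x i] from the second, so fixing the first
   leaves standard normal [x i] with constant residuals. *)
pose sp w : @rvec R I := split_pair Y J ^~ w.
have law q : P (X q @^-1` S) = (P \x P)%E (sp @^-1` event q).
  rewrite -(split_law_char mY charY splitQ (mevent q)); congr (P _).
  by apply/seteqP; split => w /=; rewrite /event /= XE.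
have msp : measurable_fun setT sp by apply: measurable_rvec => k; exact: measurable_split_pair.
rewrite !law; apply: product_privacy => //.
- by rewrite -[X in measurable X]setTI; exact: msp.
- by rewrite -[X in measurable X]setTI; exact: msp.
move=> w.
have secE q : P (xsection (sp @^-1` event q) w) =
    P ((fun w' => K + q *: (v *m v^T) +
      \sum_i (x i w' *: v + h i w) *m (x i w' *: v + h i w)^T) @^-1` S).
  have PhiE w' : Phi q (sp (w, w')) = K + q *: (v *m v^T) +
      \sum_i (x i w' *: v + h i w) *m (x i w' *: v + h i w)^T.
    rewrite /Phi; congr (_ + _); apply: eq_bigr => i _.
    have -> : resid (sp (w, w')) i = h i w.
      by apply/colP => r; rewrite mxE /sp /split_pair inE.
    by rewrite /sp /split_pair inE.
  by congr (P _); apply/seteqP; split => w'; rewrite /xsection /= inE /event /= PhiE.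
rewrite !secE.
exact: (fixed_residual_privacy mx stdx K v u0 (h := h ^~ w) (uh ^~ w) num a0 delta0 priv mS).
Qed.

End rank_one.

(** * From the chi-square bounds to one row *)

Section privacy_step.
Context {R : realType}.

Section chi_square.
Variables (eps w Q L p : R) (m : nat).
Hypotheses (w01 : 0 < w < 1) (pQ : 0 <= p <= Q) (rate : 2 * L <= m.+2%:R * w ^+ 2).

Let p0 : 0 <= p. Proof. by case/andP: pQ. Qed.

Lemma chi_square_private_add :
  chi_square_private m p 0 (expR (loss_add w Q m)) (expR (- L)).
Proof.
move=> c c0 mass1 S mS; have /andP[w0 w1] := w01.
have r1_gt0 : 0 < m.+2%:R * (1 + 7 / 8 * w) ^+ 2.
  by rewrite mulr_gt0// exprn_gt0//; lra.
have -> : [set r | S (r + 0)] = S by apply/seteqP; split => r /=; rewrite addr0.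
apply: (le_trans (chi_square_add c0 p0 r1_gt0 (loss_addP m w01 pQ) mS)).
rewrite leeD2l//.
apply: le_trans (_ : _ <= ((1 + 7 / 8 * w) ^+ m.+2 *
    expR (- (m.+2%:R / 2 * ((1 + 7 / 8 * w) ^+ 2 - 1))))%:E)%E _.
  apply: (chi_square_chernoff c0 mass1) => //; first lra.
  move=> r /=; rewrite in_itv/= andbT => r1r.
  apply: mulr_ge0; last by rewrite subr_ge0 ltW.
  rewrite subr_ge0 invf_le1 ?exprn_gt0//; last lra.
  by rewrite expr_ge1//; lra.
by rewrite lee_fin; exact: upper_chernoff_rate.
Qed.

Hypotheses (eps01 : 0 < eps < 1) (Qle : Q * (2 * w) <= eps * (1 - w) ^+ 2).
Hypothesis kw : 4 <= m.+2%:R * w ^+ 2.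

Let Q0 : 0 <= Q. Proof. by apply: le_trans p0 _; case/andP: pQ. Qed.

Lemma chi_square_private_sub :
  chi_square_private m 0 p (expR (loss_sub w Q m)) (expR (- L)).
Proof.
move=> c c0 mass1 S mS; have /andP[w0 w1] := w01.
have pr0 : p < m.+2%:R * (1 - 7 / 8 * w) ^+ 2.
  by apply: le_lt_trans (loss_sub_lt eps01 w01 Q0 Qle kw); case/andP: pQ.
have -> : [set r | S (r + 0)] = S by apply/seteqP; split => r /=; rewrite addr0.
apply: (le_trans (chi_square_sub c0 p0 pr0 (loss_subP eps01 w01 Q0 Qle kw pQ) mS)).
rewrite leeD2l//.
apply: le_trans (_ : _ <= ((1 - 7 / 8 * w) ^+ m.+2 *
    expR (- (m.+2%:R / 2 * ((1 - 7 / 8 * w) ^+ 2 - 1))))%:E)%E _.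
  apply: (chi_square_chernoff c0 mass1) => //; first lra.
  move=> r /=; rewrite in_itv/= => rr0.
  apply: mulr_le0; last by rewrite subr_le0 ltW.
  rewrite subr_le0 invf_ge1 ?exprn_gt0//; last lra.
  by rewrite expr_le1//; lra.
by rewrite lee_fin; exact: lower_chernoff_rate.
Qed.

End chi_square.

Lemma rank_one_normalize n (V : 'M[R]_n) (C : R) (a : 'cV[R]_n) :
  posdef V -> 0 < C -> C <= sigma_min V -> a != 0 ->
  exists (p : R) (u : 'cV[R]_n), [/\ 0 <= p <= l2norm_col a ^+ 2 / C, (u^T *m V *m u) 0 0 = 1 &
    a *m a^T = p *: ((V *m u) *m (V *m u)^T)].
Proof.
move=> hV C0 hC a0; have /andP[p0 pQ] := posdef_inv_form hV C0 hC a0.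
set p := (_ *m _) 0 0 in p0 pQ.
have Vu : V \in unitmx := posdef_unitmx hV.
have [Vt _] := hV.
have VVa : V *m (invmx V *m a) = a by rewrite mulmxA mulmxV// mul1mx.
have sp : (Num.sqrt p)^-1 * (Num.sqrt p)^-1 = p^-1.
  by rewrite -expr2 exprVn sqr_sqrtr// ltW.
exists p, ((Num.sqrt p)^-1 *: (invmx V *m a)); split.
- by rewrite (ltW p0).
- rewrite -mulmxA -scalemxAr VVa.
  have -> : ((Num.sqrt p)^-1 *: (invmx V *m a))^T = (Num.sqrt p)^-1 *: (a^T *m invmx V).
    by rewrite linearZ/= trmx_mul trmx_inv Vt.
  by rewrite -scalemxAl -scalemxAr scalerA sp mxE -/p mulVf// gt_eqF.
- rewrite -scalemxAr VVa linearZ/= -scalemxAl -scalemxAr !scalerA -mulrA sp mulfV ?scale1r//.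
  by rewrite gt_eqF.
Qed.

Section wishart.
Context d (T : measurableType d) (P : probability T R).
Variables (n nu m : nat) (V : 'M[R]_n) (C Q e delta : R) (N : T -> 'M[R]_n).
Hypotheses (hV : posdef V) (C0 : 0 < C) (hC : C <= sigma_min V).
Hypotheses (num : (m.+2 + n = nu.+1)%N) (hN : wishart P V nu N).
Hypotheses (e1 : 1 <= e) (delta0 : 0 <= delta).
Variables (K : 'M[R]_n) (a : 'cV[R]_n) (S : set 'M[R]_n).
Hypotheses (aQ : l2norm_col a ^+ 2 / C <= Q) (mS : mx_borel S).

(** For the case [a = 0]: there is no direction to normalize, but the two events coincide. *)
Let trivial (A : set T) : (P A <= e%:E * P A + delta%:E)%E.
Proof.
rewrite -[leLHS]adde0; apply: leeD; last by rewrite lee_fin.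
by apply: lee_pemull => //; rewrite lee_fin.
Qed.

Lemma wishart_add_privacy :
  (forall p, 0 <= p <= Q -> chi_square_private m p 0 e delta) ->
  (P ((fun w => K + a *m a^T + N w)%R @^-1` S) <=
   e%:E * P ((fun w => K + N w)%R @^-1` S) + delta%:E)%E.
Proof.
move=> priv; have [->|a0] := eqVneq a 0.
  rewrite mul0mx addr0; exact: trivial.
have [p [u [/andP[p0 pa] u1 aE]]] := rank_one_normalize hV C0 hC a0.
have pQ : 0 <= p <= Q by rewrite p0 (le_trans pa).
have [g [hg [indg NE]]] := hN.
have := rank_one_privacy hV hg indg K u1 num (le_trans ler01 e1) delta0 (priv p pQ) mS.
by rewrite (funext NE) /= -aE scale0r addr0.
Qed.

Lemma wishart_sub_privacy :
  (forall p, 0 <= p <= Q -> chi_square_private m 0 p e delta) ->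
  (P ((fun w => K + N w)%R @^-1` S) <=
   e%:E * P ((fun w => K + a *m a^T + N w)%R @^-1` S) + delta%:E)%E.
Proof.
move=> priv; have [->|a0] := eqVneq a 0.
  rewrite mul0mx addr0; exact: trivial.
have [p [u [/andP[p0 pa] u1 aE]]] := rank_one_normalize hV C0 hC a0.
have pQ : 0 <= p <= Q by rewrite p0 (le_trans pa).
have [g [hg [indg NE]]] := hN.
have := rank_one_privacy hV hg indg K u1 num (le_trans ler01 e1) delta0 (priv p pQ) mS.
by rewrite (funext NE) /= -aE scale0r addr0.
Qed.

End wishart.

Lemma gram_row n d (A : 'M[R]_(n, d)) (i : 'I_n) :
  A^T *m A = (\sum_(j | j != i) (row j A)^T *m row j A) + (row i A)^T *m row i A.
Proof.
transitivity (\sum_j (row j A)^T *m row j A); last by rewrite (bigD1 i)//= addrC.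
apply/matrixP => r s; rewrite summxE !mxE; apply: eq_bigr => j _.
by rewrite !mxE big_ord1 !mxE.
Qed.

(** From [e^(-1/6) >= 5/6] follows [e <= (6/5)^6 = 2.985984]. The bound is what fits the first loss
    factor times [delta / 4] into [3 delta / 4]. *)
Lemma expR1_le3 : expR 1 <= 3 :> R.
Proof.
have e6 : expR (6^-1) <= 6 / 5 :> R.
  have := @expR_ge1Dx R (- 6^-1); rewrite expRN => h.
  have : 5 / 6 <= (expR (6^-1))^-1 :> R by apply: le_trans h; lra.
  rewrite -[_ / 6]invrK lef_pV2 ?posrE ?expR_gt0//; lra.
have -> : expR 1 = expR (6^-1) ^+ 6 :> R by rewrite -expRM_natl mulfV.
apply: le_trans (_ : (6 / 5) ^+ 6 <= _); last by lra.
by apply: lerXn2r => //; rewrite nnegrE ?expR_ge0//; lra.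
Qed.

End privacy_step.

Lemma l2norm_col_tr (R : realType) d (x : 'rV[R]_d) : l2norm_col x^T = l2norm_row x.
Proof. by congr Num.sqrt; apply: eq_bigr => j _; rewrite mxE. Qed.

(** * Translation of the parameters *)

Section parameters.
Context {R : realType} (eps delta B C1 C2 : R).
Hypotheses (eps01 : 0 < eps < 1) (delta_bd : 0 < delta < (expR 1)^-1) (B0 : 0 < B).
Hypotheses (C10 : 0 < C1) (C21 : 1 < C2).

Lemma sqrtV_lt1 : 0 < (Num.sqrt C2)^-1 < 1.
Proof.
rewrite invr_gt0 sqrtr_gt0 (lt_trans ltr01)//=.
by rewrite invf_lt1 ?sqrtr_gt0 ?(lt_trans ltr01)// -sqrtr1 ltr_sqrt// (lt_trans ltr01).
Qed.

(** For [s = 1 / w] one has [s / (s - 1)^2 = w / (1 - w)^2]; this is the form in which the loss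
    estimates consume the hypothesis. *)
Lemma sensitivity_scaled :
  2 * Num.sqrt C2 / (C1 * (Num.sqrt C2 - 1) ^+ 2) <= eps / B ^+ 2 ->
  B ^+ 2 / C1 * (2 * (Num.sqrt C2)^-1) <= eps * (1 - (Num.sqrt C2)^-1) ^+ 2.
Proof.
have /andP[w0 w1] := sqrtV_lt1.
have s0 : 0 < Num.sqrt C2 by rewrite -invr_gt0.
have s1 : 1 < Num.sqrt C2 by rewrite -invf_lt1.
move: (Num.sqrt C2) s0 s1 => s s0 s1 {w0 w1}.
have B20 : 0 < B ^+ 2 by rewrite exprn_gt0.
have s10 : 0 < (s - 1) ^+ 2 by rewrite exprn_gt0// subr_gt0.
move=> h; have {}h : 2 * s * B ^+ 2 <= eps * (C1 * (s - 1) ^+ 2).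
  have C1s : 0 < C1 * (s - 1) ^+ 2 by rewrite mulr_gt0.
  by move: h; rewrite ler_pdivrMr// [leRHS]mulrAC ler_pdivlMr.
have -> : B ^+ 2 / C1 * (2 * s^-1) = 2 * s * B ^+ 2 / (C1 * s ^+ 2).
  by field; rewrite !gt_eqF.
have -> : eps * (1 - s^-1) ^+ 2 = eps * (C1 * (s - 1) ^+ 2) / (C1 * s ^+ 2).
  by field; rewrite !gt_eqF.
by rewrite ler_pM2r// invr_gt0 mulr_gt0// exprn_gt0.
Qed.

(** [4 / delta > 4 e >= e^2], as [e <= 3]. This will give [k w^2 >= 4], which keeps the corrections
    of order [1 / k] in the losses small. *)
Lemma ln_delta_ge2 : 2 <= ln (4 / delta).
Proof.
have /andP[d0 d1] := delta_bd.
rewrite -(@expRK R 2) ler_ln ?posrE ?expR_gt0 ?divr_gt0//.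
rewrite ler_pdivlMr// -ler_pdivlMl ?expR_gt0//.
have -> : 2 = 1 + 1 :> R by [].
rewrite expRD invfM; apply: (le_trans (ltW d1)).
rewrite -mulrA ler_pMr ?invr_gt0 ?expR_gt0// ler_pdivlMl ?expR_gt0// mulr1.
by apply: (le_trans expR1_le3); lra.
Qed.

(** The floor gives only [d + 2 C2 L < nu + 1], but [m + 2] is [nu + 1 - d], so nothing is lost.
    That [2 C2 L >= 4] ensures that the subtraction defining [m] does not truncate. *)
Lemma degrees_of_freedom (d nu : nat) :
  (Num.floor (d%:R + 2 * C2 * ln (4 / delta)) <= nu%:Z)%R ->
  exists2 m : nat, (m.+2 + d = nu.+1)%N &
    2 * ln (4 / delta) <= m.+2%:R * (Num.sqrt C2)^-1 ^+ 2.
Proof.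
have := ln_delta_ge2; move: (ln (4 / delta)) => L L2 hnu.
have C20 : 0 < C2 by rewrite (lt_trans ltr01).
have nuL : d%:R + 2 * C2 * L < nu.+1%:R.
  apply: lt_le_trans (floorD1_gt _) _.
  have -> : nu.+1%:R = (nu%:Z + 1)%:~R :> R by rewrite -natr1 intrD.
  by rewrite ler_int lerD2r.
have L4 : 4 <= 2 * C2 * L.
  have : 0 <= (C2 - 1) * (L - 2) by rewrite mulr_ge0 ?subr_ge0// ltW.
  by have := C21; lra.
have dnu : (d + 2 <= nu.+1)%N.
  by rewrite -(ler_nat R) natrD; lra.
have num : ((nu.+1 - (d + 2)).+2 + d = nu.+1)%N.
  by rewrite -addn2 -addnA [(2 + d)%N]addnC subnK.
move: (nu.+1 - (d + 2))%N num => m num; exists m => //.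
rewrite exprVn (sqr_sqrtr (ltW C20)) ler_pdivlMr//.
by move: nuL; rewrite -num natrD; lra.
Qed.

End parameters.

Theorem theoremB3 (R : realType) (eps delta B C1 C2 : R)
  (heps : 0 < eps < 1) (hdelta : 0 < delta < (expR 1)^-1) (hB : 0 < B)
  (hC1 : 0 < C1) (hC2 : 1 < C2)
  (hC : 2 * Num.sqrt C2 / (C1 * (Num.sqrt C2 - 1) ^+ 2) <= eps / B ^+ 2)
  (n d nu : nat) (V : 'M[R]_d) (hV : posdef V) (hsV : C1 <= sigma_min V)
  (hnu : (Num.floor (d%:R + 2 * C2 * ln (4 / delta)) <= nu%:Z)%R)
  (dT : measure_display) (T : measurableType dT) (P : probability T R)
  (N : T -> 'M[R]_d) (hN : wishart P V nu N) :
  diff_private P B eps delta (fun (A : 'M[R]_(n, d)) w => A^T *m A + N w).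
Proof.
move=> A A' rA rA' [i [_ AA']] S mS.
have w01 := sqrtV_lt1 hC2.
have Qw := sensitivity_scaled hB hC1 hC2 hC.
have L2 := ln_delta_ge2 hdelta.
have [m num rate] := degrees_of_freedom hdelta hC2 hnu.
have /andP[d0 d1] := hdelta.
have deltaE : expR (- ln (4 / delta)) = delta / 4.
  by rewrite expRN lnK ?invf_div// posrE divr_gt0.
have Q0 : 0 <= B ^+ 2 / C1 by rewrite divr_ge0 ?sqr_ge0// ltW.
have colQ (M : 'M[R]_(n, d)) : rows_bounded B M ->
    l2norm_col ((row i M)^T) ^+ 2 / C1 <= B ^+ 2 / C1.
  by move=> rM; rewrite l2norm_col_tr ler_pM2r ?invr_gt0// lerXn2r ?nnegrE ?sqrtr_ge0 ?(ltW hB)//.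
move: (Num.sqrt C2)^-1 (B ^+ 2 / C1) (ln (4 / delta)) w01 Qw L2 rate deltaE Q0 colQ
  => w Q L w01 Qw L2 rate deltaE Q0 colQ.
have kw : 4 <= m.+2%:R * w ^+ 2 by apply: le_trans rate; lra.
have add0 := loss_add_ge0 m w01 Q0.
(* The case [p = 0] of [loss_subP], whose left-hand side vanishes. *)
have sub0 : 0 <= loss_sub w Q m.
  have := @loss_subP R eps w Q m heps w01 Q0 Qw kw 0; rewrite lexx Q0 => /(_ isT).
  by rewrite !mul0r mulr0 subr0.
have losses := lossD_le heps w01 Q0 Qw kw.
have d4 : 0 <= delta / 4 by lra.
(* The Gram matrix of the rows shared by [A] and [A']; the two comparisons meet at [K + N], the
   output with row [i] deleted. *)
pose K := \sum_(j | j != i) (row j A)^T *m row j A.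
have AE w' : A^T *m A + N w' = K + (row i A)^T *m ((row i A)^T)^T + N w'.
  by rewrite trmxK (gram_row A i).
have AE' w' : A'^T *m A' + N w' = K + (row i A')^T *m ((row i A')^T)^T + N w'.
  rewrite trmxK (gram_row A' i) /K; congr (_ + _ + _).
  by apply: eq_bigr => j ji; rewrite AA'.
rewrite (funext AE) (funext AE').
have e1 x : 0 <= x -> 1 <= expR x :> R by move=> x0; rewrite -expR0 ler_expR.
have add := wishart_add_privacy hV hC1 hsV num hN (e1 _ add0) d4 K (colQ A rA) mS
  (fun p pQ => ltac:(rewrite -deltaE; exact: chi_square_private_add)).
have sub := wishart_sub_privacy hV hC1 hsV num hN (e1 _ sub0) d4 K (colQ A' rA') mS
  (fun p pQ => ltac:(rewrite -deltaE; exact: (chi_square_private_sub w01 pQ rate heps Qw kw))).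
apply: (le_trans add).
(* Composition: the tail of the second step is multiplied by the loss factor of the first. *)
apply: le_trans (_ : _ <= (expR (loss_add w Q m))%:E * ((expR (loss_sub w Q m))%:E *
    P ((fun w => K + (row i A')^T *m ((row i A')^T)^T + N w)%R @^-1` S) + (delta / 4)%:E) +
    (delta / 4)%:E)%E _.
  by rewrite leeD2r// lee_wpmul2l// lee_fin expR_ge0.
rewrite muleDr// ?ge0_adde_def ?inE ?mule_ge0//.
rewrite muleA -addeA -!EFinM -EFinD -expRD; apply: leeD.
  by apply: lee_wpmul2r => //; rewrite lee_fin ler_expR.
rewrite lee_fin.
(* [loss_add <= eps < 1] because [loss_sub] is nonnegative, so the tails total at most
   [3 delta / 4 + delta / 4]. *)
have : expR (loss_add w Q m) <= 3.
  apply: le_trans expR1_le3; rewrite ler_expR.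
  by have /andP[_ e1'] := heps; lra.
nra.
Qed.
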